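(* Let $x_1,x_2$ be two distinct points of $\mathbb{S}^2$. Then $$\Gamma_2(B_2(\mathbb{S}^2\setminus\{x_1,x_2\}))\cong\Gamma_2(\mathbb{F}_2(a,b))\rtimes\mathbb{Z},$$ where $\mathbb{F}_2(a,b)$ is the free group of rank $2$ on $a,b$, and the action of (a generator of) $\mathbb{Z}$ on $\Gamma_2(\mathbb{F}_2(a,b))$ is given by conjugation by $b^{-1}a$.
   Context: For a surface $M$, $F_m(M)=\{(y_1,\ldots,y_m)\in M^m: y_i\neq y_j\text{ if }i\neq j\}$, and $B_m(M)=\pi_1(F_m(M)/S_m)$ is the $m$-string braid group of $M$. $\Gamma_2(G)=[G,G]$. In $N\rtimes Q$ the normal subgroup is $N$. *)

(* Defs.v *)
From HB Require Import structures.
From mathcomp Require Import all_boot all_order all_algebra perm.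
From mathcomp Require Import generic_quotient lra.
From mathcomp Require Import all_classical reals topology normedtype homotopy.

Set Implicit Arguments.
Unset Strict Implicit.
Unset Printing Implicit Defensive.

Import Order.TTheory GRing.Theory Num.Theory.
Import numFieldNormedType.Exports.

Section FreeGroup.
Local Open Scope group_scope.
Local Open Scope quotient_scope.
Variable S : choiceType.

(* The letter (s, true) stands for s and (s, false) for s^-1. *)
Definition word := seq (S * bool).

Inductive word_equiv : word -> word -> Prop :=
| word_cancel u v s e : word_equiv (u ++ (s, e) :: (s, ~~ e) :: v) (u ++ v)
| word_refl u : word_equiv u u
| word_sym u v : word_equiv u v -> word_equiv v u
| word_trans u v w : word_equiv u v -> word_equiv v w -> word_equiv u w.

Definition word_rel (u v : word) : bool := `[< word_equiv u v >].

Lemma word_rel_refl : reflexive word_rel.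
Proof. by move=> u; apply/asboolP; exact: word_refl. Qed.

Lemma word_rel_sym : symmetric word_rel.
Proof.
by move=> u v; apply/asboolP/asboolP; exact: word_sym.
Qed.

Lemma word_rel_trans : transitive word_rel.
Proof.
by move=> v u w /asboolP uv /asboolP vw; apply/asboolP; exact: word_trans vw.
Qed.

Canonical word_equivrel :=
  EquivRel word_rel word_rel_refl word_rel_sym word_rel_trans.

Definition free_group : Type := {eq_quot word_equivrel}.

HB.instance Definition _ := Choice.on free_group.
HB.instance Definition _ := EqQuotient.on free_group.

Lemma word_equiv_catl w u v : word_equiv u v -> word_equiv (w ++ u) (w ++ v).
Proof.
elim=> {u v} [u v s e|u|u v _|u v t _ uv _ vt].
- by rewrite !catA; exact: word_cancel.
- exact: word_refl.
- exact: word_sym.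
- exact: word_trans vt.
Qed.

Lemma word_equiv_catr w u v : word_equiv u v -> word_equiv (u ++ w) (v ++ w).
Proof.
elim=> {u v} [u v s e|u|u v _|u v t _ uv _ vt].
- by rewrite -!catA /=; exact: word_cancel.
- exact: word_refl.
- exact: word_sym.
- exact: word_trans vt.
Qed.

Definition word_inv (w : word) : word := rev [seq (l.1, ~~ l.2) | l <- w].

Lemma word_inv_cat u v : word_inv (u ++ v) = word_inv v ++ word_inv u.
Proof. by rewrite /word_inv map_cat rev_cat. Qed.

Lemma word_invK : involutive word_inv.
Proof.
move=> w; rewrite /word_inv map_rev revK -map_comp -[RHS]map_id.
by apply: eq_map => -[s e] /=; rewrite negbK.
Qed.

Lemma word_equiv_inv u v :
  word_equiv u v -> word_equiv (word_inv u) (word_inv v).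
Proof.
elim=> {u v} [u v s e|u|u v _|u v t _ uv _ vt].
- rewrite -[_ :: _]/([:: (s, e); (s, ~~ e)] ++ v) !word_inv_cat -catA.
  by case: e; exact: word_cancel.
- exact: word_refl.
- exact: word_sym.
- exact: word_trans vt.
Qed.

Lemma word_equivV w : word_equiv (word_inv w ++ w) [::].
Proof.
elim: w => [|[s e] w IH]; first exact: word_refl.
rewrite -cat1s word_inv_cat -catA /=.
by case: e; apply: word_trans IH; exact: word_cancel.
Qed.

Lemma free_piP (u v : word) :
  \pi_free_group u = \pi_free_group v <-> word_equiv u v.
Proof. by split=> [/eqmodP/asboolP //|uv]; apply/eqmodP/asboolP. Qed.

Lemma free_reprP (u : word) : word_equiv (repr (\pi_free_group u)) u.
Proof. by apply/free_piP; rewrite reprK. Qed.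

Definition free_one : free_group := \pi_free_group [::].
Definition free_mul (x y : free_group) : free_group := \pi_free_group (repr x ++ repr y).
Definition free_inv (x : free_group) : free_group := \pi_free_group (word_inv (repr x)).

Lemma free_mulE (u v : word) :
  free_mul (\pi_free_group u) (\pi_free_group v) = \pi_free_group (u ++ v).
Proof.
apply/free_piP; apply: word_trans (word_equiv_catl _ (free_reprP v)).
exact: word_equiv_catr (free_reprP u).
Qed.

Lemma free_invE (u : word) : free_inv (\pi_free_group u) = \pi_free_group (word_inv u).
Proof. by apply/free_piP; apply: word_equiv_inv; exact: free_reprP. Qed.

Lemma freeW (P : free_group -> Prop) :
  (forall u : word, P (\pi_free_group u)) -> forall x, P x.
Proof. by move=> Ppi x; rewrite -[x]reprK. Qed.

Lemma free_mulA : associative free_mul.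
Proof.
by elim/freeW=> u; elim/freeW=> v; elim/freeW=> w; rewrite !free_mulE catA.
Qed.

Lemma free_mul1 : left_id free_one free_mul.
Proof. by elim/freeW=> u; rewrite free_mulE. Qed.

Lemma free_1mul : right_id free_one free_mul.
Proof. by elim/freeW=> u; rewrite free_mulE cats0. Qed.

Lemma free_mulV : left_inverse free_one free_inv free_mul.
Proof.
by elim/freeW=> u; rewrite free_invE free_mulE; apply/free_piP/word_equivV.
Qed.

Lemma free_Vmul : right_inverse free_one free_inv free_mul.
Proof.
elim/freeW=> u; rewrite free_invE free_mulE; apply/free_piP.
by rewrite -{1}(word_invK u); exact: word_equivV.
Qed.

HB.instance Definition _ := isGroup.Build free_group
  free_mulA free_mul1 free_1mul free_mulV free_Vmul.

Definition free_gen (s : S) : free_group := \pi_free_group [:: (s, true)].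

End FreeGroup.

Section CommutatorSubgroup.
Local Open Scope group_scope.
Local Open Scope classical_set_scope.
Variable G : groupType.

Definition is_subgroup (H : set G) : Prop :=
  [/\ H 1, (forall x y, H x -> H y -> H (x * y)) & (forall x, H x -> H x^-1)].

Definition gamma2 : set G :=
  smallest is_subgroup [set z | exists x y, z = [~ x, y]].

Lemma gamma2_subgroup : is_subgroup gamma2.
Proof.
split=> [H [[]]//|x y Hx Hy H HP|x Hx H HP]; have [[_ HM HV] _] := HP.
- by apply: HM; [exact: Hx|exact: Hy].
- by apply: HV; exact: Hx.
Qed.

Lemma gamma2_commg x y : gamma2 [~ x, y].
Proof. by move=> H [_]; apply; exists x, y. Qed.

Lemma gamma2_conj g x : gamma2 x -> gamma2 (g * x * g^-1).
Proof.
move=> xG; have [_ GM GV] := gamma2_subgroup.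
have -> : g * x * g^-1 = [~ g^-1, x^-1] * x.
  by rewrite /commg /conjg !invgK -!mulgA mulVg mulg1.
by apply: GM => //; exact: gamma2_commg.
Qed.

Definition Gamma2 : Type := set_type gamma2.
HB.instance Definition _ := SubChoice.on Gamma2.

Lemma gamma2_closed : group_closed (fun x : G => x \in gamma2).
Proof.
have [G1 GM GV] := gamma2_subgroup.
split=> [|x y]; rewrite -!topredE /= !inE // => xG yG.
by apply: GM => //; exact: GV.
Qed.

HB.instance Definition _ :=
  @SubChoice_isSubGroup.Build G _ Gamma2 gamma2_closed.

End CommutatorSubgroup.

Arguments gamma2 : clear implicits.

Section Semidirect.
Local Open Scope group_scope.

Record group_action (Q N : groupType) := GroupAction {
  gact :> Q -> N -> N;
  gactM : forall q, {morph gact q : x y / x * y};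
  gact1 : forall x, gact 1 x = x;
  gactA : forall p q x, gact (p * q) x = gact p (gact q x)
}.

Definition semidirect (Q N : groupType) (f : group_action Q N) : Type :=
  (N * Q)%type.

Variables (Q N : groupType) (f : group_action Q N).
Local Notation sd := (semidirect f).

HB.instance Definition _ := Choice.on sd.

Definition sd_one : sd := (1, 1).
Definition sd_mul (x y : sd) : sd :=
  (x.1 * f x.2 y.1, x.2 * y.2).
Definition sd_inv (x : sd) : sd := (f x.2^-1 x.1^-1, x.2^-1).

Lemma gact_1 q : f q 1 = 1.
Proof. by apply: (@mulgI _ (f q 1)); rewrite -gactM !mulg1. Qed.

Lemma sd_mulA : associative sd_mul.
Proof. by move=> x y z; rewrite /sd_mul /= gactM gactA !mulgA. Qed.

Lemma sd_mul1 : left_id sd_one sd_mul.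
Proof. by move=> [n q]; rewrite /sd_mul /= gact1 !mul1g. Qed.

Lemma sd_1mul : right_id sd_one sd_mul.
Proof. by move=> [n q]; rewrite /sd_mul /= gact_1 !mulg1. Qed.

Lemma sd_mulV : left_inverse sd_one sd_inv sd_mul.
Proof. by move=> [n q]; rewrite /sd_mul /= -gactM !mulVg gact_1. Qed.

Lemma sd_Vmul : right_inverse sd_one sd_inv sd_mul.
Proof.
by move=> [n q]; rewrite /sd_mul /= -gactA !mulgV gact1 mulgV.
Qed.

HB.instance Definition _ := isGroup.Build sd
  sd_mulA sd_mul1 sd_1mul sd_mulV sd_Vmul.

End Semidirect.

Definition group_isomorphic (G H : groupType) : Prop :=
  exists f : {multiplicative G -> H}, bijective f.

(* The additive group of integers, as a multiplicative groupType. *)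
Definition Zgroup : groupType := Algebra.to_multiplicative int.

Section ConjugationAction.
Local Open Scope group_scope.
Variables (G : groupType) (g : G).

Definition zexpg (n : int) : G :=
  match n with Posz k => g ^+ k | Negz k => g ^- k.+1 end.

Lemma zexpgS (n : int) : zexpg (n + 1)%R = zexpg n * g.
Proof.
case: n => [k|[|k]].
- by rewrite -[1%R]/(Posz 1) -PoszD addn1 [LHS]expgSr.
- by rewrite [LHS]/= mulVg.
- have -> : (Negz k.+1 + 1 = Negz k)%R by rewrite !NegzE -[k.+2]addn1 PoszD opprD addrNK.
  by rewrite /= [g ^+ k.+2]expgS invgM mulgVK.
Qed.

Lemma zexpgB (n : int) : zexpg (n - 1)%R = zexpg n * g^-1.
Proof. by rewrite -[n in RHS](subrK 1%R) zexpgS mulgK. Qed.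

Lemma zexpgD (m n : int) : zexpg (m + n)%R = zexpg m * zexpg n.
Proof.
elim/int_ind: n => [|n IH|n IH].
- by rewrite addr0 mulg1.
- by rewrite -addn1 PoszD addrA !zexpgS IH mulgA.
- by rewrite -addn1 PoszD opprD addrA !zexpgB IH mulgA.
Qed.

Lemma conjZ_subproof (n : int) (x : Gamma2 G) :
  zexpg n * val x * (zexpg n)^-1 \in gamma2 G.
Proof. by rewrite inE; apply: gamma2_conj; have := valP x; rewrite inE. Qed.

Definition conjZ_fun (n : Zgroup) (x : Gamma2 G) : Gamma2 G :=
  exist _ (zexpg n * val x * (zexpg n)^-1) (conjZ_subproof n x).

Lemma conjZ_funM n : {morph conjZ_fun n : x y / x * y}.
Proof.
by move=> x y; apply: val_inj; rewrite /= !mulgA mulgVK.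
Qed.

Lemma conjZ_fun1 x : conjZ_fun 1 x = x.
Proof. by apply: val_inj; rewrite /= invg1 mulg1 mul1g. Qed.

Lemma conjZ_funA p q x : conjZ_fun (p * q) x = conjZ_fun p (conjZ_fun q x).
Proof. by apply: val_inj; rewrite /= zexpgD invgM !mulgA. Qed.

(* The action of Z on Gamma_2(G) whose generator 1 acts by x |-> g x g^-1. *)
Definition conjZ : group_action Zgroup (Gamma2 G) :=
  GroupAction conjZ_funM conjZ_fun1 conjZ_funA.

End ConjugationAction.

Section UnitInterval.
Local Open Scope ring_scope.
Local Open Scope classical_set_scope.
Variable R : realType.

Definition unit_interval : Type := set_type (`[0, 1] : set R).
HB.instance Definition _ := Topological.on unit_interval.

Lemma clamp_subproof (r : R) :
  Num.min 1 (Num.max 0 r) \in (`[0, 1] : set R).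
Proof.
by rewrite inE /= in_itv /= ge_min lexx le_min ler01 le_max lexx.
Qed.

(* The retraction of R onto [0, 1]. *)
Definition clamp (r : R) : unit_interval :=
  exist (fun x => x \in (`[0, 1] : set R)) _ (clamp_subproof r).

Definition tval_itv (t : unit_interval) : R := val t.

Lemma tval_itv_ge0 t : 0 <= tval_itv t.
Proof. by have := valP t; rewrite inE /= in_itv /= => /andP[]. Qed.

Lemma tval_itv_le1 t : tval_itv t <= 1.
Proof. by have := valP t; rewrite inE /= in_itv /= => /andP[]. Qed.

Lemma val_clamp r : 0 <= r <= 1 -> tval_itv (clamp r) = r.
Proof. by move=> /andP[r0 r1]; rewrite /tval_itv /= max_r// min_r. Qed.

Lemma clampK t : clamp (tval_itv t) = t.
Proof. by apply: val_inj; rewrite -[LHS]/(tval_itv _) val_clamp// tval_itv_ge0 tval_itv_le1. Qed.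

Lemma zero_one_subproof : clamp 0 != clamp 1.
Proof.
apply/eqP => /(congr1 tval_itv); rewrite !val_clamp ?lexx ?ler01//.
by move/eqP; rewrite eq_sym oner_eq0.
Qed.

HB.instance Definition _ := isBiPointed.Build unit_interval zero_one_subproof.

Lemma tval0 : tval_itv (zero : unit_interval) = 0.
Proof. by rewrite val_clamp// lexx ler01. Qed.

Lemma tval1 : tval_itv (one : unit_interval) = 1.
Proof. by rewrite val_clamp// lexx ler01. Qed.

Lemma tval_continuous : continuous tval_itv.
Proof. exact: initial_continuous. Qed.

Lemma clamp_continuous : continuous clamp.
Proof.
have cm : continuous (cst 0 \max id : R -> R).
  by apply: max_fun_continuous => r; [exact: cvg_cst|exact: cvg_id].
have : continuous (cst 1 \min (cst 0 \max id) : R -> R).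
  by apply: min_fun_continuous => // r; exact: cvg_cst.
exact: (@continuous_comp_initial unit_interval R R val clamp).
Qed.

End UnitInterval.

Section Pasting.
Local Open Scope ring_scope.
Local Open Scope classical_set_scope.
Variables (R : realType) (X T : topologicalType).

Lemma continuous_paste (u : X -> R) (c : R) (f g : X -> T) :
  continuous u -> continuous f -> continuous g ->
  (forall x, u x = c -> f x = g x) ->
  continuous (fun x => if u x <= c then f x else g x).
Proof.
move=> cu cf cg fg; apply/continuous_closedP => A cA.
have -> : (fun x => if u x <= c then f x else g x) @^-1` A =
    (f @^-1` A `&` u @^-1` [set r | r <= c]) `|`
    (g @^-1` A `&` u @^-1` [set r | c <= r]).
  apply/seteqP; split=> x /=.
    by case: leP => uc Ax; [left|right; split=> //; exact: ltW].
  case=> [[Ax ->]//|[Ax cx]]; case: leP => // xc.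
  by rewrite fg//; apply/eqP; rewrite eq_le xc cx.
have clu (B : set R) : closed B -> closed (u @^-1` B).
  by move: cu => /continuous_closedP; apply.
apply: closedU; apply: closedI.
- by move: cf => /continuous_closedP; apply.
- by apply: clu; exact: closed_le.
- by move: cg => /continuous_closedP; apply.
- by apply: clu; exact: closed_ge.
Qed.

Lemma continuous_affine (a b : R) (u : X -> R) :
  continuous u -> continuous (fun x => a * u x + b).
Proof.
move=> cu x; apply: cvgD; last exact: cvg_cst.
by apply: cvgM; [exact: cvg_cst|exact: cu].
Qed.

Lemma continuous_clamp (u : X -> R) (f : unit_interval R -> T) :
  continuous u -> continuous f -> continuous (fun x => f (clamp (u x))).
Proof.
move=> cu cf x; apply: (@continuous_comp _ _ _ (fun x => clamp (u x)) f).
  by apply: (@continuous_comp _ _ _ u (@clamp R)); [exact: cu|exact: clamp_continuous].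
exact: cf.
Qed.

End Pasting.

Section PathOperations.
Local Open Scope ring_scope.
Variables (R : realType) (T : topologicalType).
Local Notation I := (unit_interval R).

Section Cat.
Variables (x y z : T).
Variables (p : {path I from x to y in T}) (q : {path I from y to z in T}).

(* clamp only serves to land in I: 2t and 2t - 1 already lie in [0, 1] on the
   branch where they are used. *)
Definition path_cat (t : I) : T :=
  if tval_itv t <= 2^-1 then p (clamp (2 * tval_itv t))
  else q (clamp (2 * tval_itv t - 1)).

Lemma path_cat_continuous : continuous path_cat.
Proof.
apply: continuous_paste => [|||t ->].
- exact: tval_continuous.
- under eq_fun do rewrite -[2 * _]addr0.
  apply: continuous_clamp; last exact: cts_fun.
  by apply: continuous_affine; exact: tval_continuous.
- apply: continuous_clamp; last exact: cts_fun.
  by apply: continuous_affine; exact: tval_continuous.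
- by rewrite divff ?pnatr_eq0// subrr path_one path_zero.
Qed.

Lemma path_cat_zero : path_cat zero = x.
Proof. by rewrite /path_cat tval0 invr_ge0 ler0n mulr0 path_zero. Qed.

Lemma path_cat_one : path_cat one = z.
Proof.
rewrite /path_cat tval1 ifF ?mulr1; last by apply/negP => h; lra.
have -> : 2 - 1 = 1 :> R by lra.
exact: path_one.
Qed.

HB.instance Definition _ := isContinuous.Build I T path_cat path_cat_continuous.
HB.instance Definition _ := isPath.Build I T x z path_cat path_cat_zero path_cat_one.
End Cat.

Section Rev.
Variables (x y : T) (p : {path I from x to y in T}).

Definition path_rev (t : I) : T := p (clamp (1 - tval_itv t)).

Lemma path_rev_continuous : continuous path_rev.
Proof.
rewrite /path_rev; under eq_fun do rewrite addrC -mulN1r.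
apply: continuous_clamp; last exact: cts_fun.
by apply: continuous_affine; exact: tval_continuous.
Qed.

Lemma path_rev_zero : path_rev zero = y.
Proof. by rewrite /path_rev tval0 subr0 path_one. Qed.

Lemma path_rev_one : path_rev one = x.
Proof. by rewrite /path_rev tval1 subrr path_zero. Qed.

HB.instance Definition _ := isContinuous.Build I T path_rev path_rev_continuous.
HB.instance Definition _ := isPath.Build I T y x path_rev path_rev_zero path_rev_one.
End Rev.

End PathOperations.

Lemma continuous_pair (X Y Z : topologicalType) (f : X -> Y) (g : X -> Z) :
  continuous f -> continuous g -> continuous (fun x => (f x, g x)).
Proof. by move=> cf cg x; apply: (cvg_pair (cf x) (cg x)). Qed.

Lemma continuous_tval_fst (R : realType) (X : topologicalType) :
  continuous (fun a : unit_interval R * X => tval_itv a.1).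
Proof.
move=> a; apply: (@continuous_comp _ _ _ fst (@tval_itv R)); first exact: cvg_fst.
exact: tval_continuous.
Qed.

Lemma continuous_tval_snd (R : realType) (X : topologicalType) :
  continuous (fun a : X * unit_interval R => tval_itv a.2).
Proof.
move=> a; apply: (@continuous_comp _ _ _ snd (@tval_itv R)); first exact: cvg_snd.
exact: tval_continuous.
Qed.

Section Homotopy.
Local Open Scope ring_scope.
Variables (R : realType) (T : topologicalType) (x y : T).
Local Notation I := (unit_interval R).

(* Homotopy relative to the endpoints; the first variable of H is the
   homotopy parameter. *)
Definition path_homotopic (p q : {path I from x to y in T}) : Prop :=
  exists H : I * I -> T,
    [/\ continuous H,
        (forall t, H (zero, t) = p t), (forall t, H (one, t) = q t),
        (forall s, H (s, zero) = x) & (forall s, H (s, one) = y)].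

Lemma path_homotopic_reparam (F : R -> T) (f g : R -> R)
    (p q : {path I from x to y in T}) :
  continuous F -> continuous f -> continuous g -> f 0 = g 0 -> f 1 = g 1 ->
  (forall t, p t = F (f (tval_itv t))) ->
  (forall t, q t = F (g (tval_itv t))) -> path_homotopic p q.
Proof.
move=> cF cf cg f0 f1 pE qE.
pose h (a : I * I) : R := (1 - tval_itv a.1) * f (tval_itv a.2) +
  tval_itv a.1 * g (tval_itv a.2).
exists (fun a => F (h a)); split.
- have ct1 := @continuous_tval_fst R I.
  have ct2 := @continuous_tval_snd R I.
  have cft : continuous (fun a : I * I => f (tval_itv a.2)).
    move=> a; apply: (@continuous_comp _ _ _ (fun a : I * I => tval_itv a.2) f).
      exact: ct2.
    exact: cf.
  have cgt : continuous (fun a : I * I => g (tval_itv a.2)).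
    move=> a; apply: (@continuous_comp _ _ _ (fun a : I * I => tval_itv a.2) g).
      exact: ct2.
    exact: cg.
  move=> a; apply: (@continuous_comp _ _ _ h F); last exact: cF.
  apply: cvgD; apply: cvgM.
  + by apply: cvgB; [exact: cvg_cst|exact: ct1].
  + exact: cft.
  + exact: ct1.
  + exact: cgt.
- by move=> t; rewrite /h /= tval0 subr0 mul1r mul0r addr0 pE.
- by move=> t; rewrite /h /= tval1 subrr mul1r mul0r add0r qE.
- move=> s; rewrite /h /= tval0 -f0 -mulrDl subrK mul1r.
  by have := pE zero; rewrite tval0 path_zero.
- move=> s; rewrite /h /= tval1 -f1 -mulrDl subrK mul1r.
  by have := pE one; rewrite tval1 path_one.
Qed.

Lemma path_homotopic_refl p : path_homotopic p p.
Proof.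
exists (p \o snd); split=> //=.
- by move=> a; apply: continuous_comp; [exact: cvg_snd|exact: cts_fun].
- by move=> _; rewrite path_zero.
- by move=> _; rewrite path_one.
Qed.

Lemma path_homotopic_sym p q : path_homotopic p q -> path_homotopic q p.
Proof.
case=> H [cH Hp Hq Hx Hy].
pose r (a : I * I) : I * I := (clamp (- 1 * tval_itv a.1 + 1), a.2).
exists (H \o r); split=> [|t|t|s|s]; rewrite /r //=.
- move=> a; apply: (@continuous_comp _ _ _ r H); last exact: cH.
  move: a; apply: continuous_pair => a; last exact: cvg_snd.
  apply: (@continuous_clamp R _ _ (fun a : I * I => - 1 * tval_itv a.1 + 1) id).
    by apply: continuous_affine; exact: continuous_tval_fst.
  by move=> b; exact: cvg_id.
- by rewrite tval0 mulr0 add0r Hq.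
- by rewrite tval1 mulr1 addNr Hp.
Qed.

Lemma path_homotopic_trans p q r :
  path_homotopic p q -> path_homotopic q r -> path_homotopic p r.
Proof.
case=> H [cH Hp Hq Hx Hy] [K [cK Kq Kr Kx Ky]].
have csnd : continuous (snd : I * I -> I) by move=> a; exact: cvg_snd.
have c1 (b : R) : continuous (fun a : I * I => clamp (2 * tval_itv a.1 + b)).
  apply: (@continuous_clamp R _ _ (fun a : I * I => 2 * tval_itv a.1 + b) id).
    by apply: continuous_affine; exact: continuous_tval_fst.
  by move=> a; exact: cvg_id.
have c2 (b : R) := continuous_pair (c1 b) csnd.
exists (fun a => if tval_itv a.1 <= 2^-1 then H (clamp (2 * tval_itv a.1 + 0), a.2)
  else K (clamp (2 * tval_itv a.1 - 1), a.2)); split=> [|t|t|s|s].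
- apply: continuous_paste => [|a|a|a ->].
  + exact: continuous_tval_fst.
  + by apply: continuous_comp; [exact: c2|exact: cH].
  + by apply: continuous_comp; [exact: c2|exact: cK].
  + by rewrite addr0 divff ?pnatr_eq0// subrr Hq Kq.
- by rewrite /= tval0 invr_ge0 ler0n mulr0 addr0 Hp.
- rewrite /= tval1 ifF; last by apply/negP => h; lra.
  have -> : 2 * 1 - 1 = 1 :> R by lra.
  exact: Kr.
- by case: ifP.
- by case: ifP.
Qed.

End Homotopy.

Section HomotopyLaws.
Local Open Scope ring_scope.
Variables (R : realType) (T : topologicalType).
Local Notation I := (unit_interval R).
Local Notation path x y := {path I from x to y in T}.

Lemma path_catEt x y z (p : path x y) (q : path y z) (t : I) :
  path_cat p q t =
    if tval_itv t <= 2^-1 then p (clamp (2 * tval_itv t))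
    else q (clamp (2 * tval_itv t - 1)).
Proof. by []. Qed.

Lemma path_catE x y z (p : path x y) (q : path y z) (r : R) : 0 <= r <= 1 ->
  path_cat p q (clamp r) =
    if r <= 2^-1 then p (clamp (2 * r)) else q (clamp (2 * r - 1)).
Proof. by move=> r01; rewrite /path_cat val_clamp. Qed.

Lemma path_homotopic_cat x y z (p p' : path x y) (q q' : path y z) :
  path_homotopic p p' -> path_homotopic q q' ->
  path_homotopic (path_cat p q) (path_cat p' q').
Proof.
case=> H [cH Hp Hp' Hx Hy] [K [cK Kq Kq' Kx Ky]].
have cfst : continuous (fst : I * I -> I) by move=> a; exact: cvg_fst.
have c1 (b : R) : continuous (fun a : I * I => clamp (2 * tval_itv a.2 + b)).
  apply: (@continuous_clamp R _ _ (fun a : I * I => 2 * tval_itv a.2 + b) id).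
    by apply: continuous_affine; exact: continuous_tval_snd.
  by move=> a; exact: cvg_id.
have c2 (b : R) := continuous_pair cfst (c1 b).
exists (fun a => if tval_itv a.2 <= 2^-1 then H (a.1, clamp (2 * tval_itv a.2 + 0))
  else K (a.1, clamp (2 * tval_itv a.2 - 1))); split=> [|t|t|s|s].
- apply: continuous_paste => [|a|a|a ->].
  + exact: continuous_tval_snd.
  + by apply: continuous_comp; [exact: c2|exact: cH].
  + by apply: continuous_comp; [exact: c2|exact: cK].
  + by rewrite addr0 divff ?pnatr_eq0// subrr Hy Kx.
- by rewrite /path_cat addr0 Hp Kq.
- by rewrite /path_cat addr0 Hp' Kq'.
- by rewrite /= tval0 invr_ge0 ler0n mulr0 addr0 Hx.
- rewrite /= tval1 ifF; last by apply/negP => h; lra.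
  have -> : 2 * 1 - 1 = 1 :> R by lra.
  exact: Ky.
Qed.

Lemma tval_itvP (t : I) : 0 <= tval_itv t <= 1.
Proof. by rewrite tval_itv_ge0 tval_itv_le1. Qed.

Lemma path_ext_continuous x y (p : path x y) : continuous (fun r : R => p (clamp r)).
Proof.
apply: (@continuous_clamp R _ _ id p); first by move=> r; exact: cvg_id.
exact: cts_fun.
Qed.

Lemma continuous_affineR (a b : R) : continuous (fun r : R => a * r + b).
Proof. by apply: (@continuous_affine R R a b id) => r; exact: cvg_id. Qed.

Lemma path_cat1p x y (p : path x y) :
  path_homotopic (path_cat (cst x : path x x) p) p.
Proof.
apply: (@path_homotopic_reparam _ _ _ _ (fun r => p (clamp r))
  (fun r : R => Num.max (0 : R) (2 * r + -1)) id) => [|||||t|t].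
- exact: path_ext_continuous.
- apply: (@max_fun_continuous _ _ R (fun=> 0)) => r; first exact: cvg_cst.
  exact: continuous_affineR.
- by move=> r; exact: cvg_id.
- by rewrite max_l//=; lra.
- by rewrite max_r//=; lra.
- rewrite [LHS]path_catEt; case: (leP (tval_itv t) 2^-1) => t2; last by rewrite max_r//=; lra.
  by rewrite max_l; [rewrite path_zero|lra].
- by rewrite clampK.
Qed.

Lemma path_catp1 x y (p : path x y) :
  path_homotopic (path_cat p (cst y : path y y)) p.
Proof.
apply: (@path_homotopic_reparam _ _ _ _ (fun r => p (clamp r))
  (fun r : R => Num.min (1 : R) (2 * r + 0)) id) => [|||||t|t].
- exact: path_ext_continuous.
- apply: (@min_fun_continuous _ _ R (fun=> 1)) => r; first exact: cvg_cst.
  exact: continuous_affineR.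
- by move=> r; exact: cvg_id.
- by rewrite min_r//=; lra.
- by rewrite min_l//=; lra.
- rewrite [LHS]path_catEt; case: (leP (tval_itv t) 2^-1) => t2; first by rewrite min_r ?addr0//=; lra.
  by rewrite min_l; [rewrite path_one|lra].
- by rewrite clampK.
Qed.

Lemma path_catpV x y (p : path x y) :
  path_homotopic (path_cat p (path_rev p)) (cst x : path x x).
Proof.
apply: (@path_homotopic_reparam _ _ _ _ (fun r => p (clamp r))
  (fun r => Num.min (2 * r + 0) (- 2 * r + 2)) (fun=> 0)) => [|||||t|t].
- exact: path_ext_continuous.
- by apply: min_fun_continuous; exact: continuous_affineR.
- by move=> r; exact: cvg_cst.
- by rewrite min_l//=; lra.
- by rewrite min_r//=; lra.
- rewrite [LHS]path_catEt; case: (leP (tval_itv t) 2^-1) => t2; first by rewrite min_l ?addr0//=; lra.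
  have := tval_itvP t => t01.
  rewrite min_r; last by lra.
  rewrite -[LHS]/(p (clamp (1 - tval_itv (clamp _)))) val_clamp; last by lra.
  by congr (p (clamp _)); lra.
- by rewrite path_zero.
Qed.

Lemma path_catVp x y (p : path x y) :
  path_homotopic (path_cat (path_rev p) p) (cst y : path y y).
Proof.
apply: (@path_homotopic_reparam _ _ _ _ (fun r => p (clamp r))
  (fun r => Num.max (- 2 * r + 1) (2 * r - 1)) (fun=> 1)) => [|||||t|t].
- exact: path_ext_continuous.
- by apply: max_fun_continuous; exact: continuous_affineR.
- by move=> r; exact: cvg_cst.
- by rewrite max_l//=; lra.
- by rewrite max_r//=; lra.
- have := tval_itvP t => t01.
  rewrite [LHS]path_catEt; case: (leP (tval_itv t) 2^-1) => t2; last by rewrite max_r//=; lra.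
  rewrite max_l; last by lra.
  rewrite -[LHS]/(p (clamp (1 - tval_itv (clamp _)))) val_clamp; last by lra.
  by congr (p (clamp _)); lra.
- by rewrite path_one.
Qed.

Lemma path_catA x y z w (p : path x y) (q : path y z) (r : path z w) :
  path_homotopic (path_cat p (path_cat q r)) (path_cat (path_cat p q) r).
Proof.
apply: path_homotopic_sym.
apply: (@path_homotopic_reparam _ _ _ _ (fun t => path_cat p (path_cat q r) (clamp t))
  (fun t => Num.min (2 * t + 0) (Num.min (1 * t + 4^-1) (2^-1 * t + 2^-1))) id)
  => [|||||t|t].
- exact: path_ext_continuous.
- apply: min_fun_continuous; first exact: continuous_affineR.
  by apply: min_fun_continuous; exact: continuous_affineR.
- by move=> t; exact: cvg_id.
- by rewrite min_l ?le_min; lra.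
- by rewrite (min_r (x := 1 * 1 + _)) ?min_r; lra.
- have := tval_itvP t; rewrite [LHS]path_catEt; move: (tval_itv t) => {}t t01.
  have [t2|t2] := leP t 2^-1; last first.
    rewrite (min_r (x := 1 * t + _)); last by lra.
    rewrite min_r; last by lra.
    rewrite [RHS]path_catE; last by lra.
    rewrite ifF; last by apply/negP; lra.
    rewrite [RHS]path_catE; last by lra.
    rewrite ifF; last by apply/negP; lra.
    by congr (r (clamp _)); lra.
  rewrite [LHS]path_catE; last by lra.
  have [t4|t4] := leP (2 * t) 2^-1.
    rewrite min_l; last by rewrite le_min; lra.
    rewrite [RHS]path_catE; last by lra.
    rewrite ifT; last by lra.
    by congr (p (clamp _)); lra.
  rewrite (min_l (x := 1 * t + _)); last by lra.
  rewrite min_r; last by lra.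
  rewrite [RHS]path_catE; last by lra.
  rewrite ifF; last by apply/negP; lra.
  rewrite [RHS]path_catE; last by lra.
  rewrite ifT; last by lra.
  by congr (q (clamp _)); lra.
- by rewrite clampK.
Qed.

End HomotopyLaws.

Section FundamentalGroup.
Local Open Scope quotient_scope.
Variables (R : realType) (T : topologicalType) (x : T).
Local Notation loop := {path (unit_interval R) from x to x in T}.

Definition loop_rel (p q : loop) : bool := `[< path_homotopic p q >].

Lemma loop_rel_refl : reflexive loop_rel.
Proof. by move=> p; apply/asboolP; exact: path_homotopic_refl. Qed.

Lemma loop_rel_sym : symmetric loop_rel.
Proof. by move=> p q; apply/asboolP/asboolP; exact: path_homotopic_sym. Qed.

Lemma loop_rel_trans : transitive loop_rel.
Proof.
move=> q p r /asboolP pq /asboolP qr.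
by apply/asboolP; exact: path_homotopic_trans qr.
Qed.

Canonical loop_equivrel :=
  EquivRel loop_rel loop_rel_refl loop_rel_sym loop_rel_trans.

Definition pi1 : Type := {eq_quot loop_equivrel}.
HB.instance Definition _ := Choice.on pi1.
HB.instance Definition _ := EqQuotient.on pi1.

Definition loop_cat (p q : loop) : loop := path_cat p q.
Definition loop_cst : loop := cst x.
Definition loop_rev (p : loop) : loop := path_rev p.

Lemma pi1_piP (p q : loop) : \pi_pi1 p = \pi_pi1 q <-> path_homotopic p q.
Proof. by split=> [/eqmodP/asboolP //|pq]; apply/eqmodP/asboolP. Qed.

Lemma pi1_reprP (p : loop) : path_homotopic (repr (\pi_pi1 p)) p.
Proof. by apply/pi1_piP; rewrite reprK. Qed.

Lemma pi1W (P : pi1 -> Prop) :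
  (forall p : loop, P (\pi_pi1 p)) -> forall a, P a.
Proof. by move=> Ppi a; rewrite -[a]reprK. Qed.

Definition pi1_one : pi1 := \pi_pi1 loop_cst.
Definition pi1_mul (a b : pi1) : pi1 := \pi_pi1 (loop_cat (repr a) (repr b)).
Definition pi1_inv (a : pi1) : pi1 := \pi_pi1 (loop_rev (repr a)).

Lemma pi1_mulE (p q : loop) :
  pi1_mul (\pi_pi1 p) (\pi_pi1 q) = \pi_pi1 (loop_cat p q).
Proof. by apply/pi1_piP; apply: path_homotopic_cat; exact: pi1_reprP. Qed.

Lemma pi1_mulA : associative pi1_mul.
Proof.
elim/pi1W=> p; elim/pi1W=> q; elim/pi1W=> r; rewrite !pi1_mulE.
by apply/pi1_piP; exact: path_catA.
Qed.

Lemma pi1_mul1 : left_id pi1_one pi1_mul.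
Proof. by elim/pi1W=> p; rewrite pi1_mulE; apply/pi1_piP; exact: path_cat1p. Qed.

Lemma pi1_1mul : right_id pi1_one pi1_mul.
Proof. by elim/pi1W=> p; rewrite pi1_mulE; apply/pi1_piP; exact: path_catp1. Qed.

Lemma pi1_mulV : left_inverse pi1_one pi1_inv pi1_mul.
Proof.
move=> a; rewrite -{2}[a]reprK pi1_mulE.
by apply/pi1_piP; exact: path_catVp.
Qed.

Lemma pi1_Vmul : right_inverse pi1_one pi1_inv pi1_mul.
Proof.
move=> a; rewrite -{1}[a]reprK pi1_mulE.
by apply/pi1_piP; exact: path_catpV.
Qed.

HB.instance Definition _ := isGroup.Build pi1
  pi1_mulA pi1_mul1 pi1_1mul pi1_mulV pi1_Vmul.

End FundamentalGroup.

Section ConfigurationSpace.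
Local Open Scope quotient_scope.
Local Open Scope classical_set_scope.
Variables (m : nat) (M : topologicalType).

(* {ptws 'I_m -> M} is M^m with the product topology. *)
Definition config : set {ptws 'I_m -> M} :=
  [set y | forall i j, i != j -> y i <> y j].

Definition perm_rel (y z : config) : bool :=
  `[< exists s : 'S_m, forall i, set_val z i = set_val y (s i) >].

Lemma perm_rel_refl : reflexive perm_rel.
Proof. by move=> y; apply/asboolP; exists 1%g => i; rewrite perm1. Qed.

Lemma perm_rel_sym : symmetric perm_rel.
Proof.
by move=> y z; apply/asboolP/asboolP=> -[s sE]; exists s^-1%g => i;
  rewrite sE permKV.
Qed.

Lemma perm_rel_trans : transitive perm_rel.
Proof.
move=> z y w /asboolP[s sE] /asboolP[t tE].
by apply/asboolP; exists (t * s)%g => i; rewrite tE sE permM.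
Qed.

Canonical perm_equivrel :=
  EquivRel perm_rel perm_rel_refl perm_rel_sym perm_rel_trans.

(* F_m(M) / S_m, with the quotient topology. *)
Definition unordered_config : topologicalType :=
  quotient_topology {eq_quot perm_equivrel}.

End ConfigurationSpace.

(* B_m(M), based at the unordered configuration c. *)
Definition braid_group (R : realType) (m : nat) (M : topologicalType)
  (c : unordered_config m M) : groupType := pi1 R c.

(* The norm of the library on 'rV[R]_3 is the sup norm, hence the explicit sum
   of squares. *)
Definition sphere2 (R : realType) : set 'rV[R]_3 :=
  [set v | \sum_i v ord0 i ^+ 2 = 1]%R%classic.

Arguments sphere2 : clear implicits.

Definition punctured_sphere2 (R : realType) (x1 x2 : 'rV[R]_3) :
  topologicalType := set_type (sphere2 R `\` [set x1; x2])%classic.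

Definition F2 : groupType := free_group 'I_2.
Definition F2_a : F2 := free_gen (ord0 : 'I_2).
Definition F2_b : F2 := free_gen (ord_max : 'I_2).

(* Main.v *)
(* A homeomorphism of the sphere minus two points with C* gives two distinct
   points y1, y2 the coordinates s = (y1 + y2) / (y1 - y2) in C \ {1, -1} and
   d = y1 - y2 in C*. Exchanging the points negates both, so the space of
   unordered pairs is the quotient of (C \ {1, -1}) x C* by a free involution.
   Along a loop in it, record the number of half turns of d and the word in a, b
   spelled by the crossings of s through two cuts, one for each puncture, that
   negation exchanges. This identifies the braid group with F2 x| Z, where the
   generator of Z swaps a and b. The commutator subgroup of F2 x| Z is the kernel
   of the total exponent on F2; its elements are the x (b^-1 a)^n with x in
   Gamma_2(F2), and n, being the exponent of a, is determined by the element. *)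

(* The record along a loop is the holonomy of a cocycle with values in a discrete group,
   multiplicative only for nearby points; homotopy invariance comes from small squares. Injectivity
   is obtained without van Kampen. A fixed path from the base point to every point places all path
   classes in one group. In each convex chart the class of a segment is the image of its holonomy
   under a morphism from F2 or Z to the fundamental group; this propagates to all paths, so trivial
   holonomy means null-homotopic. Triangles avoiding the punctures supply the relations.

   The obstacle in passing to the quotient is that counting turns of d at a fixed cut is not
   invariant under negation, which moves the cut to the opposite ray. The two counts differ by a
   coboundary. Once full turns count twice, [kappa] absorbs it, by adding a half turn on the sheet
   where d is not positive, where it also swaps a and b. The parity of the holonomy tells whether a
   loop lifts to a closed path; one of trivial holonomy does, and both components of the lift are
   null-homotopic. *)
Require Import Defs.
From HB Require Import structures.
From mathcomp Require Import all_boot all_order all_algebra.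
From mathcomp Require Import perm generic_quotient zify ring lra.
From mathcomp Require Import all_classical reals topology normedtype homotopy.

Set Implicit Arguments.
Unset Strict Implicit.
Unset Printing Implicit Defensive.
Import Order.TTheory GRing.Theory Num.Theory.
Import numFieldNormedType.Exports.

(** * The group F2 x| Z *)

Section Morphisms.
Local Open Scope group_scope.
Variables (G H : groupType) (f : G -> H).
Hypothesis fM : {morph f : x y / x * y}.

Lemma morph_one : f 1 = 1.
Proof. by apply: (@mulgI _ (f 1)); rewrite -fM !mulg1. Qed.

Lemma morph_inv x : f x^-1 = (f x)^-1.
Proof. by apply: (@mulgI _ (f x)); rewrite -fM !mulgV morph_one. Qed.

Lemma morph_commg x y : f [~ x, y] = [~ f x, f y].
Proof. by rewrite /commg /conjg !(fM, morph_inv). Qed.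

Lemma morph_zexpg g n : f (zexpg g n) = zexpg (f g) n.
Proof.
have fX k : f (g ^+ k) = f g ^+ k.
  by elim: k => [|k IH]; rewrite ?expg0 ?morph_one// !expgS fM IH.
by case: n => k; rewrite /zexpg ?morph_inv fX.
Qed.

Lemma gamma2_ind (P : G -> Prop) : P 1 -> (forall x y, P x -> P y -> P (x * y)) ->
  (forall x, P x -> P x^-1) -> (forall x y, P [~ x, y]) ->
  forall x, gamma2 G x -> P x.
Proof. by move=> P1 PM PV PC x; apply; split; [split|move=> _ [y [z ->]]]. Qed.

End Morphisms.

Section MoreMorphisms.
Local Open Scope group_scope.
Variables (G H : groupType) (f : G -> H).
Hypothesis fM : {morph f : x y / x * y}.

Lemma morph_gamma2 x : gamma2 G x -> gamma2 H (f x).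
Proof.
have [H1 HM HV] := gamma2_subgroup H.
move: x; apply: gamma2_ind => [|x y Hx Hy|x Hx|x y].
- by rewrite morph_one.
- by rewrite fM; exact: HM.
- by rewrite morph_inv//; exact: HV.
- by rewrite morph_commg//; exact: gamma2_commg.
Qed.

Lemma gamma2_surj : (forall y, exists x, f x = y) ->
  forall y, gamma2 H y -> exists2 x, gamma2 G x & f x = y.
Proof.
have [G1 GM GV] := gamma2_subgroup G.
move=> fS; apply: gamma2_ind => [|_ _ [x Gx <-] [y Gy <-]|_ [x Gx <-]|u v].
- by exists 1 => //; exact: morph_one.
- by exists (x * y); [exact: GM|rewrite fM].
- by exists x^-1; [exact: GV|rewrite morph_inv].
- have [[x <-] [y <-]] := (fS u, fS v).
  by exists [~ x, y]; [exact: gamma2_commg|rewrite morph_commg].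
Qed.

Lemma gamma2_abelian : (forall x y : H, x * y = y * x) ->
  forall x, gamma2 G x -> f x = 1.
Proof.
move=> HC; apply: gamma2_ind => [|x y fx fy|x fx|x y].
- exact: morph_one.
- by rewrite fM fx fy mulg1.
- by rewrite morph_inv// fx invg1.
- by rewrite morph_commg//; apply/eqP/commgP/HC.
Qed.

(** Both groups are compared inside [H]: the isomorphism and its inverse are chosen from the
    equality of the two images, and injectivity of [g] makes the choice multiplicative. *)
Lemma isomorphic_same_image (K : groupType) (g : K -> H) :
  {morph g : x y / x * y} -> injective f -> injective g ->
  (forall x, exists y, g y = f x) -> (forall y, exists x, f x = g y) ->
  group_isomorphic G K.
Proof.
move=> gM fI gI fg gf.
have [h hE] := choice fg; have [h' h'E] := choice gf.
have hM : {morph h : x y / x * y}.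
  by move=> x y; apply: gI; rewrite gM !hE fM.
pose hm := isMultiplicative.Build G K h hM.
pose h1 := Multiplicative_isUMagmaMorphism.Build G K h (morph_one hM).
pose F : {multiplicative G -> K} := HB.pack h hm h1.
exists F; exists h' => [x|y] /=; [apply: fI|apply: gI].
  by rewrite h'E hE.
by rewrite hE h'E.
Qed.

End MoreMorphisms.

Section FreeLift.
Local Open Scope group_scope.
Local Open Scope quotient_scope.
Variables (S : choiceType) (G : groupType) (f : S -> G).

Definition letter_eval (l : S * bool) : G := if l.2 then f l.1 else (f l.1)^-1.

Definition word_eval (w : word S) : G :=
  foldr (fun l g => letter_eval l * g) 1 w.

Lemma word_eval_cat u v : word_eval (u ++ v) = word_eval u * word_eval v.
Proof. by elim: u => [|l u IH] /=; rewrite ?mul1g// IH mulgA. Qed.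

Lemma word_eval_equiv u v : word_equiv u v -> word_eval u = word_eval v.
Proof.
elim=> {u v} [u v s e|//|u v _ ->//|u v t _ -> //].
rewrite !word_eval_cat /= /letter_eval /=; congr (_ * _).
by case: e => /=; rewrite ?mulKg ?mulVKg.
Qed.

Definition free_lift (x : free_group S) : G := word_eval (repr x).

Lemma free_liftE (u : word S) : free_lift (\pi_(free_group S) u) = word_eval u.
Proof. by apply: word_eval_equiv; exact: free_reprP. Qed.

Lemma free_liftM : {morph free_lift : x y / x * y}.
Proof.
elim/freeW=> u; elim/freeW=> v.
by rewrite [_ * _]free_mulE !free_liftE word_eval_cat.
Qed.

Lemma free_lift_gen s : free_lift (free_gen s) = f s.
Proof. by rewrite /free_gen free_liftE /= mulg1. Qed.

End FreeLift.

Lemma free_group_ind (S : choiceType) (P : free_group S -> Prop) :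
  P 1%g -> (forall x y, P x -> P y -> P (x * y)%g) -> (forall x, P x -> P (x^-1)%g) ->
  (forall s, P (free_gen s)) -> forall x, P x.
Proof.
move=> P1 PM PV Pg; elim/freeW; elim=> [|[s e] u IH]; first exact: P1.
rewrite -cat1s -free_mulE; apply: PM => //.
case: e; first exact: Pg.
by have := PV _ (Pg s); rewrite -[(_^-1)%g]/(free_inv _) free_invE.
Qed.

Section SwapExtension.
Local Open Scope group_scope.
Local Notation a := F2_a.
Local Notation b := F2_b.

Lemma F2_ind (P : F2 -> Prop) : P 1 -> (forall x y, P x -> P y -> P (x * y)) ->
  (forall x, P x -> P (x^-1)) -> P a -> P b -> forall x, P x.
Proof.
move=> P1 PM PV Pa Pb; apply: free_group_ind => // s.
have [->|->] : s = ord0 \/ s = ord_max; [|exact: Pa|exact: Pb].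
by case: s => [[|[|//]] ?]; [left|right]; apply: val_inj.
Qed.

Definition F2_lift (G : groupType) (x y : G) : F2 -> G :=
  free_lift (fun i : 'I_2 => if i == ord0 then x else y).

Lemma F2_liftM (G : groupType) (x y : G) : {morph F2_lift x y : u v / u * v}.
Proof. exact: free_liftM. Qed.

Lemma F2_lift_a (G : groupType) (x y : G) : F2_lift x y a = x.
Proof. exact: free_lift_gen. Qed.

Lemma F2_lift_b (G : groupType) (x y : G) : F2_lift x y b = y.
Proof. exact: free_lift_gen. Qed.

Lemma F2_morph_ext (G : groupType) (f g : F2 -> G) :
  {morph f : x y / x * y} -> {morph g : x y / x * y} ->
  f a = g a -> f b = g b -> f =1 g.
Proof.
move=> fM gM fa fb; apply: F2_ind => [|x y fx fy|x fx||] //.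
- by rewrite !morph_one.
- by rewrite fM gM fx fy.
- by rewrite !morph_inv// fx.
Qed.

Definition F2_swap : F2 -> F2 := F2_lift b a.

Lemma F2_swapM : {morph F2_swap : x y / x * y}.
Proof. exact: F2_liftM. Qed.

Lemma F2_swapK : involutive F2_swap.
Proof.
move=> x; apply: (@F2_morph_ext _ (F2_swap \o F2_swap) id) => [y z|//||] /=.
- by rewrite !F2_swapM.
- by rewrite /F2_swap F2_lift_a F2_lift_b.
- by rewrite /F2_swap F2_lift_b F2_lift_a.
Qed.

Definition oddz (n : int) : bool := odd `|n|%N.

Lemma oddzD m n : oddz (m + n)%R = oddz m (+) oddz n.
Proof. by rewrite /oddz; lia. Qed.

Definition swap_fun (n : Zgroup) (x : F2) : F2 := if oddz n then F2_swap x else x.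

Lemma swap_funM n : {morph swap_fun n : x y / x * y}.
Proof. by move=> x y; rewrite /swap_fun; case: ifP => // _; rewrite F2_swapM. Qed.

Lemma swap_funA m n x : swap_fun (m * n) x = swap_fun m (swap_fun n x).
Proof.
rewrite /swap_fun oddzD; case: (oddz m); case: (oddz n) => //=.
by rewrite F2_swapK.
Qed.

Definition swap_action : group_action Zgroup F2 :=
  @GroupAction Zgroup F2 swap_fun swap_funM (fun=> erefl) swap_funA.

Definition F2Z : groupType := semidirect swap_action.

Lemma F2Z_mulE (g h : F2) (m n : int) :
  ((g, m) : F2Z) * ((h, n) : F2Z) = (g * swap_fun m h, (m + n)%R) :> F2Z.
Proof. by []. Qed.

Lemma F2Z_invE (g : F2) (m : int) :
  ((g, m) : F2Z)^-1 = (swap_fun (- m)%R g^-1, (- m)%R) :> F2Z.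
Proof. by []. Qed.

Definition total_exp : F2 -> Zgroup := F2_lift (1%R : Zgroup) (1%R : Zgroup).

Lemma total_expM : {morph total_exp : x y / x * y}.
Proof. exact: F2_liftM. Qed.

Lemma total_exp_swap x : total_exp (F2_swap x) = total_exp x.
Proof.
move: x; apply: F2_morph_ext => [x y|x y||].
- by rewrite F2_swapM total_expM.
- exact: total_expM.
- by rewrite /F2_swap /total_exp !F2_lift_a F2_lift_b.
- by rewrite /F2_swap /total_exp !F2_lift_b F2_lift_a.
Qed.

(** The second [1] is the unit of [Zgroup], that is the integer 0, whereas [1%R] is the
    generator. *)
Definition exp_a : F2 -> Zgroup := F2_lift (1%R : Zgroup) (1 : Zgroup).

Lemma exp_aM : {morph exp_a : x y / x * y}.
Proof. exact: F2_liftM. Qed.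

Lemma ZgroupC (x y : Zgroup) : x * y = y * x.
Proof. exact: addrC. Qed.

Lemma zexpg_Z (x : Zgroup) (n : int) : zexpg x n = (x *~ n)%R.
Proof.
elim/int_ind: n => [|n IH|n IH]; [by [] | |].
- by rewrite -addn1 PoszD zexpgS IH mulrzDr.
- by rewrite -addn1 PoszD opprD zexpgB IH mulrzDr.
Qed.

Section Congruence.
Variable G : groupType.

Definition gamma2_eq (x y : G) : Prop := gamma2 G (x * y^-1).

Lemma gamma2_eq_refl x : gamma2_eq x x.
Proof. by rewrite /gamma2_eq mulgV; have [] := gamma2_subgroup G. Qed.

Lemma gamma2_eq_sym x y : gamma2_eq x y -> gamma2_eq y x.
Proof.
have [_ _ GV] := gamma2_subgroup G.
by rewrite /gamma2_eq => /GV; rewrite invgM invgK.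
Qed.

Lemma gamma2_eq_trans y x z : gamma2_eq x y -> gamma2_eq y z -> gamma2_eq x z.
Proof.
have [_ GM _] := gamma2_subgroup G.
by rewrite /gamma2_eq => xy /(GM _ _ xy); rewrite mulgA mulgVK.
Qed.

Lemma gamma2_eqM x y z t : gamma2_eq x y -> gamma2_eq z t -> gamma2_eq (x * z) (y * t).
Proof.
have [_ GM _] := gamma2_subgroup G.
rewrite /gamma2_eq => xy /(gamma2_conj y)/(GM _ _ xy).
by rewrite invgM !mulgA mulgVK.
Qed.

Lemma gamma2_eqC x y : gamma2_eq (x * y) (y * x).
Proof.
rewrite /gamma2_eq (commgCV x y) mulgK; exact: gamma2_commg.
Qed.

Lemma gamma2_eqV x y : gamma2_eq x y -> gamma2_eq x^-1 y^-1.
Proof.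
move=> xy; have := gamma2_eqM (gamma2_eq_refl x^-1) (gamma2_eqM xy (gamma2_eq_refl y^-1)).
rewrite mulKg mulgV mulg1 => /gamma2_eq_sym; exact.
Qed.

End Congruence.

Local Notation c := (b^-1 * a).

(** Since b = a c^-1, the elements a and c generate F2. The total exponent is 1 on a and 0 on c, so
    modulo Gamma_2 it is the coordinate along a. *)
Lemma gamma2_normal_form (x : F2) :
  exists n : int, gamma2_eq x (zexpg a (total_exp x) * zexpg c n).
Proof.
move: x; apply: F2_ind => [|x y [n xn] [m ym]|x [n xn]||].
- by exists 0%R; rewrite morph_one ?mulg1; [exact: gamma2_eq_refl|exact: total_expM].
- exists (n + m)%R; rewrite total_expM !zexpgD.
  apply: gamma2_eq_trans (gamma2_eqM xn ym) _.
  rewrite -!mulgA; apply: gamma2_eqM; first exact: gamma2_eq_refl.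
  rewrite !mulgA; apply: gamma2_eqM; last exact: gamma2_eq_refl.
  exact: gamma2_eqC.
- exists (- n)%R; apply: gamma2_eq_trans (gamma2_eqV xn) _.
  rewrite invgM (morph_inv total_expM).
  have zV (g : F2) (k : int) : zexpg g (- k)%R = (zexpg g k)^-1.
    by apply: (@mulgI _ (zexpg g k)); rewrite -zexpgD subrr mulgV.
  by rewrite !zV; exact: gamma2_eqC.
- exists 0%R; rewrite /total_exp F2_lift_a mulg1 /= expg1.
  exact: gamma2_eq_refl.
- exists (-1)%R; rewrite /total_exp F2_lift_b /= !expg1 invgM invgK.
  by rewrite mulVKg; exact: gamma2_eq_refl.
Qed.

Definition F2Z_of_semidirect (x : semidirect (conjZ c)) : F2Z :=
  (val x.1 * zexpg c x.2, 0%R).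

(** Moving c^n past y conjugates y: (x c^n)(y c^m) = x (c^n y c^-n) c^(n+m), which is the action
    [conjZ]. *)
Lemma F2Z_of_semidirectM : {morph F2Z_of_semidirect : x y / x * y}.
Proof.
move=> [x n] [y m]; rewrite /F2Z_of_semidirect [RHS]F2Z_mulE /= addr0.
congr (_, _). rewrite -[swap_fun _ _]/(sval y * zexpg c m).
rewrite [X in _ * X = _](_ : _ = zexpg c n * zexpg c m); last exact: zexpgD.
rewrite !mulgA; congr (_ * _).
by rewrite mulgVK.
Qed.

Lemma exp_a_gamma2 (x : F2) : gamma2 F2 x -> exp_a x = 0%R.
Proof. exact: (gamma2_abelian exp_aM ZgroupC). Qed.

Lemma gamma2P (x : Gamma2 F2) : gamma2 F2 (val x).
Proof. by have := valP x; rewrite inE. Qed.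

Lemma F2Z_of_semidirect_inj : injective F2Z_of_semidirect.
Proof.
move=> [x n] [y m] [] /= xy.
have eE (z : Gamma2 F2) k : exp_a (val z * zexpg c k) = k.
  rewrite exp_aM exp_a_gamma2; last exact: gamma2P.
  rewrite (morph_zexpg exp_aM) zexpg_Z exp_aM (morph_inv exp_aM).
  rewrite /exp_a F2_lift_a F2_lift_b [X in (X *~ _)%R](_ : _ = 1%R)//.
  by rewrite [LHS]add0r intz.
have nm : n = m by rewrite -(eE x n) xy eE.
by rewrite nm in xy *; congr (_, _); apply: val_inj; exact: mulIg xy.
Qed.

Lemma F2Z_of_semidirect_gamma2 x : gamma2 F2Z (F2Z_of_semidirect x).
Proof.
have [G1 GM GV] := gamma2_subgroup F2Z.
case: x => x n; pose i (g : F2) : F2Z := (g, 0%R).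
have iM : {morph i : g h / g * h} by move=> g h; rewrite F2Z_mulE addr0.
rewrite [F2Z_of_semidirect _](_ : _ = i (val x) * zexpg (i c) n); last first.
  by rewrite -(morph_zexpg iM) -iM.
apply: (GM); first exact: (morph_gamma2 iM (gamma2P x)).
have ic : gamma2 F2Z (i c).
  (* Conjugation by [u] exchanges a and b, so b^-1 a = b^-1 (u b u^-1) is a commutator in the
     convention [x, y] = x^-1 y^-1 x y. *)
  pose u : F2Z := (1, 1%R).
  rewrite (_ : i c = [~ i b, u^-1]); first exact: gamma2_commg.
  rewrite /commg /conjg invgK iM (morph_inv iM); congr (_ * _).
  rewrite /u F2Z_invE /i !F2Z_mulE /swap_fun /= mul1g invg1 (morph_one F2_swapM).
  by rewrite -[swap_fun _ _]/(1 : F2) mulg1 /F2_swap F2_lift_b.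
have iX k : gamma2 F2Z (i c ^+ k).
  by elim: k => [|k IH]; rewrite ?expg0// expgS; exact: (GM _ _ ic IH).
by case: n => k; [exact: iX|apply: GV; exact: iX].
Qed.

Lemma gamma2_F2Z (w : F2Z) : gamma2 F2Z w -> exists x, F2Z_of_semidirect x = w.
Proof.
move=> wG; pose d (w : F2Z) : Zgroup := w.2.
pose t (w : F2Z) : Zgroup := total_exp w.1.
have dM : {morph d : x y / x * y} by [].
(* The total exponent is invariant under the swap, hence extends to [F2Z]. Like the projection [d],
   it is trivial on [w] because its target is abelian. *)
have tM : {morph t : x y / x * y}.
  move=> [g m] [h n]; rewrite /t /= total_expM /swap_fun.
  by case: ifP => // _; rewrite total_exp_swap.
have d0 := gamma2_abelian dM ZgroupC wG; have t0 := gamma2_abelian tM ZgroupC wG.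
have [n] := gamma2_normal_form w.1; rewrite [total_exp _]t0 /gamma2_eq mul1g => wn.
have wn' : w.1 * (zexpg c n)^-1 \in gamma2 F2 by rewrite inE.
pose y : Gamma2 F2 := exist (fun x => x \in gamma2 F2) _ wn'.
exists (y, n); rewrite /F2Z_of_semidirect /= mulgVK.
by rewrite -[0%R]d0 /d; case: (w).
Qed.

Theorem gamma2_of_F2Z (B : groupType) (f : B -> F2Z) :
  {morph f : x y / x * y} -> injective f -> (forall w, exists x, f x = w) ->
  group_isomorphic (Gamma2 B) (semidirect (conjZ c)).
Proof.
move=> fM fI fS.
pose F (x : Gamma2 B) : F2Z := f (val x).
have FM : {morph F : x y / x * y} by move=> x y; rewrite /F -fM.
have BP (x : Gamma2 B) : gamma2 B (val x) by have := valP x; rewrite inE.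
apply: (isomorphic_same_image FM F2Z_of_semidirectM _ F2Z_of_semidirect_inj).
- by move=> x y /fI/val_inj.
- by move=> x; apply: gamma2_F2Z; exact: (morph_gamma2 fM).
- move=> y; have [x xG xE] := gamma2_surj fM fS (F2Z_of_semidirect_gamma2 y).
  have xG' : x \in gamma2 B by rewrite inE.
  by exists (exist (fun x => x \in gamma2 B) x xG').
Qed.

End SwapExtension.

(** * Holonomy of local cocycles *)

Section IntervalChain.
Local Open Scope ring_scope.
Local Open Scope classical_set_scope.
Variable R : realType.

(** Continuous induction, which stands in for subdivision arguments on an interval: the local
    hypothesis at the supremum of the [x] with [Q l x] carries [Q] up to it and, unless it is [u],
    beyond it. *)
Lemma interval_chain (l u : R) (Q : R -> R -> Prop) : l <= u ->
  (forall a b c, l <= a -> a <= b -> b <= c -> c <= u -> Q a b -> Q b c -> Q a c) ->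
  (forall t, l <= t <= u -> exists2 e : R, 0 < e & forall a b, l <= a -> a <= b ->
    b <= u -> `|a - t| < e -> `|b - t| < e -> Q a b) -> Q l u.
Proof.
move=> lu Qtrans Qloc.
pose S := [set x | l <= x <= u /\ Q l x].
have Sl : S l.
  split; first by rewrite lexx.
  have [|e e0 Qe] := Qloc l; first by rewrite lexx.
  by apply: Qe; rewrite ?lexx// subrr normr0.
have Su : ubound S u by move=> x [/andP[]].
have hS : has_sup S by split; [exists l|exists u].
have ls : l <= sup S by apply: ub_le_sup => //; exists u.
have su : sup S <= u by apply: ge_sup => //; exists l.
have [|e e0 Qe] := Qloc (sup S); first by rewrite ls.
have [x [/andP[lx xu] Qlx] xs] := sup_adherent e0 hS.
have xs' : x <= sup S by apply: ub_le_sup; [exists u|split => //; rewrite lx].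
(* Strictly beyond the supremum, unless the supremum is [u]. *)
pose y := Num.min u (sup S + e / 2).
have yu : y <= u by rewrite ge_min lexx.
have sy : sup S <= y by rewrite le_min su; lra.
have Qly : Q l y.
  apply: (Qtrans l x y) => //; first lra.
  apply: Qe => //; first lra.
    by rewrite ler0_norm; lra.
  rewrite ger0_norm ?subr_ge0//.
  have : y <= sup S + e / 2 by rewrite ge_min lexx orbT.
  by lra.
have Sy : S y by split; [rewrite yu andbT; exact: le_trans sy|].
have ys : y <= sup S by apply: ub_le_sup => //; exists u.
suff -> : u = y by [].
move: ys; rewrite /y; case: (leP u (sup S + e / 2)) => //; lra.
Qed.

Lemma continuous_compose (A B C : topologicalType) (f : A -> B) (g : B -> C) :
  continuous f -> continuous g -> continuous (fun x => g (f x)).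
Proof. by move=> cf cg x; apply: continuous_comp; [exact: cf|exact: cg]. Qed.

Lemma continuous_eps (T : topologicalType) (f : R -> T) (t : R) (U : set T) :
  {for t, continuous f} -> nbhs (f t) U ->
  exists2 e : R, 0 < e & forall a, `|a - t| < e -> U (f a).
Proof.
move=> cf /cf /nbhs_ballP[e /= e0 eU]; exists e => // a ae; apply: eU.
by rewrite /ball /= distrC.
Qed.

Lemma continuous_eps2 (T : topologicalType) (f : R * R -> T) (s t : R) (U : set T) :
  {for (s, t), continuous f} -> nbhs (f (s, t)) U ->
  exists2 e : R, 0 < e & forall a b, `|a - s| < e -> `|b - t| < e -> U (f (a, b)).
Proof.
move=> cf /cf /nbhs_ballP[e /= e0 eU]; exists e => // a b ae be; apply: eU.
by split; rewrite /ball /= distrC.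
Qed.

End IntervalChain.

Section Holonomy.
Local Open Scope ring_scope.
Local Open Scope classical_set_scope.
Variables (R : realType) (X : topologicalType) (G : groupType) (rho : X -> X -> G).

Definition cocycle_on (U : set X) : Prop :=
  forall x y z, U x -> U y -> U z -> (rho x y * rho y z = rho x z)%g.

Definition local_cocycle : Prop := forall x : X, exists2 U, nbhs x U & cocycle_on U.

(* h is a section over f|[l,u] of the covering of X defined by the cocycle. *)
Definition hlift (f : R -> X) (l u : R) (h : R -> G) : Prop :=
  forall t, l <= t <= u -> exists2 e : R, 0 < e & forall a b, l <= a <= u ->
    l <= b <= u -> `|a - t| < e -> `|b - t| < e -> h b = (h a * rho (f a) (f b))%g.

Lemma hlift_sub f l u l' u' h :
  l <= l' -> u' <= u -> hlift f l u h -> hlift f l' u' h.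
Proof.
move=> ll uu hL t lt; have [|e e0 he] := hL t; first by lra.
by exists e => // a b la lb; apply: he; lra.
Qed.

Lemma hlift_affine f l u h k c : 0 < k -> hlift f (k * l + c) (k * u + c) h ->
  hlift (fun x => f (k * x + c)) l u (fun x => h (k * x + c)).
Proof.
move=> k0 hL t lt.
have kle x y : (k * x + c <= k * y + c) = (x <= y) by rewrite lerD2r ler_pM2l.
have [|e e0 he] := hL (k * t + c); first by rewrite !kle.
exists (e / k) => [|a b la lb ae be]; first exact: divr_gt0.
have kd x : `|x - t| < e / k -> `|k * x + c - (k * t + c)| < e.
  move=> xe; rewrite (_ : _ - _ = k * (x - t)); last by ring.
  by rewrite normrM gtr0_norm// mulrC -ltr_pdivlMr.
by apply: he; rewrite ?kle; [| |exact: kd|exact: kd].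
Qed.

Lemma cocycle_onxx U x : cocycle_on U -> U x -> rho x x = 1%g.
Proof. by move=> cU Ux; apply: (mulgI (rho x x)); rewrite cU// mulg1. Qed.

Lemma hlift_local f l u h U : l <= u -> cocycle_on U ->
  (forall t, l <= t <= u -> U (f t)) -> hlift f l u h ->
  h u = (h l * rho (f l) (f u))%g.
Proof.
move=> lu cU Uf hL.
apply: (@interval_chain _ l u (fun a b => h b = (h a * rho (f a) (f b))%g)) => //.
  move=> a b c la ab bc cu -> ->; rewrite -mulgA cU//; apply: Uf; lra.
move=> t /hL[e e0 he]; exists e => // a b la ab bu ae be.
by apply: he => //; lra.
Qed.

(** Two lifts differ by a left translation: near each parameter both increments are the same value
    of [rho]. *)
Lemma hlift_unique f l u h h' : l <= u -> hlift f l u h -> hlift f l u h' ->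
  ((h l)^-1 * h u = (h' l)^-1 * h' u)%g.
Proof.
move=> lu hL hL'.
apply: (@interval_chain _ l u (fun a b => ((h a)^-1 * h b = (h' a)^-1 * h' b)%g)) => //.
  have D (k : R -> G) a b c : ((k a)^-1 * k c = ((k a)^-1 * k b) * ((k b)^-1 * k c))%g.
    by rewrite -mulgA mulVKg.
  by move=> a b c la ab bc cu E E'; rewrite (D h a b) (D h' a b) E E'.
move=> t lt; have [e e0 he] := hL t lt; have [e' e0' he'] := hL' t lt.
exists (Num.min e e') => [|a b la ab bu]; first by rewrite lt_min e0.
rewrite !lt_min => /andP[ae ae'] /andP[be be'].
rewrite (he a b)//; [|lra|lra]; rewrite (he' a b)//; [|lra|lra].
by rewrite !mulKg.
Qed.

Hypothesis rhoL : local_cocycle.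

Lemma cocyclexx x : rho x x = 1%g.
Proof. by have [U /nbhs_singleton Ux cU] := rhoL x; exact: cocycle_onxx cU Ux. Qed.

Lemma hlift_cat f a b c h h' : a <= b -> b <= c -> {for b, continuous f} ->
  h b = h' b -> hlift f a b h -> hlift f b c h' ->
  hlift f a c (fun x => if x <= b then h x else h' x).
Proof.
move=> ab bc cf hb hL hL' t /andP[at_ tc].
have [tb|bt|tb] := ltgtP t b.
- have [|e e0 he] := hL t; first by rewrite at_ ltW.
  exists (Num.min e (b - t)) => [|x y ax ay]; first by rewrite lt_min e0 subr_gt0.
  rewrite !lt_min => /andP[xe xb] /andP[ye yb].
  have xb' : x <= b by move: xb; rewrite ltr_norml; lra.
  have yb' : y <= b by move: yb; rewrite ltr_norml; lra.
  by rewrite xb' yb'; apply: he => //; lra.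
- have [|e e0 he] := hL' t; first by rewrite tc ltW.
  exists (Num.min e (t - b)) => [|x y ax ay]; first by rewrite lt_min e0 subr_gt0.
  rewrite !lt_min => /andP[xe xb] /andP[ye yb].
  have xb' : b < x by move: xb; rewrite ltr_norml; lra.
  have yb' : b < y by move: yb; rewrite ltr_norml; lra.
  by rewrite (leNgt x b) xb' (leNgt y b) yb' /=; apply: he => //; lra.
(* Near the junction, parameters on different sides are compared through [f b], using the cocycle
   identity on a neighbourhood of it. *)
- subst t.
  have [|e e0 he] := hL b; first by rewrite ab lexx.
  have [|e' e0' he'] := hL' b; first by rewrite bc lexx.
  have [U Ub cU] := rhoL (f b); have [d d0 dU] := continuous_eps cf Ub.
  exists (Num.min d (Num.min e e')) => [|x y ax ay].
    by rewrite !lt_min e0 e0' d0.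
  rewrite !lt_min => /andP[xd /andP[xe xe']] /andP[yd /andP[ye ye']].
  have b0 r : 0 < r -> `|b - b| < r by rewrite subrr normr0.
  have Ux := dU _ xd; have Uy := dU _ yd; have Ufb : U (f b) by apply: dU; exact: b0.
  case: (leP x b) => xb; case: (leP y b) => yb.
  + by apply: he => //; lra.
  + rewrite (he' b y) -?hb ?(he x b) ?b0//; [|lra..].
    by rewrite -mulgA cU.
  + rewrite (he' b x) -?hb ?(he b y) ?b0//; [|lra..].
    by rewrite -mulgA cU.
  + by apply: he' => //; lra.
Qed.

Lemma hlift_exists f l u : l <= u -> continuous f -> exists h, hlift f l u h.
Proof.
move=> lu cf.
(* Prescribing the initial value lets lifts on adjacent intervals be matched. *)
suff /(_ 1%g)[h [_ hL]] : forall g, exists h, h l = g /\ hlift f l u h by exists h.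
apply: (@interval_chain _ l u (fun a b => forall g, exists h, h a = g /\ hlift f a b h)) => //.
  move=> a b c la ab bc cu Qab Qbc g.
  have [h [hg hL]] := Qab g; have [h' [hb hL']] := Qbc (h b).
  exists (fun x => if x <= b then h x else h' x); rewrite ab; split=> //.
  exact: (hlift_cat ab bc (cf b) (esym hb) hL hL').
move=> t lt; have [U Ut cU] := rhoL (f t); have [e e0 eU] := continuous_eps (cf t) Ut.
exists e => // a b la ab bu ae be g.
have Uab x : a <= x <= b -> U (f x).
  by move=> ax; apply: eU; move: ae be; rewrite !ltr_norml; lra.
exists (fun x => (g * rho (f a) (f x))%g); rewrite cocyclexx mulg1; split=> // s _.
exists 1 => // x y ax ay _ _; rewrite -mulgA cU//; apply: Uab => //.
by rewrite lexx.
Qed.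

(** Only increments are compared, so the lifts [k s] of the slices can be chosen independently of
    one another. *)
Lemma hlift_homotopy (H : R * R -> X) : continuous H ->
  (forall s, H (s, 0) = H (0, 0)) -> (forall s, H (s, 1) = H (0, 1)) ->
  forall h h', hlift (fun t => H (0, t)) 0 1 h -> hlift (fun t => H (1, t)) 0 1 h' ->
  ((h 0%R)^-1 * h 1%R = (h' 0%R)^-1 * h' 1%R)%g.
Proof.
move=> cH H0 H1 h h' hL hL'.
have cHs s : continuous (fun t => H (s, t)).
  apply: (@continuous_compose _ _ _ (fun t => (s, t)) H) => //.
  by apply: continuous_pair => t; [exact: cvg_cst|exact: cvg_id].
have /choice[k kL] : forall s, exists k, hlift (fun t => H (s, t)) 0 1 k.
  move=> s.
  exact: (hlift_exists ler01 (cHs s)).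
rewrite (hlift_unique _ hL (kL 0))// (hlift_unique _ hL' (kL 1))//.
pose D s a b := ((k s a)^-1 * k s b)%g.
rewrite -/(D 0 0 1) -/(D 1 0 1).
apply: (@interval_chain _ 0 1 (fun s s' => D s 0 1 = D s' 0 1)) => //.
  by move=> a b c _ _ _ _ -> ->.
move=> s0 _.
(* A ladder of small squares between two nearby slices: across and then along one slice equals along
   the other and then across. At the two ends [H] does not depend on [s] and the crossings are
   trivial. *)
suff : exists2 e : R, 0 < e & forall s s', `|s - s0| < e -> `|s' - s0| < e ->
    (rho (H (s, 0%R)) (H (s', 0%R)) * D s' 0%R 1%R =
     D s 0%R 1%R * rho (H (s, 1%R)) (H (s', 1%R)))%g.
  move=> [e e0 he]; exists e => // a b _ _ _ ae be.
  have := he _ _ ae be.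
  by rewrite (H0 a) (H0 b) (H1 a) (H1 b) !cocyclexx mul1g mulg1 => ->.
apply: (@interval_chain _ 0 1 (fun a b => exists2 e : R, 0 < e & forall s s',
    `|s - s0| < e -> `|s' - s0| < e ->
    (rho (H (s, a)) (H (s', a)) * D s' a b = D s a b * rho (H (s, b)) (H (s', b)))%g)) => //.
  move=> a b c _ _ _ _ [e e0 he] [e' e0' he'].
  exists (Num.min e e') => [|s s']; first by rewrite lt_min e0.
  rewrite !lt_min => /andP[se se'] /andP[te te'].
  have Dm r : D r a c = (D r a b * D r b c)%g by rewrite /D -mulgA mulVKg.
  rewrite !Dm mulgA he// -[in LHS]mulgA he'//. by rewrite mulgA.
move=> t _; have [U Ut cU] := rhoL (H (s0, t)).
have [e e0 eU] := continuous_eps2 (cH _) Ut.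
exists e => // a b a0 ab b1 ae be; exists e => // s s' se se'.
have UD r : `|r - s0| < e -> D r a b = rho (H (r, a)) (H (r, b)).
  move=> re; rewrite /D; apply: (mulgI (k r a)); rewrite mulVKg.
  apply: (@hlift_local (fun t => H (r, t)) a b (k r) U) => //.
    by move=> x ax; apply: eU => //; move: ae be; rewrite !ltr_norml; lra.
  exact: (hlift_sub a0 b1 (kL r)).
by rewrite !UD// !cU//; exact: eU.
Qed.

Section PathHolonomy.
Local Notation I := (unit_interval R).
Local Notation path x y := {path I from x to y in X}.

Definition path_ext x y (p : path x y) (r : R) : X := p (clamp r).

Lemma path_ext_cont x y (p : path x y) : continuous (path_ext p).
Proof. exact: path_ext_continuous. Qed.

Lemma path_lift_exists x y (p : path x y) : exists h, hlift (path_ext p) 0 1 h.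
Proof. by apply: hlift_exists => //; exact: path_ext_cont. Qed.

Definition path_lift x y (p : path x y) : R -> G := projT1 (cid (path_lift_exists p)).

Lemma path_liftP x y (p : path x y) : hlift (path_ext p) 0 1 (path_lift p).
Proof. exact: (projT2 (cid (path_lift_exists p))). Qed.

Definition hol x y (p : path x y) : G := ((path_lift p 0%R)^-1 * path_lift p 1%R)%g.

Lemma holE x y (p : path x y) h : hlift (path_ext p) 0 1 h ->
  hol p = ((h 0%R)^-1 * h 1%R)%g.
Proof. by apply: hlift_unique => //; exact: path_liftP. Qed.

Lemma hol_homotopic x y (p q : path x y) : path_homotopic p q -> hol p = hol q.
Proof.
case=> H [cH Hp Hq Hx Hy].
pose K (a : R * R) := H (clamp a.1, clamp a.2).
have cK : continuous K.
  apply: (@continuous_compose _ _ _ (fun a : R * R => (clamp a.1, clamp a.2)) H) => //.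
  apply: continuous_pair.
    by apply: (@continuous_compose _ _ _ fst (@clamp R)) => [a|];
      [exact: cvg_fst|exact: clamp_continuous].
  by apply: (@continuous_compose _ _ _ snd (@clamp R)) => [a|];
    [exact: cvg_snd|exact: clamp_continuous].
apply: (@hlift_homotopy K cK) => [s|s||]; rewrite /K /=.
- by rewrite !Hx.
- by rewrite !Hy.
- have -> : (fun t => H (clamp 0, clamp t)) = path_ext p.
    by apply/funext => t; exact: Hp.
  exact: path_liftP.
- have -> : (fun t => H (clamp 1, clamp t)) = path_ext q.
    by apply/funext => t; exact: Hq.
  exact: path_liftP.
Qed.

(** A lift along the concatenation restricts, after rescaling, to lifts along both halves. *)
Lemma hol_cat x y z (p : path x y) (q : path y z) :
  hol (path_cat p q : path x z) = (hol p * hol q)%g.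
Proof.
set pq := (path_cat p q : path x z).
pose h := path_lift pq.
have hL : hlift (path_ext pq) 0 1 h by exact: path_liftP.
have Lext f g k l u : (forall t, l <= t <= u -> f t = g t) -> hlift f l u k -> hlift g l u k.
  move=> fg kL t /kL[e e0 he]; exists e => // a b la lb ae be.
  by rewrite -!fg//; exact: he.
rewrite (@holE _ _ p (fun r => h (2^-1 * r + 0))); last first.
  apply: (Lext (fun r => path_ext pq (2^-1 * r + 0))) => [t t01|].
    rewrite /path_ext [LHS]path_catE; last lra.
    by rewrite ifT; [congr (p (clamp _))|]; lra.
  by apply: hlift_affine; [lra|apply: hlift_sub hL; lra].
rewrite (@holE _ _ q (fun r => h (2^-1 * r + 2^-1))); last first.
  apply: (Lext (fun r => path_ext pq (2^-1 * r + 2^-1))) => [t t01|].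
    rewrite /path_ext [LHS]path_catE; last lra.
    case: leP => t2; last by congr (q (clamp _)); lra.
    (* [path_cat] assigns the midpoint to [p]; the two values agree there. *)
    have -> : t = 0 by lra.
    have -> : 2 * (2^-1 * 0 + 2^-1) = 1 :> R by lra.
    by rewrite path_one path_zero.
  by apply: hlift_affine; [lra|apply: hlift_sub hL; lra].
rewrite /hol -/h.
have -> : 2^-1 * 0 + 0 = 0 :> R by lra.
have -> : 2^-1 * 1 + 0 = 2^-1 :> R by lra.
have -> : 2^-1 * 0 + 2^-1 = 2^-1 :> R by lra.
have -> : 2^-1 * 1 + 2^-1 = 1 :> R by lra.
by rewrite -mulgA mulVKg.
Qed.

Lemma hol_local x y (p : path x y) U : cocycle_on U -> (forall t, U (p t)) ->
  hol p = rho x y.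
Proof.
move=> cU Up; apply: (mulgI (path_lift p 0)); rewrite mulVKg.
have -> : rho x y = rho (path_ext p 0) (path_ext p 1).
  by congr (rho _ _); rewrite /path_ext ?path_zero ?path_one.
by apply: hlift_local cU _ (path_liftP p) => // t _; exact: Up.
Qed.

Definition pi1_hol x (g : pi1 R x) : G := hol (repr g).

Lemma pi1_holE x (p : path x x) : pi1_hol (\pi_(pi1 R x) p)%qT = hol p.
Proof. by apply: hol_homotopic; exact: pi1_reprP. Qed.

Lemma pi1_holM x : {morph @pi1_hol x : g h / (g * h)%g}.
Proof.
elim/pi1W=> p; elim/pi1W=> q; rewrite [(_ * _)%g]pi1_mulE !pi1_holE.
exact: hol_cat.
Qed.

End PathHolonomy.
End Holonomy.

(** * Path classes in a group *)

Section PathAlgebra.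
Local Open Scope ring_scope.
Local Open Scope classical_set_scope.
Variables (R : realType) (X : topologicalType).
Local Notation I := (unit_interval R).
Local Notation path x y := {path I from x to y in X}.

Definition pcat x y z (p : path x y) (q : path y z) : path x z := path_cat p q.
Definition prevp x y (p : path x y) : path y x := path_rev p.
Definition pcst x : path x x := cst x.

Definition mkpath (x y : X) (f : I -> X) (cf : continuous f) (f0 : f zero = x)
  (f1 : f one = y) : path x y := mk_path cf f0 f1.

Local Notation "p ~ q" := (path_homotopic p q) (at level 70).

Lemma pcat_homol x y z (p p' : path x y) (q : path y z) :
  p ~ p' -> pcat p q ~ pcat p' q.
Proof. by move=> pp'; apply: path_homotopic_cat => //; exact: path_homotopic_refl. Qed.

Lemma pcat_homor x y z (p : path x y) (q q' : path y z) :
  q ~ q' -> pcat p q ~ pcat p q'.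
Proof. by move=> pp'; apply: path_homotopic_cat => //; exact: path_homotopic_refl. Qed.

Lemma pcatKl x y z (a : path x y) (p : path y z) : pcat (prevp a) (pcat a p) ~ p.
Proof.
apply: path_homotopic_trans (path_catA _ _ _) _.
apply: path_homotopic_trans (pcat_homol _ (path_catVp a)) _.
exact: path_cat1p.
Qed.

Lemma pcatKr x y z (p : path x y) (a : path y z) : pcat (pcat p a) (prevp a) ~ p.
Proof.
apply: path_homotopic_trans (path_homotopic_sym (path_catA _ _ _)) _.
apply: path_homotopic_trans (pcat_homor _ (path_catpV a)) _.
exact: path_catp1.
Qed.

Lemma pcat_cancel x y z (a : path x y) (p p' : path y z) :
  pcat a p ~ pcat a p' -> p ~ p'.
Proof.
move=> /(pcat_homor (prevp a)) app'.
apply: path_homotopic_trans (path_homotopic_sym (pcatKl a p)) _.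
exact: path_homotopic_trans app' (pcatKl a p').
Qed.

Lemma pcat_cancelr x y z (p p' : path x y) (a : path y z) :
  pcat p a ~ pcat p' a -> p ~ p'.
Proof.
move=> pap'; apply: path_homotopic_trans (path_homotopic_sym (pcatKr p a)) _.
exact: path_homotopic_trans (pcat_homol (prevp a) pap') (pcatKr p' a).
Qed.

Section Gauge.
Variables (x0 : X) (q : forall x, path x0 x).

(* Transporting the endpoints to x0 along q turns path classes into elements of
   one group, and path concatenation into its product. *)
Definition gauge x y (p : path x y) : pi1 R x0 :=
  (\pi_(pi1 R x0) (pcat (pcat (q x) p) (prevp (q y))))%qT.

Lemma gauge_homotopic x y (p p' : path x y) : p ~ p' -> gauge p = gauge p'.
Proof. by move=> pp'; apply/pi1_piP; apply/pcat_homol/pcat_homor. Qed.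

Lemma gauge_inj x y (p p' : path x y) : gauge p = gauge p' -> p ~ p'.
Proof. by move/pi1_piP/pcat_cancelr/pcat_cancel. Qed.

Lemma gauge_cat x y z (p : path x y) (p' : path y z) :
  gauge (pcat p p') = (gauge p * gauge p')%g.
Proof.
rewrite [RHS]pi1_mulE; apply/pi1_piP; apply: path_homotopic_sym.
apply: path_homotopic_trans (path_catA _ _ _) _; apply: pcat_homol.
apply: path_homotopic_trans (path_catA _ _ _) _.
apply: path_homotopic_trans (pcat_homol _ _) (path_homotopic_sym (path_catA _ _ _)).
apply: path_homotopic_trans (path_homotopic_sym (path_catA _ _ _)) _.
apply: path_homotopic_trans (pcat_homor _ (path_catVp _)) _.
exact: path_catp1.
Qed.

Lemma gauge_cst x : gauge (pcst x) = 1%g.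
Proof.
apply/pi1_piP; apply: path_homotopic_trans (pcat_homol _ (path_catp1 _)) _.
exact: path_catpV.
Qed.

(** The connecting paths become trivial, like the edges of a spanning tree in a presentation of a
    fundamental group. *)
Lemma gauge_base x : q x0 ~ pcst x0 -> gauge (q x) = 1%g.
Proof.
move=> q0; apply/pi1_piP; apply: path_homotopic_trans (pcat_homol _ (pcat_homol _ q0)) _.
apply: path_homotopic_trans (pcat_homol _ (path_cat1p _)) _; exact: path_catpV.
Qed.

Section Subpath.
Variables (f : R -> X) (cf : continuous f).

Lemma subpath_cont a b : continuous (fun t : I => f ((b - a) * tval_itv t + a)).
Proof.
apply: (@continuous_compose _ _ _ (fun t : I => (b - a) * tval_itv t + a) f) => //.
by apply: continuous_affine; exact: tval_continuous.
Qed.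

Lemma subpath0 a b : f ((b - a) * tval_itv (zero : I) + a) = f a.
Proof. by rewrite tval0 mulr0 add0r. Qed.

Lemma subpath1 a b : f ((b - a) * tval_itv (one : I) + a) = f b.
Proof. by rewrite tval1 mulr1 subrK. Qed.

Definition subpath a b : path (f a) (f b) :=
  mkpath (@subpath_cont a b) (subpath0 a b) (subpath1 a b).

Lemma subpath_cat a b c : a <= b -> b <= c ->
  pcat (subpath a b) (subpath b c) ~ subpath a c.
Proof.
move=> ab bc.
(* The first summand runs from [a] to [b] and then stops; the second waits at 0 and then runs to
   [c - b]. *)
apply: (@path_homotopic_reparam _ _ _ _ f
  (fun t => Num.min (2 * (b - a) * t + a) b + Num.max (2 * (c - b) * t - (c - b)) 0)
  (fun t => (c - a) * t + a)) => //.
- move=> t; apply: (@cvgD _ R).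
    apply: (@min_fun_continuous _ _ R (fun t => 2 * (b - a) * t + a) (fun=> b)) => r.
      exact: continuous_affineR.
    exact: cvg_cst.
  apply: (@max_fun_continuous _ _ R (fun t => 2 * (c - b) * t - (c - b)) (fun=> 0)) => r.
    exact: (@continuous_affineR R).
  exact: cvg_cst.
- exact: continuous_affineR.
- rewrite min_l; last lra. rewrite max_r; lra.
- rewrite min_r; last lra. rewrite max_l; lra.
- move=> t; have := tval_itvP t; rewrite [LHS]path_catEt => t01.
  case: (leP (tval_itv t) 2^-1) => t2.
    rewrite -[LHS]/(f ((b - a) * tval_itv (clamp _) + a)) val_clamp; last lra.
    by congr (f _); rewrite min_l ?max_r; [lra|nra..].
  rewrite -[LHS]/(f ((c - b) * tval_itv (clamp _) + b)) val_clamp; last lra.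
  by congr (f _); rewrite min_r ?max_l; [lra|nra..].
Qed.

(** [p] and the subpath have different types, but [gauge] sends both to the same group, where they
    can be compared. *)
Lemma gauge_ends (a b : R) u v (p : path u v) : f a = u -> f b = v ->
  p =1 subpath a b -> gauge p = gauge (subpath a b).
Proof. by move=> au bv; subst u v => pE; congr gauge; apply/path_eqP. Qed.

End Subpath.

(** The key to injectivity: a description of short paths by [rho] through [phi] propagates to all
    paths, since both sides are multiplicative under subdivision. *)
Lemma gauge_hol (G : groupType) (rho : X -> X -> G) (rhoL : local_cocycle rho)
    (phi : G -> pi1 R x0) : {morph phi : g h / (g * h)%g} ->
  (forall x : X, exists2 U, nbhs x U &
    forall y z (p : path y z), (forall t, U (p t)) -> gauge p = phi (rho y z)) ->
  forall x y (p : path x y), gauge p = phi (hol rhoL p).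
Proof.
move=> phiM phiL x y p.
pose h := path_lift rhoL p; have hL : hlift rho (path_ext p) 0 1 h by exact: path_liftP.
have cp := @path_ext_cont _ _ _ _ p.
rewrite (@gauge_ends _ cp 0 1); first last.
- by move=> t /=; rewrite /mkpath /= /mk_path subr0 mul1r addr0 /path_ext clampK.
- by rewrite /path_ext path_one.
- by rewrite /path_ext path_zero.
rewrite /hol -/h.
apply: (@interval_chain _ 0 1 (fun a b => gauge (subpath cp a b) = phi ((h a)^-1 * h b)%g)) => //.
  move=> a b c _ ab bc _ E E'.
  rewrite -(gauge_homotopic (subpath_cat cp ab bc)) gauge_cat E E' -phiM.
  by rewrite -mulgA mulVKg.
move=> t t01; have [U Ut UE] := phiL (path_ext p t).
have [e e0 he] := hL t t01; have [e' e0' eU] := continuous_eps (cp t) Ut.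
exists (Num.min e e') => [|a b a0 ab b1]; first by rewrite lt_min e0.
rewrite !lt_min => /andP[ae ae'] /andP[be be'].
rewrite (he a b)//; [|lra|lra]; rewrite mulKg; apply: UE => s; apply: eU.
have := tval_itvP s; move: ae' be'; rewrite !ltr_norml => /andP[? ?] /andP[? ?] s01.
by nra.
Qed.

End Gauge.
End PathAlgebra.
Arguments pcst {R X} x.

(** * Segments in planar sets *)

Section RealContinuity.
Local Open Scope ring_scope.
Variables (R : realType) (T : topologicalType).
Implicit Types f g : T -> R.

Lemma contD f g : continuous f -> continuous g -> continuous (fun x => f x + g x).
Proof. by move=> cf cg x; apply: cvgD; [exact: cf|exact: cg]. Qed.

Lemma contB f g : continuous f -> continuous g -> continuous (fun x => f x - g x).
Proof. by move=> cf cg x; apply: cvgB; [exact: cf|exact: cg]. Qed.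

Lemma contM f g : continuous f -> continuous g -> continuous (fun x => f x * g x).
Proof. by move=> cf cg x; apply: cvgM; [exact: cf|exact: cg]. Qed.

Lemma contN f : continuous f -> continuous (fun x => - f x).
Proof. by move=> cf x; apply: cvgN; exact: cf. Qed.

Lemma contV f : continuous f -> (forall x, f x != 0) -> continuous (fun x => (f x)^-1).
Proof. by move=> cf f0 x; apply: cvgV; [exact: f0|exact: cf]. Qed.

Lemma contC (V : topologicalType) (c : V) : continuous (fun _ : T => c).
Proof. by move=> x; exact: cvg_cst. Qed.

Lemma cont_fst (U V : topologicalType) (f : T -> U * V) :
  continuous f -> continuous (fun x => (f x).1).
Proof. by move=> cf; apply: (@continuous_compose _ _ _ f fst) => // a; exact: cvg_fst. Qed.

Lemma cont_snd (U V : topologicalType) (f : T -> U * V) :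
  continuous f -> continuous (fun x => (f x).2).
Proof. by move=> cf; apply: (@continuous_compose _ _ _ f snd) => // a; exact: cvg_snd. Qed.

End RealContinuity.

Section IntoSubset.
Local Open Scope classical_set_scope.
Variables (V : topologicalType) (A : set V).

Definition into_set (v : V) (Av : A v) : set_type A := exist (fun x => x \in A) v (mem_set Av).

Lemma val_set_cont : continuous (val : set_type A -> V).
Proof. exact: initial_continuous. Qed.

Lemma set_typeP (v : set_type A) : A (val v).
Proof. by have := valP v; rewrite inE. Qed.

Lemma cont_into_set (T : topologicalType) (f : T -> V) (Af : forall t, A (f t)) :
  continuous f -> continuous (fun t => into_set (Af t)).
Proof. by move=> cf; apply: (@continuous_comp_initial (set_type A) T V val). Qed.

Lemma cont_val (T : topologicalType) (f : T -> set_type A) :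
  continuous f -> continuous (fun t => val (f t)).
Proof. by move=> cf; apply: (continuous_compose cf); exact: val_set_cont. Qed.

End IntoSubset.

Section Plane.
Local Open Scope ring_scope.
Local Open Scope classical_set_scope.
Variable (R : realType).
Local Notation I := (unit_interval R).
Local Notation C := (R * R)%type.

Definition lerp (t : R) (x y : C) : C :=
  ((1 - t) * x.1 + t * y.1, (1 - t) * x.2 + t * y.2).

Lemma lerp_cont (T : topologicalType) (t : T -> R) (f g : T -> C) :
  continuous t -> continuous f -> continuous g ->
  continuous (fun a => lerp (t a) (f a) (g a)).
Proof.
move=> ct cf cg; have c1 : continuous (fun a : T => 1 - t a).
  by apply: contB ct; exact: contC.
by apply: continuous_pair; apply: contD; apply: contM => //;
  (exact: cont_fst || exact: cont_snd).
Qed.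

Lemma lerp0 x y : lerp 0 x y = x.
Proof. by rewrite /lerp subr0 !mul1r !mul0r !addr0; case: x. Qed.

Lemma lerp1 x y : lerp 1 x y = y.
Proof. by rewrite /lerp subrr !mul1r !mul0r !add0r; case: y. Qed.

Definition convex_set (U : set C) : Prop :=
  forall (t : R) x y, 0 <= t <= 1 -> U x -> U y -> U (lerp t x y).

Variable A : set C.
Local Notation Y := (set_type A).

Lemma straight_homotopic (x y : Y) (p q : {path I from x to y in Y}) :
  (forall s t : I, A (lerp (tval_itv s) (val (p t)) (val (q t)))) ->
  path_homotopic p q.
Proof.
move=> AH; exists (fun a => into_set (AH a.1 a.2)).
have eqA (v : C) (w : Y) (Av : A v) : v = val w -> into_set Av = w.
  by move=> vw; apply: val_inj.
split=> [|t|t|s|s].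
- apply: cont_into_set; apply: lerp_cont; first exact: continuous_tval_fst.
  + apply: cont_val; apply: (@continuous_compose _ _ _ snd p) => [a|]; first exact: cvg_snd.
    exact: cts_fun.
  + apply: cont_val; apply: (@continuous_compose _ _ _ snd q) => [a|]; first exact: cvg_snd.
    exact: cts_fun.
- by apply: eqA; rewrite tval0 lerp0.
- by apply: eqA; rewrite tval1 lerp1.
- by apply: eqA; rewrite /= !path_zero /lerp -!mulrDl !subrK !mul1r; case: (val x).
- by apply: eqA; rewrite /= !path_one /lerp -!mulrDl !subrK !mul1r; case: (val y).
Qed.

Definition seg_in (x y : C) : Prop := forall t : R, 0 <= t <= 1 -> A (lerp t x y).

Lemma seg_inI (x y : Y) : seg_in (val x) (val y) ->
  forall t : I, A (lerp (tval_itv t) (val x) (val y)).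
Proof. by move=> xy t; apply: xy; exact: tval_itvP. Qed.

Section Segment.
Variables (x y : Y) (xy : seg_in (val x) (val y)).

Lemma seg_cont : continuous (fun t : I => into_set (seg_inI xy t)).
Proof.
apply: cont_into_set.
by apply: lerp_cont; [exact: tval_continuous|exact: contC|exact: contC].
Qed.

Lemma seg0 : into_set (seg_inI xy zero) = x.
Proof. by apply: val_inj; rewrite /= tval0 lerp0. Qed.

Lemma seg1 : into_set (seg_inI xy one) = y.
Proof. by apply: val_inj; rewrite /= tval1 lerp1. Qed.

Definition seg : {path I from x to y in Y} := mkpath seg_cont seg0 seg1.

Lemma val_seg t : val (seg t) = lerp (tval_itv t) (val x) (val y).
Proof. by []. Qed.

End Segment.

Definition tri_in (x y z : C) : Prop := forall a b c : R, 0 <= a -> 0 <= b -> 0 <= c ->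
  a + b + c = 1 ->
  A (a * x.1 + b * y.1 + c * z.1, a * x.2 + b * y.2 + c * z.2).

Lemma tri_seg12 x y z : tri_in x y z -> seg_in x y.
Proof.
move=> T t t01; have := T (1 - t) t 0.
rewrite !mul0r !addr0 subrK => H; apply: H; lra.
Qed.

Lemma tri_seg23 x y z : tri_in x y z -> seg_in y z.
Proof.
move=> T t t01; have := T 0 (1 - t) t.
by rewrite !mul0r !add0r subrK; apply => //; lra.
Qed.

Lemma tri_seg13 x y z : tri_in x y z -> seg_in x z.
Proof.
move=> T t t01; have := T (1 - t) 0 t.
rewrite !mul0r !addr0 subrK => H; apply: H; lra.
Qed.

(** The straight homotopy between two sides and the third sweeps only the triangle; the coefficients
    passed to [T] are barycentric coordinates of its points. *)
Lemma triangle_homotopic (x y z : Y) (xy : seg_in (val x) (val y))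
    (yz : seg_in (val y) (val z)) (xz : seg_in (val x) (val z)) :
  tri_in (val x) (val y) (val z) ->
  path_homotopic (pcat (seg xy) (seg yz)) (seg xz).
Proof.
move=> T; apply: straight_homotopic => s t; rewrite val_seg.
rewrite -[pcat _ _ t]/(path_cat _ _ t) path_catEt.
have := tval_itvP s; have := tval_itvP t; move: (tval_itv s) (tval_itv t) => {}s {}t t01 s01.
case: (leP t 2^-1) => t2; rewrite val_seg val_clamp; try lra.
  have := T ((1 - s) * (1 - 2 * t) + s * (1 - t)) ((1 - s) * (2 * t)) (s * t).
  rewrite /lerp /= => H.
  rewrite (_ : (_, _) = ((((1 - s) * (1 - 2 * t) + s * (1 - t)) * (val x).1 +
     (1 - s) * (2 * t) * (val y).1 + s * t * (val z).1),
    (((1 - s) * (1 - 2 * t) + s * (1 - t)) * (val x).2 +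
     (1 - s) * (2 * t) * (val y).2 + s * t * (val z).2))); last by congr (_, _); ring.
  by apply: H; [nra|nra|nra|ring].
have := T (s * (1 - t)) ((1 - s) * (2 - 2 * t)) ((1 - s) * (2 * t - 1) + s * t).
rewrite /lerp /= => H.
rewrite (_ : (_, _) = (s * (1 - t) * (val x).1 + (1 - s) * (2 - 2 * t) * (val y).1 +
     ((1 - s) * (2 * t - 1) + s * t) * (val z).1,
    s * (1 - t) * (val x).2 + (1 - s) * (2 - 2 * t) * (val y).2 +
     ((1 - s) * (2 * t - 1) + s * t) * (val z).2)); last by congr (_, _); ring.
by apply: H; [nra|nra|nra|ring].
Qed.

Section SegmentClass.
Variables (x0 : Y) (q : forall x, {path I from x0 to x in Y}).

(* 1 when the segment is not contained in A. *)
Definition segc (x y : Y) : pi1 R x0 :=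
  match pselect (seg_in (val x) (val y)) with
  | left xy => gauge q (seg xy)
  | right _ => 1%g
  end.

Lemma segcE x y (xy : seg_in (val x) (val y)) : segc x y = gauge q (seg xy).
Proof.
rewrite /segc; case: pselect => // xy'; congr gauge.
by apply/path_eqP => t; exact: val_inj.
Qed.

Lemma segc_tri x y z : tri_in (val x) (val y) (val z) ->
  (segc x y * segc y z)%g = segc x z.
Proof.
move=> T; rewrite (segcE (tri_seg12 T)) (segcE (tri_seg23 T)) (segcE (tri_seg13 T)).
by rewrite -gauge_cat; apply: gauge_homotopic; exact: triangle_homotopic.
Qed.

Lemma segc_third x y z : tri_in (val x) (val y) (val z) ->
  segc y z = ((segc x y)^-1 * segc x z)%g.
Proof. by move=> T; rewrite -(segc_tri T) mulKg. Qed.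

(** In a convex part of [A] the straight homotopy deforms a path to its chord. *)
Lemma segc_convex U x y (p : {path I from x to y in Y}) : convex_set U -> U `<=` A ->
  (forall t, U (val (p t))) -> gauge q p = segc x y.
Proof.
move=> cU UA Up.
have Ux : U (val x) by have := Up zero; rewrite path_zero.
have Uy : U (val y) by have := Up one; rewrite path_one.
have xy : seg_in (val x) (val y) by move=> t t01; apply: UA; exact: cU.
rewrite (segcE xy); apply: gauge_homotopic; apply: straight_homotopic => s t.
apply: UA; apply: (cU) => //; first exact: tval_itvP.
by rewrite val_seg; apply: cU => //; exact: tval_itvP.
Qed.

Lemma tri_convex U x y z : convex_set U -> U `<=` A -> U x -> U y -> U z -> tri_in x y z.
Proof.
move=> cU UA Ux Uy Uz a b c a0 b0 c0 abc.
(* A barycentre is an iterated [lerp]: first x and y with weight b / (a + b), then z with weight c.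
   The quotient is why a + b = 0 is separated. *)
apply: UA; have [ab0|ab0] := eqVneq (a + b) 0.
  have [-> [-> ->]] : a = 0 /\ b = 0 /\ c = 1 by lra.
  by rewrite !mul0r !add0r !mul1r -surjective_pairing.
have := cU (b / (a + b)) x y _ Ux Uy => U1.
have ab : 0 < a + b by rewrite lt_neqAle eq_sym ab0 addr_ge0.
have {}U1 : U (lerp (b / (a + b)) x y).
  apply: U1; apply/andP; split; first by apply: divr_ge0 => //; exact: ltW.
  by rewrite ler_pdivrMr//; lra.
have := cU c _ z _ U1 Uz => U2.
suff <- : lerp c (lerp (b / (a + b)) x y) z =
  (a * x.1 + b * y.1 + c * z.1, a * x.2 + b * y.2 + c * z.2) by apply: U2; lra.
by rewrite /lerp /= (_ : 1 - c = a + b); [congr (_, _); field|lra].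
Qed.

End SegmentClass.
End Plane.

(** * Holonomy over a cover by convex charts *)

Section HolonomyAtlas.
Local Open Scope ring_scope.
Local Open Scope classical_set_scope.
Variables (R : realType) (A : set (R * R)) (G : groupType) (rho : R * R -> R * R -> G).
Variables (J : Type) (U : J -> set (R * R)) (h : J -> R * R -> G).
Hypothesis U_open : forall j, open (U j).
Hypothesis U_convex : forall j, convex_set (U j).
Hypothesis U_sub : forall j, U j `<=` A.
Hypothesis U_cover : forall x, A x -> exists j, U j x.
Hypothesis rhoE : forall j x y, U j x -> U j y -> rho x y = ((h j x)^-1 * h j y)%g.

Local Notation Y := (set_type A).
Local Notation path x y := {path (unit_interval R) from x to y in Y}.

Definition rho_on (x y : Y) : G := rho (val x) (val y).

Lemma nbhs_chart j (x : Y) : U j (val x) -> nbhs x (val @^-1` U j).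
Proof.
move=> Ux; apply: open_nbhs_nbhs; split => //.
by apply: open_comp; [move=> y _; exact: val_set_cont|exact: U_open].
Qed.

Lemma cocycle_chart j : cocycle_on rho_on (val @^-1` U j).
Proof.
move=> x y z Ux Uy Uz.
by rewrite /rho_on !(@rhoE j)// -mulgA mulVKg.
Qed.

Lemma local_cocycle_chart : local_cocycle rho_on.
Proof.
move=> x; have [j Ux] := U_cover (set_typeP x).
by exists (val @^-1` U j); [exact: nbhs_chart|exact: cocycle_chart].
Qed.

Local Notation holA := (hol local_cocycle_chart).

Lemma hol_pcat x y z (p : path x y) (q : path y z) : holA (pcat p q) = (holA p * holA q)%g.
Proof. exact: hol_cat. Qed.

Lemma hol_pcst x : holA (@pcst R _ x) = 1%g.
Proof.
apply: (mulgI (holA (@pcst R _ x))); rewrite -hol_pcat mulg1.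
by apply: hol_homotopic; exact: path_catp1.
Qed.

Lemma hol_prevp x y (p : path x y) : holA (prevp p) = ((holA p)^-1)%g.
Proof.
apply: (mulgI (holA p)); rewrite -hol_pcat mulgV -(hol_pcst x).
by apply: hol_homotopic; exact: path_catpV.
Qed.

Lemma chart_path j (x y : Y) : U j (val x) -> U j (val y) ->
  exists p : path x y, holA p = ((h j (val x))^-1 * h j (val y))%g.
Proof.
move=> Ux Uy.
have xy : seg_in A (val x) (val y) by move=> t t01; apply: (U_sub (j := j)); exact: U_convex.
exists (seg xy); rewrite -(rhoE Ux Uy); apply: (hol_local _ (cocycle_chart (j := j))).
by move=> t; apply: U_convex => //; exact: tval_itvP.
Qed.

Lemma hol_ex_cat x y z g k : (exists p : path x y, holA p = g) ->
  (exists p : path y z, holA p = k) -> exists p : path x z, holA p = (g * k)%g.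
Proof. by move=> [p <-] [q <-]; exists (pcat p q); exact: hol_pcat. Qed.

(** Reduces surjectivity to generators of [G]. *)
Lemma loop_hol_subgroup x0 : is_subgroup [set g | exists p : path x0 x0, holA p = g].
Proof.
split=> [|_ _ [p <-] [q <-]|_ [p <-]].
- by exists (@pcst R _ x0); exact: hol_pcst.
- by exists (pcat p q); exact: hol_pcat.
- by exists (prevp p); exact: hol_prevp.
Qed.

(** Composing with the paths from [x0] to the ends multiplies the holonomy by fixed elements. *)
Lemma hol_surj x0 (q : forall x, path x0 x) :
  (forall g, exists p : path x0 x0, holA p = g) ->
  forall x y g, exists p : path x y, holA p = g.
Proof.
move=> S x y g; have [p pE] := S (holA (q x) * g * (holA (q y))^-1)%g.
exists (pcat (pcat (prevp (q x)) p) (q y)).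
rewrite !hol_pcat hol_prevp pE; move: (holA (q x)) (holA (q y)) => a b.
by rewrite -!mulgA mulKg mulVg mulg1.
Qed.

Section NullHomotopy.
Variables (x0 : Y) (q : forall x, path x0 x) (phi : G -> pi1 R x0).
Hypothesis phiM : {morph phi : g k / (g * k)%g}.
Hypothesis segc_chart : forall j x y, U j (val x) -> U j (val y) ->
  segc q x y = ((phi (h j (val x)))^-1 * phi (h j (val y)))%g.

(** By [segc_chart], [gauge] is [phi] of the holonomy on paths inside a chart, hence on all paths;
    trivial holonomy therefore gives the trivial class. *)
Lemma hol1_null x (p : path x x) : holA p = 1%g -> path_homotopic p (@pcst R _ x).
Proof.
move=> p1; apply: (@gauge_inj _ _ _ q).
rewrite gauge_cst (gauge_hol local_cocycle_chart phiM) ?p1 ?morph_one//.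
move=> y; have [j Uy] := U_cover (set_typeP y).
exists (val @^-1` U j) => [|z t r Ur]; first exact: nbhs_chart.
rewrite (segc_convex q (U_convex (j := j)) (U_sub (j := j)) Ur).
have Uz : U j (val z) by have := Ur zero; rewrite path_zero.
have Ut : U j (val t) by have := Ur one; rewrite path_one.
by rewrite (segc_chart Uz Ut) /rho_on (rhoE Uz Ut) phiM morph_inv.
Qed.

End NullHomotopy.

End HolonomyAtlas.

(** * The punctured plane *)

Section HalfPlanes.
Local Open Scope ring_scope.
Local Open Scope classical_set_scope.
Variable R : realType.
Local Notation C := (R * R)%type.

Lemma open_pos (T : topologicalType) (f : T -> R) :
  continuous f -> open [set x | 0 < f x].
Proof.
move=> cf; apply: (@open_comp _ _ f [set r | 0 < r]); last exact: open_gt.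
by move=> x _; exact: cf.
Qed.

Definition sign_of (s : bool) : R := if s then 1 else -1.

Definition vert (s : bool) : set C := [set z | 0 < sign_of s * z.2].
Definition horiz (s : bool) (c : R) : set C := [set z | 0 < sign_of s * z.1 - c].

Lemma vertT z : vert true z <-> 0 < z.2.
Proof. by rewrite /vert /sign_of /= mul1r. Qed.

Lemma vertF z : vert false z <-> z.2 < 0.
Proof. by rewrite /vert /sign_of /= mulN1r oppr_gt0. Qed.

Lemma horizT c z : horiz true c z <-> c < z.1.
Proof. by rewrite /horiz /sign_of /= mul1r subr_gt0. Qed.

Lemma horizF c z : horiz false c z <-> z.1 < - c.
Proof. by rewrite /horiz /sign_of /= mulN1r subr_gt0 ltrNr. Qed.

Lemma fst_cont : continuous (fst : C -> R).
Proof. by move=> z; exact: cvg_fst. Qed.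

Lemma snd_cont : continuous (snd : C -> R).
Proof. by move=> z; exact: cvg_snd. Qed.

Lemma vert_open s : open (vert s).
Proof. by apply: open_pos; apply: contM; [exact: contC|exact: snd_cont]. Qed.

Lemma horiz_open s c : open (horiz s c).
Proof.
apply: open_pos; apply: contB; last exact: contC.
by apply: contM; [exact: contC|exact: fst_cont].
Qed.

Lemma lerp_pos (t p q : R) : 0 <= t <= 1 -> 0 < p -> 0 < q -> 0 < (1 - t) * p + t * q.
Proof.
move=> /andP[t0 t1] p0 q0; have [->|t0'] := eqVneq t 0; first by rewrite subr0 mul1r mul0r addr0.
apply: ltr_wpDl; first by rewrite mulr_ge0 ?subr_ge0// ltW.
by rewrite mulr_gt0// lt_neqAle eq_sym t0'.
Qed.

Lemma vert_convex s : convex_set (vert s).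
Proof.
move=> t x y t01 Ux Uy; have := lerp_pos t01 Ux Uy; congr (0 < _).
by rewrite /lerp /=; ring.
Qed.

Lemma horiz_convex s c : convex_set (horiz s c).
Proof.
move=> t x y t01 Ux Uy; have := lerp_pos t01 Ux Uy; congr (0 < _).
by rewrite /lerp /=; ring.
Qed.

End HalfPlanes.

Section PuncturedPlane.
Local Open Scope ring_scope.
Local Open Scope classical_set_scope.
Variable R : realType.
Local Notation C := (R * R)%type.

Definition cstar : set C := [set z | ~ (z.1 = 0 /\ z.2 = 0)].
Local Notation Y := (set_type cstar).
Local Notation path x y := {path (unit_interval R) from x to y in Y}.

(** Selects one of [z] and its negative for each nonzero [z]. In the lower half-plane it means being
    to the right of the cut, the cut itself counting as left. *)
Definition positive (z : C) : bool := (0 < z.1) || ((z.1 == 0) && (0 < z.2)).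

Definition posn (z : C) : int := if positive z then 1 else 0.

(* Counts the signed crossings of the negative imaginary axis. *)
Definition cstar_rho (x y : C) : Zgroup :=
  if (x.2 < 0) && (y.2 < 0) then posn y - posn x else 0.

(* The charts are the half-planes; (true, s) is vertical and (false, s) horizontal. *)
Definition cstar_chart (j : bool * bool) : set C :=
  if j.1 then vert j.2 else horiz j.2 0.

Definition cstar_height (j : bool * bool) (z : C) : Zgroup :=
  if j.1 && ~~ j.2 then posn z else 0.

Lemma cstar_open j : open (cstar_chart j).
Proof. by case: j => -[] s; [exact: vert_open|exact: horiz_open]. Qed.

Lemma cstar_convex j : convex_set (cstar_chart j).
Proof. by case: j => -[] s; [exact: vert_convex|exact: horiz_convex]. Qed.

Lemma cstar_sub j : cstar_chart j `<=` cstar.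
Proof.
by case: j => -[] s z Uz [z1 z2]; move: Uz;
  rewrite /cstar_chart /= /vert /horiz /= ?z1 ?z2 mulr0 ?subr0 ltxx.
Qed.

Lemma cstar_cover x : cstar x -> exists j, cstar_chart j x.
Proof.
move=> xA; have [x1|x1|x1] := ltgtP x.1 0.
- by exists (false, false); rewrite /cstar_chart /horiz /sign_of /=; lra.
- by exists (false, true); rewrite /cstar_chart /horiz /sign_of /=; lra.
have [x2|x2|x2] := ltgtP x.2 0.
- by exists (true, false); rewrite /cstar_chart /vert /sign_of /=; lra.
- by exists (true, true); rewrite /cstar_chart /vert /sign_of /=; lra.
- by case: (xA (conj x1 x2)).
Qed.

Lemma cstar_rhoE j x y : cstar_chart j x -> cstar_chart j y ->
  cstar_rho x y = ((cstar_height j x)^-1 * cstar_height j y)%g.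
Proof.
have E (u v : int) : ((u : Zgroup)^-1 * v)%g = v - u :> int by rewrite addrC.
rewrite [RHS]E /cstar_chart /cstar_rho /cstar_height.
case: j => -[] [] /=; rewrite /vert /horiz /sign_of /= => Ux Uy.
- by rewrite subr0 ifF//; apply/negP; lra.
- by rewrite ifT//; lra.
- rewrite subr0 /posn /positive.
  have [-> ->] : 0 < x.1 /\ 0 < y.1 by split; lra.
  by case: ifP.
- rewrite subr0 /posn /positive !lt_neqAle.
  have /negPf-> : ~~ (0 <= x.1) by rewrite -ltNge; lra.
  have /negPf-> : ~~ (0 <= y.1) by rewrite -ltNge; lra.
  have /negPf-> : x.1 != 0 by apply/eqP; lra.
  have /negPf-> : y.1 != 0 by apply/eqP; lra.
  by rewrite !andbF /=; case: ifP.
Qed.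

Definition cstarL : local_cocycle (@rho_on R cstar _ cstar_rho) :=
  local_cocycle_chart cstar_open cstar_cover cstar_rhoE.

Definition cstar_pt (u v : R) (uv : cstar (u, v)) : Y := into_set uv.

Lemma cstar_i : cstar (0, 1). Proof. by move=> /= -[]; lra. Qed.
Lemma cstar_N1 : cstar (-1, 0). Proof. by move=> /= -[]; lra. Qed.
Lemma cstar_Ni : cstar (0, -1). Proof. by move=> /= -[]; lra. Qed.
Lemma cstar_SE : cstar (1, -1). Proof. by move=> /= -[]; lra. Qed.

Local Notation pI := (cstar_pt cstar_i).
Local Notation pV := (cstar_pt cstar_N1).
Local Notation pW := (cstar_pt cstar_Ni).
Local Notation pP := (cstar_pt cstar_SE).

Lemma cstar_seg_i z : positive z -> seg_in cstar (0, 1) z.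
Proof.
rewrite /positive => zp t t01 [/= E1 E2].
case/orP: zp => [z1|/andP[/eqP z1 z2]]; last by nra.
have /eqP : t * z.1 = 0 by lra.
by rewrite mulf_eq0 (gt_eqF z1) orbF => /eqP t0; rewrite t0 in E2; lra.
Qed.

Lemma cstar_seg_iN1 : seg_in cstar (0, 1) (-1, 0).
Proof. by move=> t t01 [/= E1 E2]; lra. Qed.

Lemma cstar_seg_N1 z : cstar z -> ~~ positive z -> seg_in cstar (-1, 0) z.
Proof.
rewrite /positive negb_or -leNgt => zA /andP[z1 z2] t t01 [/= E1 E2].
have t1 : t = 1 by nra.
by apply: zA; rewrite t1 in E1 E2; split; lra.
Qed.

Lemma mulr_eq0_pos (c r : R) : r != 0 -> c * r = 0 -> c = 0.
Proof. by move=> /negPf r0 /eqP; rewrite mulf_eq0 r0 orbF => /eqP. Qed.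

(** A sum of terms of one sign vanishes only if each term does, which leaves a single vertex, and
    this vertex is not 0. The next three triangles are treated alike. *)
Lemma cstar_tri1 z : 0 < z.2 -> tri_in cstar (0, 1) (-1, 0) z.
Proof.
move=> z2 a b c a0 b0 c0 abc [/= E1 E2].
have cz : 0 <= c * z.2 by rewrite mulr_ge0// ltW.
have a00 : a = 0 by lra.
have c00 : c = 0 by apply: (@mulr_eq0_pos _ z.2); [rewrite gt_eqF|lra].
by rewrite a00 c00 in abc E1; lra.
Qed.

Lemma cstar_tri2 z : z.2 < 0 -> tri_in cstar (-1, 0) (0, -1) z.
Proof.
move=> z2 a b c a0 b0 c0 abc [/= E1 E2].
have cz : c * z.2 <= 0 by rewrite mulr_ge0_le0// ltW.
have b00 : b = 0 by lra.
have c00 : c = 0 by apply: (@mulr_eq0_pos _ z.2); [rewrite lt_eqF|lra].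
by rewrite b00 c00 in abc E1; lra.
Qed.

Lemma cstar_tri3 z : 0 < z.1 -> tri_in cstar (0, 1) (1, -1) z.
Proof.
move=> z1 a b c a0 b0 c0 abc [/= E1 E2].
have cz : 0 <= c * z.1 by rewrite mulr_ge0// ltW.
have b00 : b = 0 by lra.
have c00 : c = 0 by apply: (@mulr_eq0_pos _ z.1); [rewrite gt_eqF|lra].
by rewrite b00 c00 in abc E2; lra.
Qed.

Lemma cstar_tri4 x y : 0 < x.1 -> 0 < y.1 -> tri_in cstar (0, 1) x y.
Proof.
move=> x1 y1 a b c a0 b0 c0 abc [/= E1 E2].
have bx : 0 <= b * x.1 by rewrite mulr_ge0// ltW.
have cy : 0 <= c * y.1 by rewrite mulr_ge0// ltW.
have b00 : b = 0 by apply: (@mulr_eq0_pos _ x.1); [rewrite gt_eqF|lra].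
have c00 : c = 0 by apply: (@mulr_eq0_pos _ y.1); [rewrite gt_eqF|lra].
by rewrite b00 c00 in abc E2; lra.
Qed.

Lemma positive_gt0 z : 0 < z.1 -> positive z.
Proof. by rewrite /positive => ->. Qed.

Lemma positive_lt0 z : z.1 < 0 -> ~~ positive z.
Proof. by move=> z1; rewrite /positive; apply/negP => /orP[|/andP[/eqP]]; lra. Qed.

Lemma positive_vertF z : z.2 < 0 -> positive z -> 0 < z.1.
Proof. by move=> z2; rewrite /positive => /orP[//|/andP[_]]; lra. Qed.

(** Connecting paths go straight from i to positive points and turn at -1 to reach the others, so
    they never cross the cut. Their shape is recorded so that the classes of these segments can be
    computed. *)
Lemma cstar_gauge_exists (x : Y) : exists q : path pI x,
  (positive (val x) -> exists H, q = seg (x := pI) H) /\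
  (~~ positive (val x) -> exists H H', q = pcat (seg (y := pV) H) (seg H')).
Proof.
have [xp|xp] := boolP (positive (val x)).
  have H : seg_in cstar (val pI) (val x) by exact: cstar_seg_i.
  by exists (seg H); split=> // _; exists H.
have H : seg_in cstar (val pI) (val pV) by exact: cstar_seg_iN1.
have H' : seg_in cstar (val pV) (val x) by apply: cstar_seg_N1 => //; exact: set_typeP.
by exists (pcat (seg H) (seg H')); split=> // _; exists H, H'.
Qed.

Definition cstar_gauge (x : Y) : path pI x := projT1 (cid (cstar_gauge_exists x)).

Local Notation L := (segc cstar_gauge).

Lemma cstar_gaugeE (x : Y) :
  (positive (val x) -> L pI x = 1%g) /\
  (~~ positive (val x) -> (L pI pV * L pV x)%g = 1%g).
Proof.
have posI : positive (val pI) by rewrite /positive /= eqxx ltr01 orbT.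
have qI : path_homotopic (cstar_gauge pI) (@pcst R _ pI).
  rewrite /cstar_gauge; case: (cid _) => q [/(_ posI)[H qE] _] /=; rewrite qE.
  by apply: straight_homotopic => s t [/= _]; lra.
have := gauge_base (q := cstar_gauge) x qI.
rewrite {2}/cstar_gauge; case: (cid _) => q [q1 q2] /= gq.
split=> xp.
  by have [H qE] := q1 xp; rewrite (segcE _ H) -qE.
by have [H [H' qE]] := q2 xp; rewrite (segcE _ H) (segcE _ H') -gauge_cat -qE.
Qed.

Lemma segc_pos x : positive (val x) -> L pI x = 1%g.
Proof. by have [] := cstar_gaugeE x. Qed.

Lemma segc_IV : L pI pV = 1%g.
Proof.
have [_ E] := cstar_gaugeE pV.
(* A degenerate triangle makes this class idempotent, hence trivial. *)
have V : (L pV pV * L pV pV)%g = L pV pV.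
  by apply: segc_tri => a b c a0 b0 c0 abc [/=]; lra.
have {}V : L pV pV = 1%g by apply: (mulgI (L pV pV)); rewrite V mulg1.
rewrite -E; first by rewrite V mulg1.
by apply: positive_lt0 => /=; lra.
Qed.

Lemma segc_neg x : ~~ positive (val x) -> L pV x = 1%g.
Proof. by have [_ E] := cstar_gaugeE x => /E; rewrite segc_IV mul1g. Qed.

(** The segment from -i to 1 - i leaves the cut to the right; closed up by the connecting paths, it
    turns once counterclockwise around 0. *)
Definition cstar_phi (n : Zgroup) : pi1 R pI := zexpg (L pW pP) n.

Lemma cstar_phiM : {morph cstar_phi : m n / (m * n)%g}.
Proof. by move=> m n; exact: zexpgD. Qed.

Lemma cstar_tri_chart j x y z : cstar_chart j x -> cstar_chart j y ->
  cstar_chart j z -> tri_in cstar x y z.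
Proof. exact: tri_convex (@cstar_convex j) (@cstar_sub j). Qed.

Lemma segc_vertT z : 0 < (val z).2 -> L pI z = 1%g.
Proof.
move=> z2; have [/segc_pos//|zp] := boolP (positive (val z)).
have T : tri_in cstar (val pI) (val pV) (val z) by exact: cstar_tri1.
by rewrite -(segc_tri _ T) segc_IV segc_neg ?mulg1.
Qed.

(** A non-positive [z] is compared through -1; a positive one through 1 - i, which like [z] is
    joined to i by a segment of trivial class. *)
Lemma segc_vertF z : (val z).2 < 0 -> L pW z = cstar_phi (posn (val z)).
Proof.
move=> z2; rewrite /posn; have [zp|zp] := boolP (positive (val z)); last first.
  have T : tri_in cstar (val pV) (val pW) (val z) by exact: cstar_tri2.
  rewrite (segc_third _ T) segc_neg ?segc_neg ?invg1 ?mulg1//.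
  by rewrite /positive /=; lra.
have z1 := positive_vertF z2 zp.
have T : tri_in cstar (val pW) (val pP) (val z).
  by apply: (@cstar_tri_chart (true, false)); apply/vertF => //=; lra.
have T' : tri_in cstar (val pI) (val pP) (val z) by exact: cstar_tri3.
rewrite -(segc_tri _ T) (segc_third _ T') !segc_pos ?invg1 ?mulg1//.
by apply: positive_gt0; exact: ltr01.
Qed.

(** Both ends are compared with one point: i for the upper and right half-planes, -i for the lower
    and -1 for the left. *)
Lemma cstar_segc j x y : cstar_chart j (val x) -> cstar_chart j (val y) ->
  L x y = ((cstar_phi (cstar_height j (val x)))^-1 * cstar_phi (cstar_height j (val y)))%g.
Proof.
have phi0 : cstar_phi 0 = 1%g by [].
have h1 z : cstar_height (true, true) z = 0 by [].
have h2 z : cstar_height (true, false) z = posn z by [].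
have h3 b z : cstar_height (false, b) z = 0 by [].
move: j => [[] []] Ux Uy; rewrite ?h1 ?h2 ?h3 ?phi0 ?invg1 ?mulg1.
- have T : tri_in cstar (val pI) (val x) (val y).
    by apply: (@cstar_tri_chart (true, true)) => //; apply/vertT; exact: ltr01.
  by move/vertT: Ux => Ux; move/vertT: Uy => Uy;
    rewrite (segc_third _ T) !segc_vertT// invg1 mulg1.
- have T : tri_in cstar (val pW) (val x) (val y).
    by apply: (@cstar_tri_chart (true, false)) => //; apply/vertF; rewrite /=; lra.
  by move/vertF: Ux => Ux; move/vertF: Uy => Uy; rewrite (segc_third _ T) !segc_vertF.
- move/horizT: Ux => Ux; move/horizT: Uy => Uy.
  have T : tri_in cstar (val pI) (val x) (val y) by exact: cstar_tri4.
  by rewrite (segc_third _ T) !segc_pos ?invg1 ?mulg1//; exact: positive_gt0.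
- have T : tri_in cstar (val pV) (val x) (val y).
    by apply: (@cstar_tri_chart (false, false)) => //; apply/horizF; rewrite /=; lra.
  move/horizF: Ux => Ux; move/horizF: Uy => Uy; rewrite oppr0 in Ux Uy.
  by rewrite (segc_third _ T) !segc_neg ?invg1 ?mulg1//; exact: positive_lt0.
Qed.

Lemma cstar_null x (p : path x x) : hol cstarL p = 1%g -> path_homotopic p (@pcst R _ x).
Proof. exact: (hol1_null cstar_convex cstar_sub cstar_phiM cstar_segc). Qed.

(** The boundary of the square of side 2 centred at 0, run counterclockwise from i; only its lower
    side crosses the cut. *)
Lemma cstar_square : exists p : path pI pI, hol cstarL p = 1.
Proof.
have NW : cstar (-1, 1) by move=> [/=]; lra.
have SW : cstar (-1, -1) by move=> [/=]; lra.
have NE : cstar (1, 1) by move=> [/=]; lra.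
have step j u v uA vA := @chart_path _ _ _ _ _ _ _ cstar_open cstar_convex cstar_sub
  cstar_cover cstar_rhoE j (@cstar_pt u.1 u.2 uA) (@cstar_pt v.1 v.2 vA).
have := step (true, true) (0, 1) (-1, 1) cstar_i NW _ _.
have := step (false, false) (-1, 1) (-1, -1) NW SW _ _.
have := step (true, false) (-1, -1) (1, -1) SW cstar_SE _ _.
have := step (false, true) (1, -1) (1, 1) cstar_SE NE _ _.
have := step (true, true) (1, 1) (0, 1) NE cstar_i _ _.
rewrite /cstar_chart /= /vert /horiz /sign_of /=.
have h1 z : cstar_height (true, true) z = 0 by [].
have h3 b z : cstar_height (false, b) z = 0 by [].
have hS : cstar_height (true, false) (-1, -1) = 0.
  by rewrite /cstar_height /posn /= (negPf (positive_lt0 _)) //=; lra.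
have hP : cstar_height (true, false) (1, -1) = 1.
  by rewrite /cstar_height /posn /= positive_gt0 //=; lra.
rewrite !h1 !h3 hS hP invg1 !mulg1.
move=> p5 p4 p3 p2 p1.
have := hol_ex_cat (hol_ex_cat (hol_ex_cat (hol_ex_cat
  (p1 _ _) (p2 _ _)) (p3 _ _)) (p4 _ _)) (p5 _ _).
rewrite !mul1g !mulg1; apply; lra.
Qed.

Lemma cstar_surj (x y : Y) (n : Zgroup) : exists p : path x y, hol cstarL p = n.
Proof.
apply: (hol_surj cstar_gauge) => {}n.
have [S1 SM SV] := loop_hol_subgroup cstar_open cstar_cover cstar_rhoE pI.
have S := cstar_square.
have SX k : exists p : path pI pI, hol cstarL p = (k%:Z : Zgroup).
  elim: k => [|k IH]; first exact: S1.
  by rewrite -addn1 PoszD; exact: (SM k%:Z 1 IH S).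
case: n => k; first exact: SX.
by rewrite NegzE; exact: (SV k.+1%:Z (SX k.+1)).
Qed.

End PuncturedPlane.

(** * The twice punctured plane *)

Section TwicePuncturedPlane.
Local Open Scope ring_scope.
Local Open Scope classical_set_scope.
Variable R : realType.
Local Notation C := (R * R)%type.

Definition cstar2 : set C := [set z | ~ (z.2 = 0 /\ (z.1 = 1 \/ z.1 = -1))].
Local Notation Y := (set_type cstar2).
Local Notation path x y := {path (unit_interval R) from x to y in Y}.
Local Notation sg := (@sign_of R).

Definition zone (s : bool) (z : C) : bool := 1 <= sg s * z.1.

Inductive chart2 := Vert of bool | Horiz of bool | Mid.

Definition cstar2_chart (j : chart2) : set C :=
  match j with
  | Vert s => vert s
  | Horiz s => horiz s 1
  | Mid => horiz true (-1) `&` horiz false (-1)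
  end.

Definition cstar2_height (j : chart2) (z : C) : F2 :=
  match j with
  | Vert s => if zone (~~ s) z then (if s then F2_b else F2_a) else 1%g
  | _ => 1%g
  end.

(* The letter a stands for crossing the cut going down from 1 and b for crossing
   the cut going up from -1, both counterclockwise: negation exchanges the two. *)
Definition cstar2_rho (x y : C) : F2 :=
  if (0 < x.2) && (0 < y.2) then
    ((cstar2_height (Vert true) x)^-1 * cstar2_height (Vert true) y)%g
  else if (x.2 < 0) && (y.2 < 0) then
    ((cstar2_height (Vert false) x)^-1 * cstar2_height (Vert false) y)%g
  else 1%g.

Lemma MidP z : cstar2_chart Mid z <-> -1 < z.1 < 1.
Proof.
split=> [[/horizT z1 /horizF z2]|/andP[z1 z2]]; first by rewrite z1; lra.
by split; [apply/horizT|apply/horizF; rewrite opprK].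
Qed.

Lemma cstar2_open j : open (cstar2_chart j).
Proof.
case: j => [s|s|]; [exact: vert_open|exact: horiz_open|].
by apply: openI; exact: horiz_open.
Qed.

Lemma cstar2_convex j : convex_set (cstar2_chart j).
Proof.
case: j => [s|s|]; [exact: vert_convex|exact: horiz_convex|].
by move=> t x y t01 [x1 x2] [y1 y2]; split; exact: horiz_convex.
Qed.

Lemma cstar2_sub j : cstar2_chart j `<=` cstar2.
Proof.
case: j => [[]|[]|] z; [move/vertT|move/vertF|move/horizT|move/horizF|move/MidP];
  by move=> Uz [z2 [z1|z1]]; rewrite ?z1 ?z2 in Uz; lra.
Qed.

Lemma cstar2_cover x : cstar2 x -> exists j, cstar2_chart j x.
Proof.
move=> xA; have [x2|x2|x2] := ltgtP x.2 0.
- by exists (Vert false); apply/vertF.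
- by exists (Vert true); apply/vertT.
have [x1|x1|x1] := ltgtP x.1 1; last by case: xA; split=> //; left.
- have [y1|y1|y1] := ltgtP x.1 (-1); last by case: xA; split=> //; right.
  + by exists (Horiz false); apply/horizF.
  + by exists Mid; apply/MidP; rewrite y1.
- by exists (Horiz true); apply/horizT.
Qed.

Lemma zone_disj s z : zone s z -> ~~ zone (~~ s) z.
Proof. by rewrite /zone /sign_of -ltNge; case: s => /=; lra. Qed.

Lemma zoneP z : [\/ cstar2_chart Mid z, zone true z | zone false z].
Proof.
have [z1|z1] := leP 1 z.1; first by apply: Or32; rewrite /zone /sign_of /=; lra.
have [z2|z2] := leP z.1 (-1); first by apply: Or33; rewrite /zone /sign_of /=; lra.
by apply: Or31; apply/MidP; rewrite z1 z2.
Qed.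

Lemma mid_zone s z : cstar2_chart Mid z -> ~~ zone s z.
Proof. by move/MidP => z1; rewrite /zone /sign_of -ltNge; case: s; lra. Qed.

Lemma cstar2_rhoE j x y : cstar2_chart j x -> cstar2_chart j y ->
  cstar2_rho x y = ((cstar2_height j x)^-1 * cstar2_height j y)%g.
Proof.
have same (t : bool) : zone (~~ t) x = zone (~~ t) y ->
    ((cstar2_height (Vert t) x)^-1 * cstar2_height (Vert t) y)%g = 1%g.
  by move=> E; rewrite /= E mulVg.
(* The height depends on the half-plane and the zones alone, and a chart other than [Vert] stays
   within the same zones. *)
have triv : (forall t, zone t x = zone t y) -> cstar2_rho x y = 1%g.
  by move=> E; rewrite /cstar2_rho !same//; case: ifP => // _; case: ifP.
case: j => [[]|s|].
- by move=> /vertT x2 /vertT y2; rewrite /cstar2_rho x2 y2.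
- move=> /vertF x2 /vertF y2; rewrite /cstar2_rho x2 y2 ifF//.
  by apply/negP; lra.
- move=> Ux Uy; rewrite triv ?invg1 ?mulg1// => t; rewrite /zone.
  by move: t Ux Uy; case: s => -[]; rewrite /= /horiz /sign_of /= => Ux Uy;
    apply/idP/idP; lra.
- move=> Ux Uy; rewrite triv ?invg1 ?mulg1// => t.
  by rewrite (negPf (mid_zone _ Ux)) (negPf (mid_zone _ Uy)).
Qed.

Definition cstar2L : local_cocycle (@rho_on R cstar2 _ cstar2_rho) :=
  local_cocycle_chart cstar2_open cstar2_cover cstar2_rhoE.

(* Points with real part >= 1 (s = true) or <= -1 (s = false) are joined to 0
   through cV s, which avoids the cut; entering their half-plane through cP s
   instead crosses it. *)
Definition cO : C := (0, 0).
Definition cI s : C := (0, sg s).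
Definition cV s : C := (2 * sg s, sg s).
Definition cP s : C := (2 * sg s, - sg s).

Lemma cstar2_O : cstar2 cO. Proof. by move=> [/= _ []]; lra. Qed.
Lemma cstar2_I s : cstar2 (cI s). Proof. by move=> [/= _ []]; lra. Qed.
Lemma cstar2_V s : cstar2 (cV s).
Proof. by rewrite /cV /sign_of; case: s => -[/= ? ?]; lra. Qed.
Lemma cstar2_P s : cstar2 (cP s).
Proof. by rewrite /cP /sign_of; case: s => -[/= ? ?]; lra. Qed.

Lemma mid_O : cstar2_chart Mid cO. Proof. by apply/MidP => /=; lra. Qed.
Lemma mid_I s : cstar2_chart Mid (cI s). Proof. by apply/MidP => /=; lra. Qed.
Lemma zone_V s : zone s (cV s).
Proof. by rewrite /zone /= /sign_of; case: s; lra. Qed.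
Lemma zone_P s : zone s (cP s).
Proof. by rewrite /zone /= /sign_of; case: s; lra. Qed.
Lemma vert_I s : cstar2_chart (Vert s) (cI s).
Proof. by rewrite /= /vert /= /sign_of; case: s; lra. Qed.
Lemma vert_V s : cstar2_chart (Vert s) (cV s).
Proof. by rewrite /= /vert /= /sign_of; case: s; lra. Qed.
Lemma vert_P s : cstar2_chart (Vert s) (cP (~~ s)).
Proof. by rewrite /= /vert /= /sign_of; case: s => /=; lra. Qed.
Lemma horiz_V s : cstar2_chart (Horiz s) (cV s).
Proof. by rewrite /= /horiz /= /sign_of; case: s; lra. Qed.
Lemma horiz_P s : cstar2_chart (Horiz s) (cP s).
Proof. by rewrite /= /horiz /= /sign_of; case: s; lra. Qed.

Lemma cstar2_tri_chart j x y z : cstar2_chart j x -> cstar2_chart j y ->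
  cstar2_chart j z -> tri_in cstar2 x y z.
Proof. exact: tri_convex (@cstar2_convex j) (@cstar2_sub j). Qed.

(** The two other vertices have abscissa 2 or -2, so the triangle can touch the vertical line
    through the puncture only at [z], which is not a puncture. *)
Lemma cstar2_tri1 s z : cstar2 z -> zone s z -> tri_in cstar2 (cV s) (cP s) z.
Proof.
rewrite /zone => zA zs a b c a0 b0 c0 abc [E2 E1]; apply: zA.
have cz : c <= c * (sg s * z.1) by rewrite ler_peMr.
have {}E1 : sg s * (a * (2 * sg s) + b * (2 * sg s) + c * z.1) <= 1.
  by move: E1 => /= [->|->]; rewrite /sign_of; case: (s); lra.
have ss : sg s * sg s = 1 by rewrite /sign_of; case: (s); lra.
have {}E1 : 2 * (a + b) + c * (sg s * z.1) <= 1.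
  apply: le_trans E1; rewrite le_eqVlt; apply/orP; left; apply/eqP.
  transitivity (2 * (a + b) * (sg s * sg s) + c * (sg s * z.1)); last by ring.
  by rewrite ss mulr1.
have a00 : a = 0 by lra.
have b00 : b = 0 by lra.
have c1 : c = 1 by lra.
move: E1 E2; rewrite a00 b00 c1 /= => E1 E2; split; first lra.
by move: zs E1; rewrite /sign_of; case: (s) => zs E1; [left|right]; lra.
Qed.

Lemma cstar2_tri2 s p : tri_in cstar2 cO (cI s) (p, sg s).
Proof.
move=> a b c a0 b0 c0 abc [/= E2 E1].
have bc : b + c = 0 by move: E2; rewrite /sign_of; case: (s); lra.
have c00 : c = 0 by lra.
by rewrite c00 in E1; case: E1; lra.
Qed.

Lemma cstar2_tri3 s : tri_in cstar2 cO (cI s) (cP (~~ s)).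
Proof.
have -> : cP (~~ s) = (2 * sg (~~ s), sg s) by rewrite /cP /sign_of; case: (s); rewrite /= ?opprK.
exact: cstar2_tri2.
Qed.

Definition cstar2_pt z (zA : cstar2 z) : Y := into_set zA.

Local Notation pO := (cstar2_pt cstar2_O).
Local Notation pI s := (cstar2_pt (@cstar2_I s)).
Local Notation pV s := (cstar2_pt (@cstar2_V s)).
Local Notation pP s := (cstar2_pt (@cstar2_P s)).

Lemma cstar2_gauge_exists (x : Y) : exists q : path pO x,
  (cstar2_chart Mid (val x) -> exists H, q = seg (x := pO) H) /\
  (forall s, zone s (val x) -> exists H H', q = pcat (seg (y := pV s) H) (seg H')).
Proof.
have qs s : zone s (val x) -> exists q : path pO x,
  exists H H', q = pcat (seg (y := pV s) H) (seg H').
  move=> xs.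
  have H : seg_in cstar2 (val pO) (val (pV s)) by apply: tri_seg13; exact: cstar2_tri2.
  have H' : seg_in cstar2 (val (pV s)) (val x).
    by apply: tri_seg13; apply: cstar2_tri1 => //; exact: set_typeP.
  by exists (pcat (seg H) (seg H')), H, H'.
have [xm|xs|xs] := zoneP (val x).
- have H : seg_in cstar2 (val pO) (val x).
    by apply: tri_seg13; apply: (cstar2_tri_chart mid_O mid_O).
  exists (seg H); split=> [_|s xs]; first by exists H.
  by have := mid_zone s xm; rewrite xs.
- have [q qE] := qs _ xs; exists q; split=> [xm|[]//].
    by have := mid_zone true xm; rewrite xs.
  by move=> xs'; have := zone_disj xs; rewrite xs'.
- have [q qE] := qs _ xs; exists q; split=> [xm|[]//].
    by have := mid_zone false xm; rewrite xs.
  by move=> xs'; have := zone_disj xs; rewrite xs'.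
Qed.

Definition cstar2_gauge (x : Y) : path pO x := projT1 (cid (cstar2_gauge_exists x)).

Local Notation L := (segc cstar2_gauge).

Lemma cstar2_gaugeE (x : Y) :
  (cstar2_chart Mid (val x) -> L pO x = 1%g) /\
  (forall s, zone s (val x) -> (L pO (pV s) * L (pV s) x)%g = 1%g).
Proof.
have qO : path_homotopic (cstar2_gauge pO) (@pcst R _ pO).
  rewrite /cstar2_gauge; case: (cid _) => q [/(_ mid_O)[H qE] _] /=; rewrite qE.
  by apply: straight_homotopic => s t [/= _ []]; lra.
have := gauge_base (q := cstar2_gauge) x qO.
rewrite {2}/cstar2_gauge; case: (cid _) => q [q1 q2] /= gq.
split=> [xp|s xs].
  by have [H qE] := q1 xp; rewrite (segcE _ H) -qE.
by have [H [H' qE]] := q2 s xs; rewrite (segcE _ H) (segcE _ H') -gauge_cat -qE.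
Qed.

Lemma segc2_mid x : cstar2_chart Mid (val x) -> L pO x = 1%g.
Proof. by have [] := cstar2_gaugeE x. Qed.

Lemma segc2_OV s : L pO (pV s) = 1%g.
Proof.
have [_ E] := cstar2_gaugeE (pV s).
have T : tri_in cstar2 (val (pV s)) (val (pV s)) (val (pV s)).
  exact: (cstar2_tri_chart (vert_V s) (vert_V s) (vert_V s)).
have V : L (pV s) (pV s) = 1%g by rewrite (segc_third _ T) mulVg.
by rewrite -(E s (zone_V s)) V mulg1.
Qed.

Lemma segc2_zone s x : zone s (val x) -> L (pV s) x = 1%g.
Proof. by have [_ E] := cstar2_gaugeE x => /E; rewrite segc2_OV mul1g. Qed.

(** The segment from 0 to [cP s] passes the puncture on the side of its cut, the connecting path to
    [cP s] on the other side; together they form a loop around that puncture. *)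
Definition cstar2_phi : F2 -> pi1 R pO := F2_lift (L pO (pP true)) (L pO (pP false)).

Lemma cstar2_phiM : {morph cstar2_phi : m n / (m * n)%g}.
Proof. exact: F2_liftM. Qed.

(** In this half-plane, zone [s] is reached from [cI s] through [cV s] without a letter, while the
    opposite zone is reached through [cP (~~ s)], across a cut. *)
Lemma segc2_vert s z : cstar2_chart (Vert s) (val z) ->
  L (pI s) z = cstar2_phi (cstar2_height (Vert s) (val z)).
Proof.
move=> zs; have LI : L pO (pI s) = 1%g by apply: segc2_mid; exact: mid_I.
have phi1 : cstar2_phi 1%g = 1%g := morph_one cstar2_phiM.
have [m|zz] : cstar2_chart Mid (val z) \/ exists t, zone t (val z).
    by have [|zz|zz] := zoneP (val z); [left|right; exists true|right; exists false].
  have T : tri_in cstar2 (val pO) (val (pI s)) (val z).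
    by apply: (cstar2_tri_chart mid_O (mid_I s)).
  rewrite (segc_third _ T) LI segc2_mid// /cstar2_height (negPf (mid_zone _ m)).
  by rewrite phi1 invg1 mulg1.
have [zz1|zz1] : zone s (val z) \/ zone (~~ s) (val z).
    by case: zz => t; case: t (s) => -[]; by [left|right].
  have T : tri_in cstar2 (val pO) (val (pI s)) (val (pV s)) by exact: cstar2_tri2.
  have T' : tri_in cstar2 (val (pI s)) (val (pV s)) (val z).
    exact: (cstar2_tri_chart (vert_I s) (vert_V s) zs).
  rewrite -(segc_tri _ T') (segc_third _ T) LI segc2_OV segc2_zone// /cstar2_height.
  by rewrite (negPf (zone_disj zz1)) phi1 invg1 !mulg1.
have T : tri_in cstar2 (val pO) (val (pI s)) (val (pP (~~ s))) by exact: cstar2_tri3.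
have T' : tri_in cstar2 (val (pI s)) (val (pP (~~ s))) (val z).
  exact: (cstar2_tri_chart (vert_I s) (vert_P s) zs).
have T'' : tri_in cstar2 (val (pV (~~ s))) (val (pP (~~ s))) (val z).
  by apply: cstar2_tri1 => //; exact: set_typeP.
rewrite -(segc_tri _ T') (segc_third _ T) (segc_third _ T'') LI.
rewrite (segc2_zone (x := pP (~~ s))) ?segc2_zone//; last exact: zone_P.
rewrite invg1 mul1g !mulg1 /cstar2_height zz1 /cstar2_phi.
by case: (s); rewrite ?F2_lift_a ?F2_lift_b.
Qed.

Lemma cstar2_segc j x y : cstar2_chart j (val x) -> cstar2_chart j (val y) ->
  L x y = ((cstar2_phi (cstar2_height j (val x)))^-1 *
    cstar2_phi (cstar2_height j (val y)))%g.
Proof.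
have phi1 : cstar2_phi 1%g = 1%g := morph_one cstar2_phiM.
case: j => [s|s|] Ux Uy.
- have T := cstar2_tri_chart (vert_I s) Ux Uy.
  by rewrite (@segc_third _ _ _ _ (pI s) x y T) !segc2_vert.
- have T := cstar2_tri_chart (horiz_V s) Ux Uy.
  have hz z : cstar2_chart (Horiz s) z -> zone s z.
    by rewrite /= /horiz /zone /= => ?; lra.
  rewrite (@segc_third _ _ _ _ (pV s) x y T) !segc2_zone ?invg1 ?mulg1 ?phi1 ?invg1 ?mulg1//;
    exact: hz.
- have T := cstar2_tri_chart mid_O Ux Uy.
  by rewrite (@segc_third _ _ _ _ pO x y T) !segc2_mid// ?invg1 ?mulg1 phi1 ?invg1 ?mulg1.
Qed.

Lemma cstar2_null x (p : path x x) : hol cstar2L p = 1%g -> path_homotopic p (@pcst R _ x).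
Proof. exact: (hol1_null cstar2_convex cstar2_sub cstar2_phiM cstar2_segc). Qed.

(** The loop encircles -1 when [s] is true and 1 otherwise. Only its second side, from [cI s] to
    [cP (~~ s)], crosses a cut. *)
Lemma cstar2_square s : exists p : path pO pO,
  hol cstar2L p = if s then F2_b else F2_a.
Proof.
have step j u v uA vA := @chart_path _ _ _ _ _ _ _ cstar2_open cstar2_convex cstar2_sub
  cstar2_cover cstar2_rhoE j (@cstar2_pt u uA) (@cstar2_pt v vA).
have p1 := step Mid _ _ cstar2_O (@cstar2_I s) mid_O (mid_I s).
have p2 := step (Vert s) _ _ (@cstar2_I s) (@cstar2_P (~~ s)) (vert_I s) (vert_P s).
have p3 := step (Horiz (~~ s)) _ _ (@cstar2_P (~~ s)) (@cstar2_V (~~ s)) (horiz_P _) (horiz_V _).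
have p4 := step (Vert (~~ s)) _ _ (@cstar2_V (~~ s)) (@cstar2_I (~~ s)) (vert_V _) (vert_I _).
have p5 := step Mid _ _ (@cstar2_I (~~ s)) cstar2_O (mid_I _) mid_O.
have := hol_ex_cat (hol_ex_cat (hol_ex_cat (hol_ex_cat p1 p2) p3) p4) p5.
rewrite /= (negPf (mid_zone _ (mid_I s))) zone_P (negPf (mid_zone _ (mid_I (~~ s)))).
rewrite (negPf (zone_disj (zone_V (~~ s)))) invg1 !mulg1 !mul1g.
exact.
Qed.

Lemma cstar2_surj (x y : Y) (g : F2) : exists p : path x y, hol cstar2L p = g.
Proof.
apply: (hol_surj cstar2_gauge) => {}g.
have [S1 SM SV] := loop_hol_subgroup cstar2_open cstar2_cover cstar2_rhoE pO.
move: g; apply: F2_ind => //.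
- exact: (cstar2_square false).
- exact: (cstar2_square true).
Qed.

Lemma cstar2_heightN s z : cstar2_height (Vert (~~ s)) (- z.1, - z.2) =
  F2_swap (cstar2_height (Vert s) z).
Proof.
have zN : zone s (- z.1, - z.2) = zone (~~ s) z.
  by rewrite /zone /sign_of; case: (s) => /=; rewrite ?mul1r ?mulN1r ?opprK.
rewrite /= negbK zN; case: ifP => _; last by rewrite (morph_one F2_swapM).
by rewrite /F2_swap; case: (s); rewrite ?F2_lift_a ?F2_lift_b.
Qed.

Lemma cstar2_rhoN x y : cstar2_rho (- x.1, - x.2) (- y.1, - y.2) =
  F2_swap (cstar2_rho x y).
Proof.
rewrite /cstar2_rho [_.2]/= [(- y.1, - y.2).2]/= !oppr_gt0 !oppr_lt0.
rewrite (cstar2_heightN false x) (cstar2_heightN false y).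
rewrite (cstar2_heightN true x) (cstar2_heightN true y).
case: ifP => x1; case: ifP => x2.
- by exfalso; move: x1 x2; lra.
- by rewrite -(morph_inv F2_swapM) -F2_swapM.
- by rewrite -(morph_inv F2_swapM) -F2_swapM.
- by rewrite (morph_one F2_swapM).
Qed.

End TwicePuncturedPlane.

(** * Behaviour of the cocycle of C* under negation *)

Section Negation.
Local Open Scope ring_scope.
Local Open Scope classical_set_scope.
Variable R : realType.
Local Notation C := (R * R)%type.
Local Notation A1 := (@cstar R).
Local Notation A2 := (@cstar2 R).

Definition cneg (z : C) : C := (- z.1, - z.2).
Definition cdot (z w : C) : R := z.1 * w.1 + z.2 * w.2.
Definition ccross (z w : C) : R := z.1 * w.2 - z.2 * w.1.

Lemma cnegK : involutive cneg.
Proof. by move=> [x y]; rewrite /cneg /= !opprK. Qed.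

Lemma cdotNr z w : cdot z (cneg w) = - cdot z w.
Proof. by rewrite /cdot /cneg /=; ring. Qed.

Lemma cdotNl z w : cdot (cneg z) w = - cdot z w.
Proof. by rewrite /cdot /cneg /=; ring. Qed.

Lemma cdot_gt0 z : A1 z -> 0 < cdot z z.
Proof.
move=> zA; rewrite /cdot -!expr2 lt_neqAle addr_ge0 ?sqr_ge0// andbT eq_sym.
by apply/eqP => /eqP; rewrite paddr_eq0 ?sqr_ge0// !sqrf_eq0 => /andP[/eqP ? /eqP ?]; exact: zA.
Qed.

(** The vectors at an angle of less than 45 degrees to [z0]; any two of them make an acute angle. *)
Definition cone (z0 : C) : set C :=
  [set z | 0 < cdot z z0 - ccross z z0] `&` [set z | 0 < cdot z z0 + ccross z z0].

Lemma cone_self z : A1 z -> cone z z.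
Proof.
by move=> /cdot_gt0 zz; split=> /=; rewrite /ccross mulrC subrr ?subr0 ?addr0.
Qed.

Lemma cone_open z0 : open (cone z0).
Proof.
have c1 : continuous (fun z : C => cdot z z0).
  by apply: contD; apply: contM; (exact: contC || exact: fst_cont || exact: snd_cont).
have c2 : continuous (fun z : C => ccross z z0).
  by apply: contB; apply: contM; (exact: contC || exact: fst_cont || exact: snd_cont).
by apply: openI; apply: open_pos; [exact: contB|exact: contD].
Qed.

(* dot z w |z0|^2 = dot z z0 dot w z0 + cross z z0 cross w z0 *)
Lemma cone_dot z0 z w : cone z0 z -> cone z0 w -> 0 < cdot z w.
Proof.
move=> [/= z1 z2] [/= w1 w2].
have E : cdot z w * cdot z0 z0 = cdot z z0 * cdot w z0 + ccross z z0 * ccross w z0.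
  by rewrite /cdot /ccross; ring.
have P : 0 < cdot z w * cdot z0 z0 by rewrite E; nra.
have Z : 0 <= cdot z0 z0 by rewrite /cdot -!expr2 addr_ge0 ?sqr_ge0.
by move: P; nra.
Qed.

Lemma cstarN z : A1 z -> A1 (cneg z).
Proof.
move=> zA [/= /eqP E1 /eqP E2]; rewrite !oppr_eq0 in E1 E2.
by apply: zA; split; exact/eqP.
Qed.

Lemma cstar2N z : A2 z -> A2 (cneg z).
Proof.
move=> zA [/= /eqP E1 E2]; rewrite oppr_eq0 in E1; apply: zA; split; first exact/eqP.
by case: E2 => E2; [right|left]; lra.
Qed.

Lemma positiveN z : A1 z -> positive (cneg z) = ~~ positive z.
Proof.
move=> zA; rewrite /positive /=; have [z1|z1|z1] := ltgtP z.1 0.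
- by rewrite oppr_gt0 z1.
- by rewrite oppr_gt0 oppr_eq0 ltNge (ltW z1) (gt_eqF z1).
rewrite z1 oppr0 ltxx eqxx /= oppr_gt0 -leNgt le_eqVlt.
by have [z2|z2|z2] := ltgtP z.2 0 => //; case: zA.
Qed.

Lemma posnN z : A1 z -> posn (cneg z) = 1 - posn z.
Proof. by move=> zA; rewrite /posn positiveN//; case: (positive z). Qed.

(** Negation moves the cut to the opposite ray, and the two counts differ by the coboundary of
    [posn]. If [x] and [y] share neither the open upper nor the open lower half-plane, the acute
    angle forces them to the same side of the vertical axis. *)
Lemma cstar_rhoN x y : A1 x -> A1 y -> 0 < cdot x y ->
  cstar_rho (cneg x) (cneg y) + posn y = cstar_rho x y + posn x :> int.
Proof.
move=> xA yA xy; rewrite /cstar_rho !posnN// [(cneg x).2]/= [(cneg y).2]/= !oppr_lt0.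
case: ifP => [/andP[x2 y2]|n1].
  rewrite ifF; last by apply/negP => /andP[]; lra.
  by rewrite add0r; lia.
case: ifP => [/andP[x2 y2]|n2]; first by rewrite add0r; lia.
rewrite !add0r /posn; congr (if _ then 1 else 0).
have x2y2 : x.2 * y.2 <= 0.
  have [a|a|a] := ltgtP x.2 0; have [b|b|b] := ltgtP y.2 0; rewrite ?a ?b ?mulr0 ?mul0r//.
  - by rewrite a b in n2.
  - by rewrite mulr_le0_ge0// ltW.
  - by rewrite mulr_ge0_le0// ltW.
  - by rewrite a b in n1.
have x1y1 : 0 < x.1 * y.1 by move: xy; rewrite /cdot; lra.
rewrite /positive.
have [a|a|a] := ltgtP x.1 0; have [b|b|b] := ltgtP y.1 0;
  rewrite ?a ?b ?mulr0 ?mul0r ?ltxx// in x1y1 *.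
- by nra.
- by nra.
Qed.

End Negation.

(** * A double cover by C \ {1, -1} times C* *)

Section DoubleCover.
Local Open Scope ring_scope.
Local Open Scope classical_set_scope.
Variable R : realType.
Local Notation C := (R * R)%type.
Local Notation I := (unit_interval R).
Local Notation Y1 := (set_type (@cstar R)).
Local Notation Y2 := (set_type (@cstar2 R)).
Local Notation E := (Y2 * Y1)%type.
Local Notation hol1 := (hol (@cstarL R)).
Local Notation hol2 := (hol (@cstar2L R)).

Definition negE (e : E) : E :=
  (into_set (cstar2N (set_typeP e.1)), into_set (cstarN (set_typeP e.2))).

Lemma negEK : involutive negE.
Proof.
by move=> [e1 e2]; rewrite /negE; congr (_, _); apply: val_inj; rewrite /= -[RHS]cnegK.
Qed.

Definition dotE (e e' : E) : R := cdot (val e.2) (val e'.2).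

Lemma dotE_negr e e' : dotE e (negE e') = - dotE e e'.
Proof. exact: cdotNr. Qed.

Lemma dotE_negl e e' : dotE (negE e) e' = - dotE e e'.
Proof. exact: cdotNl. Qed.

Definition posE (e : E) : bool := positive (val e.2).

Lemma posE_neg e : posE (negE e) = ~~ posE e.
Proof. by apply: positiveN; exact: set_typeP. Qed.

Definition sheet (e : E) : int := 1 - posn (val e.2).

Lemma sheet_pos e : posE e -> sheet e = 0.
Proof. by rewrite /sheet /posn /posE => ->. Qed.

Lemma sheet_npos e : ~~ posE e -> sheet e = 1.
Proof. by rewrite /sheet /posn /posE => /negPf->. Qed.

Lemma sheet_neg e : sheet (negE e) = 1 - sheet e.
Proof. by rewrite /sheet [posn _](posnN (set_typeP e.2)). Qed.

Definition kappa (e : E) : F2Z := (1%g, sheet e).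

(* A half turn of the two points is 1 in the factor Z of F2Z, so that a full
   turn of their difference counts twice. *)
Definition dbl (g : F2) (n : int) : F2Z := (g, n *+ 2).

Lemma oddz2 n : oddz (n *+ 2) = false.
Proof. by rewrite /oddz; lia. Qed.

Lemma oddzN n : oddz (- n) = oddz n.
Proof. by rewrite /oddz abszN. Qed.

Lemma dblM g h m n : (dbl g m * dbl h n)%g = dbl (g * h)%g (m + n).
Proof. by rewrite /dbl F2Z_mulE /swap_fun oddz2 mulrnDl. Qed.

Lemma dblV g m : ((dbl g m)^-1)%g = dbl (g^-1)%g (- m).
Proof. by apply: (mulgI (dbl g m)); rewrite mulgV dblM mulgV subrr. Qed.

Definition rhoE (e e' : E) : F2Z :=
  dbl (cstar2_rho (val e.1) (val e'.1)) (cstar_rho (val e.2) (val e'.2)).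

(** The change of gauge that makes the cocycle invariant under [negE] near the diagonal, so that it
    descends to the quotient. *)
Definition rhoK (e e' : E) : F2Z := ((kappa e)^-1 * rhoE e e' * kappa e')%g.

Lemma rhoKE e e' : rhoK e e' =
  (swap_fun (sheet e) (cstar2_rho (val e.1) (val e'.1)),
   - sheet e + cstar_rho (val e.2) (val e'.2) *+ 2 + sheet e').
Proof.
rewrite /rhoK /kappa F2Z_invE /rhoE /dbl !F2Z_mulE.
have swap1 n : swap_fun n 1%g = 1%g by rewrite (morph_one (swap_funM n)).
rewrite invg1 !swap1 mul1g mulg1; congr (_, _).
by rewrite -[LHS]/(swap_fun (- sheet e) _) /swap_fun oddzN.
Qed.

Lemma rhoK_neg e e' : 0 < dotE e e' -> rhoK (negE e) (negE e') = rhoK e e'.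
Proof.
move=> ee'; rewrite !rhoKE !sheet_neg; congr (_, _).
  rewrite [cstar2_rho _ _]cstar2_rhoN /swap_fun.
  have [ep|ep] := boolP (posE e); first by rewrite (sheet_pos ep) F2_swapK.
  by rewrite (sheet_npos ep).
have := cstar_rhoN (set_typeP e.2) (set_typeP e'.2) ee'.
rewrite /sheet /=; set r := cstar_rho _ _; set r' := cstar_rho _ _.
by move=> H; lia.
Qed.

Lemma cont_valE1 : continuous (fun e : E => val e.1).
Proof. by apply: (@cont_val _ (@cstar2 R) E fst) => e; exact: cvg_fst. Qed.

Lemma cont_valE2 : continuous (fun e : E => val e.2).
Proof. by apply: (@cont_val _ (@cstar R) E snd) => e; exact: cvg_snd. Qed.

(** The cone keeps a box disjoint from its image under [negE]. *)
Definition boxE (j1 : bool * bool) (j2 : chart2) (z0 : C) : set E :=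
  [set e | cstar2_chart j2 (val e.1) /\ (cstar_chart j1 (val e.2) /\ cone z0 (val e.2))].

Lemma boxE_open j1 j2 z0 : open (boxE j1 j2 z0).
Proof.
have op (T : topologicalType) (f : E -> T) U : continuous f -> open U -> open (f @^-1` U).
  by move=> cf; apply: open_comp => e _; exact: cf.
have -> : boxE j1 j2 z0 = (fun e => val e.1) @^-1` cstar2_chart j2 `&`
  (fun e => val e.2) @^-1` (cstar_chart j1 `&` cone z0) by [].
apply: openI; apply: op.
- exact: cont_valE1.
- exact: cstar2_open.
- exact: cont_valE2.
- by apply: openI; [exact: cstar_open|exact: cone_open].
Qed.

Lemma boxE_exists e : exists j1 j2, boxE j1 j2 (val e.2) e.
Proof.
have [j1 e1] := cstar_cover (set_typeP e.2); have [j2 e2] := cstar2_cover (set_typeP e.1).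
by exists j1, j2; split=> //; split=> //; apply: cone_self; exact: set_typeP.
Qed.

Lemma boxE_dot j1 j2 z0 e e' : boxE j1 j2 z0 e -> boxE j1 j2 z0 e' -> 0 < dotE e e'.
Proof. by move=> [_ [_ ez]] [_ [_ e'z]]; exact: cone_dot ez e'z. Qed.

Lemma rhoE_cocycle j1 j2 z0 : cocycle_on rhoE (boxE j1 j2 z0).
Proof.
move=> x y z [x2 [x1 _]] [y2 [y1 _]] [z2 [z1 _]]; rewrite /rhoE dblM; congr (dbl _ _).
  exact: (cocycle_chart (@cstar2_rhoE R) (j := j2) x2 y2 z2).
exact: (cocycle_chart (@cstar_rhoE R) (j := j1) x1 y1 z1).
Qed.

Variables (X : topologicalType) (P : E -> X).
Hypothesis P_cont : continuous P.
Hypothesis P_open : forall W, open W -> open (P @` W).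
Hypothesis P_surj : forall c, exists e, P e = c.
Hypothesis P_fiber : forall e e', P e = P e' <-> e' = e \/ e' = negE e.

Lemma P_neg e : P (negE e) = P e.
Proof. by apply/esym/P_fiber; right. Qed.

Lemma section_exists c : exists e, P e = c /\ posE e.
Proof.
have [e eE] := P_surj c; have [ep|ep] := boolP (posE e); first by exists e.
by exists (negE e); rewrite P_neg posE_neg.
Qed.

Definition sec (c : X) : E := projT1 (cid (section_exists c)).

Lemma secK c : P (sec c) = c.
Proof. by rewrite /sec; case: (cid _) => e []. Qed.

Lemma sec_pos c : posE (sec c).
Proof. by rewrite /sec; case: (cid _) => e []. Qed.

Lemma sec_P e : sec (P e) = e \/ sec (P e) = negE e.
Proof. by apply/P_fiber; rewrite secK. Qed.

(* rhoK transported to X, on which it is well defined near the diagonal. *)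
Definition rhoX (c d : X) : F2Z :=
  if 0 < dotE (sec c) (sec d) then rhoK (sec c) (sec d) else rhoK (sec c) (negE (sec d)).

Lemma rhoXE e e' : 0 < dotE e e' -> rhoX (P e) (P e') = rhoK e e'.
Proof.
move=> ee'; have nee' : (0 < - dotE e e') = false by apply/negP; lra.
rewrite /rhoX; case: (sec_P e) => ->; case: (sec_P e') => ->.
- by rewrite ee'.
- by rewrite dotE_negr nee' negEK.
- by rewrite dotE_negl nee' rhoK_neg.
- by rewrite dotE_negl dotE_negr opprK ee' rhoK_neg.
Qed.

Lemma rhoX_cocycle j1 j2 z0 : cocycle_on rhoX (P @` boxE j1 j2 z0).
Proof.
move=> _ _ _ [x Ux <-] [y Uy <-] [z Uz <-].
rewrite !rhoXE; [|exact: boxE_dot Ux Uz|exact: boxE_dot Uy Uz|exact: boxE_dot Ux Uy].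
rewrite /rhoK !mulgA mulgK; congr (_ * _)%g.
by rewrite -!mulgA (rhoE_cocycle Ux Uy Uz).
Qed.

Lemma rhoXL : local_cocycle rhoX.
Proof.
move=> c; have [j1 [j2 cB]] := boxE_exists (sec c).
exists (P @` boxE j1 j2 (val (sec c).2)); last exact: rhoX_cocycle.
apply: open_nbhs_nbhs; split; first by apply: P_open; exact: boxE_open.
by exists (sec c) => //; exact: secK.
Qed.

Local Notation holX := (hol rhoXL).

(** The lifts upstairs, multiplied by [kappa], form a lift for [rhoX]: the factor [kappa] accounts
    for the change of gauge. *)
Lemma hol_P (s s' : Y2) (d d' : Y1) (c c' : X) (p2 : {path I from s to s' in Y2})
    (p1 : {path I from d to d' in Y1}) (p : {path I from c to c' in X}) :
  (forall t, p t = P (p2 t, p1 t)) ->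
  holX p = ((kappa (s, d))^-1 * dbl (hol2 p2) (hol1 p1) * kappa (s', d'))%g.
Proof.
move=> pE.
pose h2 := path_lift (@cstar2L R) p2; pose h1 := path_lift (@cstarL R) p1.
have hL2 : hlift (@rho_on R _ _ (@cstar2_rho R)) (path_ext p2) 0 1 h2 by exact: path_liftP.
have hL1 : hlift (@rho_on R _ _ (@cstar_rho R)) (path_ext p1) 0 1 h1 by exact: path_liftP.
pose e t : E := (path_ext p2 t, path_ext p1 t).
have ce : continuous e by apply: continuous_pair; exact: path_ext_cont.
pose k t := (dbl (h2 t) (h1 t) * kappa (e t))%g.
have kL : hlift rhoX (path_ext p) 0 1 k.
  move=> t t01; have [r2 r20 E2] := hL2 t t01; have [r1 r10 E1] := hL1 t t01.
  have [j1 [j2 cB]] := boxE_exists (e t).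
  have [|r r0 Er] := @continuous_eps _ _ e t (boxE j1 j2 (val (e t).2)) (ce t).
    by apply: open_nbhs_nbhs; split => //; exact: boxE_open.
  exists (Num.min r (Num.min r1 r2)) => [|a b la lb]; first by rewrite !lt_min r0 r10.
  rewrite !lt_min => /andP[ar /andP[ar1 ar2]] /andP[br /andP[br1 br2]].
  have -> : path_ext p a = P (e a) by rewrite /path_ext pE.
  have -> : path_ext p b = P (e b) by rewrite /path_ext pE.
  rewrite rhoXE; last exact: boxE_dot (Er _ ar) (Er _ br).
  rewrite /k /rhoK !mulgA mulgK; congr (_ * _)%g.
  by rewrite /rhoE dblM (E2 a b)// (E1 a b).
rewrite (holE rhoXL kL) /k /hol -/h2 -/h1 invgM -dblM -dblV !mulgA.
have -> : e 0 = (s, d) by rewrite /e /path_ext !path_zero.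
by have -> : e 1 = (s', d') by rewrite /e /path_ext !path_one.
Qed.

Lemma pi1_hol_surj (c : X) (w : F2Z) : exists x : pi1 R c, pi1_hol rhoXL x = w.
Proof.
pose s := (sec c).1; pose d := (sec c).2.
have sdE : sec c = (s, d) by rewrite /s /d; case: (sec c).
have k1 : kappa (s, d) = 1%g by rewrite -sdE /kappa sheet_pos//; exact: sec_pos.
have mk (s' : Y2) (d' : Y1) (g : F2) (k : int) : P (s', d') = c ->
    exists x : pi1 R c, pi1_hol rhoXL x = (dbl g k * kappa (s', d'))%g.
  move=> Psd; have [p2 E2] := cstar2_surj s s' g; have [p1 E1] := cstar_surj d d' k.
  have cp : continuous (fun t : I => P (p2 t, p1 t)).
    apply: (@continuous_compose _ _ _ (fun t : I => (p2 t, p1 t)) P) => //.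
    by apply: continuous_pair; exact: cts_fun.
  have p_0 : P (p2 zero, p1 zero) = c by rewrite !path_zero -sdE secK.
  have p_1 : P (p2 one, p1 one) = c by rewrite !path_one.
  exists (\pi_(pi1 R c) (mkpath cp p_0 p_1))%qT.
  rewrite pi1_holE (@hol_P _ _ _ _ _ _ p2 p1)//.
  by rewrite k1 invg1 mul1g -E2 -E1.
(* An odd number of half turns comes from a path joining [sec c] to its negative, an even number
   from a loop at [sec c]. *)
case: w => g n; have [no|ne] := boolP (oddz n).
  have := mk (negE (s, d)).1 (negE (s, d)).2 g ((n - 1) %/ 2)%Z.
  rewrite -[(_, _)]/(negE (s, d)) P_neg -sdE secK => /(_ erefl)[x xE].
  exists x; rewrite xE /kappa sheet_npos ?posE_neg ?negbK ?sec_pos//.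
  rewrite /dbl F2Z_mulE (morph_one (swap_funM _)) mulg1; congr (_, _).
  by move: no; rewrite /oddz; lia.
have [|x xE] := mk s d g (n %/ 2)%Z; first by rewrite -sdE secK.
exists x; rewrite xE k1 mulg1 /dbl; congr (_, _).
by move: ne; rewrite /oddz; lia.
Qed.

(** Values of [sec] lie on sheet 0 and full turns count twice, so only the passage to the negative
    in [rhoX] contributes an odd number. *)
Lemma oddz_rhoX c d : oddz (rhoX c d).2 = ~~ (0 < dotE (sec c) (sec d)).
Proof.
rewrite /rhoX; case: ifP => _; rewrite rhoKE /= sheet_pos ?sec_pos// oppr0 add0r.
  by rewrite sheet_pos ?sec_pos// addr0 oddz2.
by rewrite sheet_npos ?posE_neg ?negbK ?sec_pos// oddzD oddz2.
Qed.

Lemma dotE_cont e0 : continuous (dotE e0).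
Proof.
have c1 := cont_fst cont_valE2; have c2 := cont_snd cont_valE2.
by apply: contD; apply: contM => //; exact: contC.
Qed.

Section Lift.
Variables (c : X) (p : {path I from c to c in X}).

Let h := path_lift rhoXL p.
Let f := path_ext p.

Definition cover_lift_sheet (t : R) : bool := oddz ((h t).2 - (h 0).2).

(* The parity of the number of half turns tells which sheet the lift is on. *)
Definition cover_lift (t : R) : E :=
  if cover_lift_sheet t then negE (sec (f t)) else sec (f t).

Lemma P_cover_lift t : P (cover_lift t) = f t.
Proof. by rewrite /cover_lift; case: ifP => _; rewrite ?P_neg secK. Qed.

(** When [sec] jumps to the other sheet the parity of [h] changes too, and the two signs cancel. *)
Lemma cover_lift_dot t : 0 <= t <= 1 -> exists2 r : R, 0 < r &
  forall a, 0 <= a <= 1 -> `|a - t| < r -> 0 < dotE (cover_lift t) (cover_lift a).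
Proof.
move=> t01; have [r r0 hr] := path_liftP rhoXL p t01.
have [j1 [j2 cB]] := boxE_exists (cover_lift t).
have [|r' r'0 fr] := @continuous_eps _ _ f t (P @` boxE j1 j2 (val (cover_lift t).2))
    (@path_ext_cont _ _ _ _ p t).
  apply: open_nbhs_nbhs; split; first by apply: P_open; exact: boxE_open.
  by exists (cover_lift t) => //; exact: P_cover_lift.
exists (Num.min r r') => [|a a01]; first by rewrite lt_min r0.
rewrite lt_min => /andP[ar ar'].
have [e' e'B e'a] := fr _ ar'; have dte' := boxE_dot cB e'B.
have ha : h a = (h t * rhoX (f t) (f a))%g.
  by apply: hr => //; rewrite subrr normr0.
have par : cover_lift_sheet a = cover_lift_sheet t (+) ~~ (0 < dotE (sec (f t)) (sec (f a))).
  rewrite -oddz_rhoX -oddzD; congr oddz.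
  have -> : (h a).2 = (h t).2 + (rhoX (f t) (f a)).2 :> int by rewrite ha.
  by rewrite addrAC.
(* The representatives agree up to sign with the lift at [t] and with the point [e'] of its box,
   whose product is positive. *)
have : dotE (sec (f t)) (sec (f a)) != 0.
  have d0 : dotE (cover_lift t) e' != 0 by rewrite gt_eqF.
  have [->|->] : sec (f a) = e' \/ sec (f a) = negE e' by rewrite -e'a; exact: sec_P.
    by move: d0; rewrite /cover_lift; case: ifP => _; rewrite ?dotE_negl ?oppr_eq0.
  by move: d0; rewrite /cover_lift; case: ifP => _; rewrite ?dotE_negl dotE_negr ?oppr_eq0.
rewrite /cover_lift par.
by have [d0|d0|d0] := ltgtP 0 (dotE (sec (f t)) (sec (f a)));
  rewrite // ?eqxx//; case: (cover_lift_sheet t);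
  rewrite /= ?dotE_negl ?dotE_negr ?opprK ?oppr_gt0.
Qed.

(** Openness of [P] gives a preimage of [f t] close to the lift at [t0]; the lift at [t] is this
    point or its negative, and the sign of the product excludes the latter. *)
Lemma cover_lift_cont : continuous (fun t : I => cover_lift (tval_itv t)).
Proof.
move=> t0 W; rewrite nbhsE => -[W0 [W0o W0t] W0W].
have [r r0 dr] := cover_lift_dot (tval_itvP t0).
pose W' := W0 `&` [set e | 0 < dotE (cover_lift (tval_itv t0)) e].
have W'o : open W' by apply: openI => //; apply: open_pos; exact: dotE_cont.
have dtt : 0 < dotE (cover_lift (tval_itv t0)) (cover_lift (tval_itv t0)).
  by apply: dr; [exact: tval_itvP|rewrite subrr normr0].
have [|r' r'0 fr] := @continuous_eps _ _ f (tval_itv t0) (P @` W')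
    (@path_ext_cont _ _ _ _ p (tval_itv t0)).
  apply: open_nbhs_nbhs; split; first exact: P_open.
  by exists (cover_lift (tval_itv t0)) => //; exact: P_cover_lift.
have m0 : 0 < Num.min r r' by rewrite lt_min r0.
have N := @tval_continuous R t0 _ (nbhsx_ballx (tval_itv t0) _ m0).
suff S : @tval_itv R @^-1` ball (tval_itv t0) (Num.min r r') `<=`
    (fun t => cover_lift (tval_itv t)) @^-1` W by exact: (filterS S N).
move=> t; rewrite /ball /= distrC lt_min => /andP[tr tr'].
have [e' [e'W e'd] e't] := fr _ tr'.
have := dr _ (tval_itvP t) tr.
have [->|->] : cover_lift (tval_itv t) = e' \/ cover_lift (tval_itv t) = negE e'.
  by apply/P_fiber; rewrite P_cover_lift.
- by move=> _; exact: W0W.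
- by rewrite dotE_negr; move: e'd => /=; lra.
Qed.

(** Trivial holonomy closes the lift and makes both of its components have trivial holonomy; their
    null homotopies are pushed down by [P]. *)
Lemma hol1_nullX : holX p = 1%g -> path_homotopic p (@pcst R _ c).
Proof.
move=> p1; have h01 : h 1 = h 0 by apply: (mulgI (h 0)^-1)%g; rewrite mulVg.
have l0 : cover_lift (tval_itv (zero : I)) = sec c.
  by rewrite /cover_lift tval0 /cover_lift_sheet subrr /f /path_ext path_zero.
have l1 : cover_lift (tval_itv (one : I)) = sec c.
  by rewrite /cover_lift tval1 /cover_lift_sheet h01 subrr /f /path_ext path_one.
have c2 := cont_fst cover_lift_cont; have c1 := cont_snd cover_lift_cont.
have l02 := congr1 fst l0; have l12 := congr1 fst l1.
have l01 := congr1 snd l0; have l11 := congr1 snd l1.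
pose p2 := mkpath c2 l02 l12; pose q1 := mkpath c1 l01 l11.
have pE t : p t = P (p2 t, q1 t).
  rewrite -[(_, _)]surjective_pairing P_cover_lift /f /path_ext clampK//.
have := hol_P pE; rewrite p1 -surjective_pairing /kappa sheet_pos ?sec_pos//.
rewrite -[(1%g, 0)]/(1%g : F2Z) invg1 mul1g mulg1 => -[] /esym h2 h1.
have {}h1 : hol1 q1 = 1%g.
  have z2 (z : int) : 0 = z *+ 2 -> z = 0 by lia.
  exact: z2 h1.
have [K2 [cK2 K20 K21 K2z K2o]] := cstar2_null h2.
have [K1 [cK1 K10 K11 K1z K1o]] := cstar_null h1.
exists (fun a => P (K2 a, K1 a)); split=> [|t|t|s|s].
- apply: (@continuous_compose _ _ _ (fun a => (K2 a, K1 a)) P) => //.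
  exact: continuous_pair.
- by rewrite K20 K10 pE.
- by rewrite K21 K11 -surjective_pairing secK.
- by rewrite K2z K1z -surjective_pairing secK.
- by rewrite K2o K1o -surjective_pairing secK.
Qed.

End Lift.

Lemma pi1_hol_inj (c : X) : injective (@pi1_hol R _ _ _ rhoXL c).
Proof.
have holM := @pi1_holM R _ _ _ rhoXL c.
have ker (x : pi1 R c) : pi1_hol rhoXL x = 1%g -> x = 1%g.
  by elim/pi1W: x => p; rewrite pi1_holE => /hol1_nullX ?; apply/pi1_piP.
move=> x y xy; apply: (@mulIg _ (y^-1)%g); rewrite mulgV; apply: ker.
by rewrite holM xy (morph_inv holM) mulgV.
Qed.

Theorem gamma2_pi1_cover (c : X) :
  group_isomorphic (Gamma2 (pi1 R c : groupType)) (semidirect (conjZ (F2_b^-1 * F2_a)%g)).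
Proof.
by apply: (gamma2_of_F2Z (@pi1_holM R _ _ _ rhoXL c)); [exact: pi1_hol_inj|exact: pi1_hol_surj].
Qed.

End DoubleCover.

(** * Pairs of points in C* *)

Lemma cont_into_ptws (T M : topologicalType) (J : Type) (f : T -> {ptws J -> M}) :
  (forall j, continuous (fun t => f t j)) -> continuous f.
Proof.
move=> cf t; apply/cvg_sup => j.
exact: (@continuous_comp_initial _ _ _ (fun g : J -> M => g j) f (cf j)).
Qed.

Lemma cont_eval (M : topologicalType) (J : eqType) (j : J) :
  continuous (fun f : {ptws J -> M} => f j).
Proof. exact: (@proj_continuous J (fun=> M) j). Qed.

Lemma perm_I2 (s : 'S_2) : (forall i, s i = i) \/
  (s ord0 = ord_max /\ s ord_max = ord0).
Proof.
have two (i : 'I_2) : i = ord0 \/ i = ord_max.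
  by case: i => [[|[|//]] ?]; [left|right]; exact: val_inj.
have inj : s ord0 <> s ord_max by move/perm_inj.
have [s0|s0] := two (s ord0); have [s1|s1] := two (s ord_max).
- by case: inj; rewrite s0 s1.
- by left=> i; have [->|->] := two i.
- by right.
- by case: inj; rewrite s0 s1.
Qed.

Section ComplexCoordinates.
Local Open Scope ring_scope.
Local Open Scope classical_set_scope.
Variable R : realType.
Local Notation C := (R * R)%type.
Local Notation Y1 := (set_type (@cstar R)).
Local Notation Y2 := (set_type (@cstar2 R)).
Local Notation E := (Y2 * Y1)%type.

Definition cmul (z w : C) : C := (z.1 * w.1 - z.2 * w.2, z.1 * w.2 + z.2 * w.1).
Definition cnorm2 (z : C) : R := z.1 * z.1 + z.2 * z.2.
Definition cdiv (z w : C) : C :=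
  ((z.1 * w.1 + z.2 * w.2) / cnorm2 w, (z.2 * w.1 - z.1 * w.2) / cnorm2 w).

Lemma cnorm2_neq0 z : cstar z -> cnorm2 z != 0.
Proof. by move=> zA; rewrite gt_eqF//; exact: cdot_gt0. Qed.

(* The points with difference d and (y1 + y2) / (y1 - y2) = s. *)
Definition pt1 (s d : C) : C := cmul d ((s.1 + 1) / 2, s.2 / 2).
Definition pt2 (s d : C) : C := cmul d ((s.1 - 1) / 2, s.2 / 2).

Lemma cmul_cstar z w : cstar z -> cstar w -> cstar (cmul z w).
Proof.
move=> /cnorm2_neq0 z0 /cnorm2_neq0 w0 [/= E1 E2].
have : cnorm2 z * cnorm2 w = 0.
  transitivity ((z.1 * w.1 - z.2 * w.2) ^+ 2 + (z.1 * w.2 + z.2 * w.1) ^+ 2).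
    by rewrite /cnorm2; ring.
  by rewrite E1 E2 expr0n addr0.
by apply/eqP; rewrite mulf_eq0 negb_or z0.
Qed.

Lemma pt1_cstar s d : cstar2 s -> cstar d -> cstar (pt1 s d).
Proof.
move=> sA dA; apply: cmul_cstar => // -[/= E1 E2]; apply: sA.
by split; [lra|right; lra].
Qed.

Lemma pt2_cstar s d : cstar2 s -> cstar d -> cstar (pt2 s d).
Proof.
move=> sA dA; apply: cmul_cstar => // -[/= E1 E2]; apply: sA.
by split; [lra|left; lra].
Qed.

Lemma pt1N s d : pt1 (cneg s) (cneg d) = pt2 s d.
Proof. by rewrite /pt1 /pt2 /cmul /cneg /=; congr (_, _); field. Qed.

Definition csub (z w : C) : C := (z.1 - w.1, z.2 - w.2).
Definition cadd (z w : C) : C := (z.1 + w.1, z.2 + w.2).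

Lemma csub_pt s d : csub (pt1 s d) (pt2 s d) = d.
Proof. by case: d => d1 d2; rewrite /csub /pt1 /pt2 /cmul /=; congr (_, _); field. Qed.

Lemma cadd_pt s d : cadd (pt1 s d) (pt2 s d) = cmul s d.
Proof. by rewrite /cadd /pt1 /pt2 /cmul /=; congr (_, _); field. Qed.

Lemma cmulK s d : cstar d -> cdiv (cmul s d) d = s.
Proof.
move=> /cnorm2_neq0 d0; case: s => s1 s2; rewrite /cdiv /cmul /=.
by congr (_, _); rewrite -[RHS](mulfK d0); congr (_ / _); rewrite /cnorm2; ring.
Qed.

Lemma cdivK z d : cstar d -> cmul (cdiv z d) d = z.
Proof.
move=> /cnorm2_neq0 d0; case: z => s1 s2; rewrite /cdiv /cmul /=.
by congr (_, _); rewrite -[RHS](mulfK d0);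
  rewrite [in RHS]mulrAC; move: d0; rewrite /cnorm2 => d0; field.
Qed.

Lemma csub_cstar z w : z <> w -> cstar (csub z w).
Proof.
case: z w => [z1 z2] [w1 w2] zw [/= E1 E2]; apply: zw.
by congr (_, _); lra.
Qed.

Lemma pt1_coord z w : z <> w ->
  pt1 (cdiv (cadd z w) (csub z w)) (csub z w) = z.
Proof.
move=> /csub_cstar dA; have := cdivK (cadd z w) dA.
move: (cdiv _ _) => s; case: z w dA => [z1 z2] [w1 w2] dA [E1 E2].
by rewrite /pt1 /cmul /=; congr (_, _); move: E1 E2; rewrite /=; lra.
Qed.

Lemma pt2_coord z w : z <> w ->
  pt2 (cdiv (cadd z w) (csub z w)) (csub z w) = w.
Proof.
move=> /csub_cstar dA; have := cdivK (cadd z w) dA.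
move: (cdiv _ _) => s; case: z w dA => [z1 z2] [w1 w2] dA [E1 E2].
by rewrite /pt2 /cmul /=; congr (_, _); move: E1 E2; rewrite /=; lra.
Qed.

(** The value 1 would put the second point at 0, and -1 the first. *)
Lemma coord_cstar2 z w : cstar z -> cstar w -> z <> w ->
  cstar2 (cdiv (cadd z w) (csub z w)).
Proof.
move=> zA wA zw [E1 E2]; have P1 := pt1_coord zw; have P2 := pt2_coord zw.
pose s := cdiv (cadd z w) (csub z w); pose d := csub z w.
have {}P1 : pt1 s d = z := P1; have {}P2 : pt2 s d = w := P2.
have {}E1 : s.2 = 0 := E1; have {E2} : s.1 = 1 \/ s.1 = -1 := E2.
move: s d P1 P2 E1 => s d P1 P2 E1 [s1|s1].
- by apply: wA; rewrite -P2 /pt2 /cmul /= E1 s1; split; field.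
- by apply: zA; rewrite -P1 /pt1 /cmul /= E1 s1; split; field.
Qed.

End ComplexCoordinates.

Section ConfigurationCover.
Local Open Scope ring_scope.
Local Open Scope classical_set_scope.
Local Open Scope quotient_scope.
Variable R : realType.
Local Notation C := (R * R)%type.
Local Notation Y1 := (set_type (@cstar R)).
Local Notation Y2 := (set_type (@cstar2 R)).
Local Notation E := (Y2 * Y1)%type.
Variables (M : topologicalType) (F : M -> Y1) (G : Y1 -> M).
Hypotheses (F_cont : continuous F) (G_cont : continuous G).
Hypotheses (FK : cancel F G) (GK : cancel G F).

Definition ptE1 (e : E) : Y1 := into_set (pt1_cstar (set_typeP e.1) (set_typeP e.2)).
Definition ptE2 (e : E) : Y1 := into_set (pt2_cstar (set_typeP e.1) (set_typeP e.2)).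

Lemma cmul_cont (T : topologicalType) (f g : T -> C) :
  continuous f -> continuous g -> continuous (fun t => cmul (f t) (g t)).
Proof.
move=> cf cg; have [f1 f2] := (cont_fst cf, cont_snd cf).
have [g1 g2] := (cont_fst cg, cont_snd cg).
by apply: continuous_pair; [apply: contB|apply: contD]; exact: contM.
Qed.

Lemma cdiv_cont (T : topologicalType) (f g : T -> C) :
  continuous f -> continuous g -> (forall t, cstar (g t)) ->
  continuous (fun t => cdiv (f t) (g t)).
Proof.
move=> cf cg g0; have [f1 f2] := (cont_fst cf, cont_snd cf).
have [g1 g2] := (cont_fst cg, cont_snd cg).
have cn : continuous (fun t => (cnorm2 (g t))^-1).
  by apply: contV => [|t]; [apply: contD; exact: contM|exact: cnorm2_neq0].
by apply: continuous_pair; apply: contM cn; [apply: contD|apply: contB]; exact: contM.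
Qed.

Lemma ptE1_cont : continuous ptE1.
Proof.
apply: cont_into_set; apply: cmul_cont; first exact: cont_valE2.
have [c1 c2] := (cont_fst (@cont_valE1 R), cont_snd (@cont_valE1 R)).
by apply: continuous_pair; apply: contM; [apply: contD|..] => //; exact: contC.
Qed.

Lemma ptE2_cont : continuous ptE2.
Proof.
apply: cont_into_set; apply: cmul_cont; first exact: cont_valE2.
have [c1 c2] := (cont_fst (@cont_valE1 R), cont_snd (@cont_valE1 R)).
by apply: continuous_pair; apply: contM; [apply: contB|..] => //; exact: contC.
Qed.

Definition conf_fun (e : E) : {ptws 'I_2 -> M} :=
  fun i => if i == ord0 then G (ptE1 e) else G (ptE2 e).

Lemma pt_neq e : ptE1 e <> ptE2 e.
Proof.
move=> /(congr1 val) E12; have D := csub_pt (val e.1) (val e.2).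
have {}E12 : pt1 (val e.1) (val e.2) = pt2 (val e.1) (val e.2) := E12.
by apply: (set_typeP e.2); rewrite -D E12 /csub !subrr.
Qed.

Lemma conf_funP e : @config 2 M (conf_fun e).
Proof.
move=> i j ij; rewrite /conf_fun; case: eqP => i0; case: eqP => j0.
- by move/eqP: ij; rewrite i0 j0.
- by move/(can_inj GK); exact: pt_neq.
- by move/(can_inj GK)/esym; exact: pt_neq.
- by case: i j i0 j0 ij => [[|[|//]] ?] [[|[|//]] ?] i0 j0 /eqP ij;
    [case: i0|case: i0|case: j0|case: ij]; exact: val_inj.
Qed.

Definition conf (e : E) : set_type (@config 2 M) := into_set (@conf_funP e).

Lemma conf_cont : continuous conf.
Proof.
apply: cont_into_set; apply: cont_into_ptws => i; rewrite /conf_fun.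
by case: eqP => _; [apply: (continuous_compose ptE1_cont)|apply: (continuous_compose ptE2_cont)].
Qed.

Lemma config_neq (y : set_type (@config 2 M)) :
  val (F (val y ord0)) <> val (F (val y ord_max)).
Proof.
move=> /val_inj/(can_inj FK); apply: (set_typeP y); exact/eqP.
Qed.

Definition coordE (y : set_type (@config 2 M)) : E :=
  (into_set (coord_cstar2 (set_typeP (F (val y ord0))) (set_typeP (F (val y ord_max)))
     (@config_neq y)),
   into_set (csub_cstar (@config_neq y))).

Lemma coordE_cont : continuous coordE.
Proof.
have cF (i : 'I_2) : continuous (fun y : set_type (@config 2 M) => val (F (val y i))).
  apply: cont_val.
  apply: (@continuous_compose _ _ _ (fun y : set_type (@config 2 M) => val y i)) => //.
  apply: (@continuous_compose _ _ _ (val : set_type (@config 2 M) -> _) (fun f => f i)).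
    exact: val_set_cont.
  exact: cont_eval.
have cD : continuous (fun y : set_type (@config 2 M) =>
    csub (val (F (val y ord0))) (val (F (val y ord_max)))).
  by apply: continuous_pair; apply: contB; (exact: (cont_fst (cF _)) || exact: (cont_snd (cF _))).
have cA : continuous (fun y : set_type (@config 2 M) =>
    cadd (val (F (val y ord0))) (val (F (val y ord_max)))).
  by apply: continuous_pair; apply: contD; (exact: (cont_fst (cF _)) || exact: (cont_snd (cF _))).
apply: continuous_pair; apply: cont_into_set => //.
by apply: cdiv_cont => // y; apply: csub_cstar; exact: config_neq.
Qed.

Lemma coordEK : cancel coordE conf.
Proof.
move=> y; apply: val_inj; apply/funext => i /=; rewrite /conf_fun.
have p1 : ptE1 (coordE y) = F (val y ord0).
  by apply: val_inj; apply: pt1_coord; exact: config_neq.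
have p2 : ptE2 (coordE y) = F (val y ord_max).
  by apply: val_inj; apply: pt2_coord; exact: config_neq.
case: eqP => [->|i0]; first by rewrite p1 FK.
rewrite p2 FK; congr (val y _).
by case: i i0 => [[|[|//]] ?] i0; [case: i0|]; exact: val_inj.
Qed.

Lemma confK : cancel conf coordE.
Proof.
move=> [s d]; have [F1 F2] : val (F (val (conf (s, d)) ord0)) = pt1 (val s) (val d) /\
  val (F (val (conf (s, d)) ord_max)) = pt2 (val s) (val d).
  by rewrite /= /conf_fun /= !GK.
have dE : csub (val (F (val (conf (s, d)) ord0))) (val (F (val (conf (s, d)) ord_max))) = val d.
  by rewrite F1 F2 csub_pt.
rewrite /coordE; congr (_, _); apply: val_inj; last exact: dE.
rewrite -[LHS]/(cdiv (cadd _ _) (csub _ _)) dE F1 F2 cadd_pt cmulK//.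
exact: set_typeP.
Qed.

Lemma conf_neg e i : val (conf (negE e)) i = val (conf e) (if i == ord0 then ord_max else ord0).
Proof.
have N1 : ptE1 (negE e) = ptE2 e by apply: val_inj; exact: pt1N.
have N2 : ptE2 (negE e) = ptE1 e.
  by rewrite -[in RHS](negEK e); apply: val_inj; apply/esym; exact: pt1N.
by rewrite /= /conf_fun N1 N2; case: eqP.
Qed.

Local Notation Q := (quotient_topology {eq_quot (perm_equivrel 2 M)}).

Definition confP (e : E) : unordered_config 2 M := \pi_Q (conf e).

Lemma confP_cont : continuous confP.
Proof. by apply: (continuous_compose conf_cont); exact: pi_continuous. Qed.

Lemma confP_fiber e e' : confP e = confP e' <-> e' = e \/ e' = negE e.
Proof.
split.
  move=> /eqmodP/asboolP[s sE].
  have [s1|[s0 s1]] := perm_I2 s.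
    left; apply: (can_inj confK); apply: val_inj; apply/funext => i.
    by rewrite -[LHS]/(set_val _ i) sE s1.
  right; apply: (can_inj confK); apply: val_inj; apply/funext => i.
  rewrite -[LHS]/(set_val _ i) sE conf_neg.
  case: eqP => [->|i0]; first by rewrite s0.
  have -> : i = ord_max by case: i i0 => [[|[|//]] ?] i0; [case: i0|]; exact: val_inj.
  by rewrite s1.
case=> ->//; apply/eqmodP/asboolP; exists (tperm ord0 ord_max) => i.
rewrite -[LHS]/(val (conf (negE e)) i) conf_neg; congr (val (conf e) _).
case: eqP => [->|i0]; first by rewrite tpermL.
have -> : i = ord_max by case: i i0 => [[|[|//]] ?] i0; [case: i0|]; exact: val_inj.
by rewrite tpermR.
Qed.

Lemma confP_surj c : exists e, confP e = c.
Proof.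
by exists (coordE (repr (c : Q))); rewrite /confP coordEK; exact: (@reprK _ Q c).
Qed.

Lemma negE_cont : continuous (@negE R).
Proof.
have [c1 c2] := (@cont_valE1 R, @cont_valE2 R).
by apply: continuous_pair; apply: cont_into_set; apply: continuous_pair; apply: contN;
  (exact: cont_fst || exact: cont_snd).
Qed.

(** Openness in the quotient is openness of the saturation, which in coordinates is the union of [W]
    and its negative. *)
Lemma confP_open W : open W -> open (confP @` W).
Proof.
move=> Wo; rewrite /open /= /quotient_open.
have -> : \pi_Q @^-1` (confP @` W) = coordE @^-1` (W `|` (@negE R) @^-1` W).
  apply/seteqP; split=> [y [e We eE]|y].
    have /confP_fiber ee : confP e = confP (coordE y) by rewrite /confP coordEK.
    by case: ee => ee; [left|right]; rewrite /= ee ?negEK.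
  case=> /= Wy; last first.
    exists (negE (coordE y)) => //.
    by rewrite -[RHS](congr1 \pi_Q (coordEK y)); apply/esym/confP_fiber; right.
  by exists (coordE y) => //; rewrite /confP coordEK.
apply: open_comp => [y _|]; first exact: coordE_cont.
apply: openU => //; apply: open_comp => // y _; exact: negE_cont.
Qed.

Theorem gamma2_braid2 (c : unordered_config 2 M) :
  group_isomorphic (Gamma2 (braid_group R c)) (semidirect (conjZ (F2_b^-1 * F2_a)%g)).
Proof.
exact: (gamma2_pi1_cover confP_cont confP_open confP_surj confP_fiber).
Qed.

End ConfigurationCover.

(** * The twice punctured sphere *)

Section SphereChart.
Local Open Scope ring_scope.
Local Open Scope classical_set_scope.
Variable R : realType.
Local Notation C := (R * R)%type.
Local Notation V := 'rV[R]_3.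

Lemma cont_into_rV (T : topologicalType) n (f : T -> 'rV[R]_n) :
  (forall i, continuous (fun t => f t ord0 i)) -> continuous f.
Proof.
move=> cf t A [B nB BA].
suff : nbhs t [set s | forall i, B ord0 i (f s ord0 i)].
  by apply: filterS => s Bs; apply: BA => i j; rewrite ord1.
by apply: filter_forall => i; apply: cf; exact: nB.
Qed.

Definition crd (k : nat) (v : V) : R := v ord0 (inord k).

Definition row3 (a b c : R) : V := \row_i nth 0 [:: a; b; c] i.

Lemma crd_row3 a b c : (crd 0 (row3 a b c) = a) * (crd 1 (row3 a b c) = b) *
  (crd 2 (row3 a b c) = c).
Proof. by rewrite /crd !mxE !inordK. Qed.

Lemma eq_crd (u v : V) : crd 0 u = crd 0 v -> crd 1 u = crd 1 v -> crd 2 u = crd 2 v -> u = v.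
Proof.
rewrite /crd => e0 e1 e2; apply/rowP => i.
have -> : i = inord i by rewrite inord_val.
by case: i => [[|[|[|//]]] ?] /=.
Qed.

Lemma sum_crd (f : 'I_3 -> R) : \sum_i f i = f (inord 0) + f (inord 1) + f (inord 2).
Proof.
rewrite !big_ord_recl big_ord0 addr0 addrA.
by congr (f _ + f _ + f _); apply: val_inj; rewrite /= inordK.
Qed.

Lemma crd_cont k : continuous (crd k).
Proof. exact: coord_continuous. Qed.

Definition dot3 (u v : V) : R := crd 0 u * crd 0 v + crd 1 u * crd 1 v + crd 2 u * crd 2 v.

Lemma sphereP v : sphere2 R v <-> dot3 v v = 1.
Proof. by rewrite /sphere2 /= sum_crd /dot3 !expr2. Qed.

Lemma dot3_eq0 v : dot3 v v = 0 -> v = 0.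
Proof.
rewrite /dot3 => v0.
have [c0 c1 c2] : [/\ crd 0 v = 0, crd 1 v = 0 & crd 2 v = 0] by split; nra.
by apply: eq_crd; rewrite ?c0 ?c1 ?c2 /crd mxE.
Qed.

Variable w : V.

Definition refl_coef (v : V) : R := 2 * dot3 v w / dot3 w w.

(* The reflection in the plane orthogonal to w, and the identity for w = 0. *)
Definition refl (v : V) : V := v - refl_coef v *: w.

Lemma crd_refl k v : crd k (refl v) = crd k v - refl_coef v * crd k w.
Proof. by rewrite /refl /crd !mxE. Qed.

(** Both sides are 0 when [w] is 0, so the identities below can avoid dividing. *)
Lemma refl_coef_dot v : refl_coef v * dot3 w w = 2 * dot3 v w.
Proof.
rewrite /refl_coef; have [w0|w0] := eqVneq (dot3 w w) 0; last by rewrite divfK.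
rewrite w0 mulr0 (dot3_eq0 w0) /dot3 /crd !mxE; ring.
Qed.

Lemma dot3_refl v : dot3 (refl v) (refl v) = dot3 v v.
Proof.
have := refl_coef_dot v; rewrite {1}/dot3 [dot3 (refl v) _]/dot3 !crd_refl.
move: (refl_coef v) => k.
rewrite [dot3 v w]/dot3 /dot3 => E.
suff : k * (k * (crd 0 w * crd 0 w + crd 1 w * crd 1 w + crd 2 w * crd 2 w) -
  2 * (crd 0 v * crd 0 w + crd 1 v * crd 1 w + crd 2 v * crd 2 w)) = 0 by move=> E'; lra.
by rewrite E subrr mulr0.
Qed.

Lemma reflK : involutive refl.
Proof.
move=> v; have E := refl_coef_dot v.
have rN : refl_coef (refl v) = - refl_coef v.
  have [w0|w0] := eqVneq (dot3 w w) 0; first by rewrite /refl_coef w0 invr0 !mulr0 oppr0.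
  apply: (mulIf w0); rewrite refl_coef_dot mulNr E.
  rewrite [dot3 (refl v) w]/dot3 !crd_refl.
  move: E; move: (refl_coef v) => k; rewrite /dot3 => E; lra.
by rewrite {1}/refl rN scaleNr opprK /refl subrK.
Qed.

Lemma refl_cont : continuous refl.
Proof.
apply: cont_into_rV => i.
have -> : (fun v => refl v ord0 i) = (fun v : V => v ord0 i - refl_coef v * w ord0 i).
  by apply/funext => v; rewrite /refl !mxE.
apply: contB; first exact: coord_continuous.
apply: contM; last exact: contC.
apply: contM; last exact: contC.
apply: contM; first exact: contC.
by apply: contD; [apply: contD|]; apply: contM; (exact: crd_cont || exact: contC).
Qed.

End SphereChart.

(** * Stereographic projection and the chart onto C* *)

Section Stereographic.
Local Open Scope ring_scope.
Local Open Scope classical_set_scope.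
Variable R : realType.
Local Notation C := (R * R)%type.
Local Notation V := 'rV[R]_3.
Local Notation Y1 := (set_type (@cstar R)).

Definition north : V := row3 0 0 1.

(** [v] and [north] have equal length, so the reflection orthogonal to their difference exchanges
    them; for [v = north] it is the identity. *)
Lemma refl_north (v : V) : dot3 v v = 1 -> refl (v - north) v = north.
Proof.
move=> v1; have w0 := @refl_coef_dot R (v - north) v.
have crdB k : crd k (v - north) = crd k v - crd k north by rewrite /crd !mxE.
have E1 : dot3 (v - north) (v - north) = 2 * dot3 v (v - north).
  by move: v1; rewrite /dot3 !crdB /north !crd_row3; lra.
have [z|nz] := eqVneq (dot3 (v - north) (v - north)) 0.
  have /eqP := dot3_eq0 z; rewrite subr_eq0 => /eqP vn.
  by rewrite {1}vn subrr /refl scaler0 subr0.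
have -> : refl (v - north) v = v - (v - north).
  congr (_ - _); rewrite -[RHS]scale1r; congr (_ *: _).
  by apply: (mulIf nz); rewrite w0 mul1r E1.
by rewrite opprB addrC subrK.
Qed.

Definition stereo (u : V) : C := (crd 0 u / (1 - crd 2 u), crd 1 u / (1 - crd 2 u)).

Definition stereo_den (z : C) : R := 1 + z.1 * z.1 + z.2 * z.2.

Definition stereo_inv (z : C) : V :=
  row3 (2 * z.1 / stereo_den z) (2 * z.2 / stereo_den z) ((stereo_den z - 2) / stereo_den z).

Lemma stereo_den_gt0 z : 0 < stereo_den z.
Proof. by rewrite /stereo_den; nra. Qed.

Lemma stereo_den_neq0 z : stereo_den z != 0.
Proof. by rewrite gt_eqF// stereo_den_gt0. Qed.

Lemma stereo_invK z : stereo (stereo_inv z) = z.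
Proof.
have n0 := stereo_den_neq0 z.
rewrite /stereo /stereo_inv !crd_row3.
have -> : 1 - (stereo_den z - 2) / stereo_den z = 2 / stereo_den z by field.
by case: z n0 => a b n0; congr (_, _) => /=; field.
Qed.

Lemma stereo_inv_sphere z : dot3 (stereo_inv z) (stereo_inv z) = 1.
Proof.
have n0 := stereo_den_neq0 z; rewrite /dot3 /stereo_inv !crd_row3.
by move: n0; rewrite /stereo_den => n0; field.
Qed.

Lemma stereo_inv_north z : stereo_inv z <> north.
Proof.
move=> /(congr1 (crd 2)); rewrite /north /stereo_inv !crd_row3 => E.
have : stereo_den z - 2 = stereo_den z.
  by rewrite -[LHS](divfK (stereo_den_neq0 z)) E mul1r.
by lra.
Qed.

Lemma sphere_crd2 u : dot3 u u = 1 -> u <> north -> 1 - crd 2 u != 0.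
Proof.
move=> u1 un; apply/eqP => u2; apply: un.
have {}u2 : crd 2 u = 1 by lra.
by apply: eq_crd; rewrite /north !crd_row3 //; move: u1; rewrite /dot3 u2; nra.
Qed.

Lemma stereoK u : dot3 u u = 1 -> u <> north -> stereo_inv (stereo u) = u.
Proof.
move=> u1 un; have c0 := sphere_crd2 u1 un.
(* On the sphere u_0^2 + u_1^2 = (1 - u_2)(1 + u_2). *)
have n1 : stereo_den (stereo u) = 2 / (1 - crd 2 u).
  rewrite /stereo_den /stereo /=; apply: (mulIf c0); rewrite divfK//.
  apply: (mulIf c0); move: u1; rewrite /dot3 => u1.
  transitivity ((1 - crd 2 u) * (1 - crd 2 u) + crd 0 u * crd 0 u + crd 1 u * crd 1 u).
    by field.
  by lra.
by apply: eq_crd; rewrite /stereo_inv !crd_row3 n1 /stereo /=; field.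
Qed.

Variables x1 x2 : V.
Hypotheses (x1S : sphere2 R x1) (x2S : sphere2 R x2) (x12 : x1 <> x2).
Local Notation M := (punctured_sphere2 x1 x2).
Local Notation H := (refl (x2 - north)).

Lemma punctured_sphereP (v : M) : [/\ dot3 (val v) (val v) = 1, val v <> x1 & val v <> x2].
Proof.
have [/sphereP v1 vN] := set_typeP v.
by split=> // vx; apply: vN; [left|right].
Qed.

Lemma H_north v : H v = north -> v = x2.
Proof.
have E : H x2 = north by apply: refl_north; exact/sphereP.
by move=> Hv; apply: (inv_inj (@reflK R (x2 - north))); rewrite Hv E.
Qed.

Lemma chart_neq (v : M) : stereo (H (val v)) <> stereo (H x1).
Proof.
have [v1 vx1 vx2] := punctured_sphereP v.
have /sphereP x11 := x1S.
move=> /(congr1 stereo_inv); rewrite !stereoK ?dot3_refl//.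
- by move/(inv_inj (@reflK R (x2 - north))).
- by move/H_north.
- by move/H_north.
Qed.

(** The reflection [H] carries [x2] to the pole of projection, that is to infinity, and the
    translation puts the image of [x1] at 0. *)
Definition chart (v : M) : Y1 := into_set (csub_cstar (@chart_neq v)).

Definition unchart_fun (z : Y1) : V := H (stereo_inv (cadd (val z) (stereo (H x1)))).

Lemma unchart_funP z : (sphere2 R `\` [set x1; x2]) (unchart_fun z).
Proof.
split; first by apply/sphereP; rewrite dot3_refl stereo_inv_sphere.
case=> /= E.
  apply: (set_typeP z); have : cadd (val z) (stereo (H x1)) = stereo (H x1).
    rewrite -[LHS]stereo_invK; congr stereo.
    have : H (unchart_fun z) = H x1 by rewrite E.
    by rewrite /unchart_fun reflK.
  move=> zp; have := congr1 fst zp; have := congr1 snd zp.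
  by move=> /= z2 z1; split; lra.
apply: (@stereo_inv_north (cadd (val z) (stereo (H x1)))).
have : H (unchart_fun z) = H x2 by rewrite E.
by rewrite /unchart_fun reflK refl_north//; exact/sphereP.
Qed.

Definition unchart (z : Y1) : M := into_set (@unchart_funP z).

Lemma chartK : cancel chart unchart.
Proof.
move=> v; apply: val_inj; have [v1 vx1 vx2] := punctured_sphereP v.
rewrite /= /unchart_fun /=.
have -> : cadd (csub (stereo (H (val v))) (stereo (H x1))) (stereo (H x1)) = stereo (H (val v)).
  by rewrite /cadd /csub /= !subrK.
by rewrite stereoK ?reflK ?dot3_refl//; move/H_north.
Qed.

Lemma unchartK : cancel unchart chart.
Proof.
move=> z; apply: val_inj; rewrite /= /unchart_fun reflK stereo_invK.
by rewrite /cadd /csub /= !addrK -surjective_pairing.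
Qed.

Lemma chart_cont : continuous chart.
Proof.
apply: cont_into_set.
have cH : continuous (fun v : M => H (val v)).
  apply: (@continuous_compose _ _ _ (val : M -> V) H); first exact: val_set_cont.
  exact: refl_cont.
have cc k : continuous (fun v : M => crd k (H (val v))).
  by apply: (continuous_compose cH); exact: crd_cont.
have ci : continuous (fun v : M => (1 - crd 2 (H (val v)))^-1).
  apply: contV => [|v]; first by apply: contB => //; exact: contC.
  have [v1 vx1 vx2] := punctured_sphereP v.
  by apply: sphere_crd2; [rewrite dot3_refl|move/H_north].
by apply: continuous_pair; apply: contB; (exact: contC || exact: contM).
Qed.

Lemma unchart_cont : continuous unchart.
Proof.
apply: cont_into_set.
have ca : continuous (fun z : Y1 => cadd (val z) (stereo (H x1))).
  have cv : continuous (val : Y1 -> C) := @val_set_cont _ _.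
  by apply: continuous_pair; apply: contD; (exact: contC || exact: cont_fst || exact: cont_snd).
apply: (@continuous_compose _ _ _ _ (fun u => H (stereo_inv u)) ca).
apply: (@continuous_compose _ _ _ stereo_inv H); last exact: refl_cont.
have [cf cs] := (@fst_cont R, @snd_cont R).
have cd : continuous stereo_den.
  by apply: contD; [apply: contD; [exact: contC|]|]; exact: contM.
have ci : continuous (fun z : C => (stereo_den z)^-1).
  by apply: contV => // z; exact: stereo_den_neq0.
apply: cont_into_rV => i.
have -> : (fun z => stereo_inv z ord0 i) = (fun z =>
    nth 0 [:: 2 * z.1 / stereo_den z; 2 * z.2 / stereo_den z;
      (stereo_den z - 2) / stereo_den z] i).
  by apply/funext => z; rewrite /stereo_inv /row3 mxE.
case: i => [[|[|[|//]]] ?] /=; apply: contM => //.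
- by apply: contM => //; exact: contC.
- by apply: contM => //; exact: contC.
- by apply: contB => //; exact: contC.
Qed.

End Stereographic.

Theorem corollary13 (R : realType) (x1 x2 : 'rV[R]_3)
    (hx1 : sphere2 R x1) (hx2 : sphere2 R x2) (hx12 : x1 <> x2)
    (c : unordered_config 2 (punctured_sphere2 x1 x2)) :
  group_isomorphic
    (Gamma2 (braid_group R c))
    (semidirect (conjZ (F2_b^-1 * F2_a)%g)).
Proof.
exact: (gamma2_braid2 (@chart_cont _ _ _ hx1 hx2 hx12) (@unchart_cont _ _ _ hx2)
  (@chartK _ _ _ hx1 hx2 hx12) (@unchartK _ _ _ hx1 hx2 hx12)).
Qed.
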